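(* Let $n\ge1$, let $\mathbb B_n=\{z\in\mathbb C^n:|z|<1\}$ and let $\lambda$ be the measure on $\mathbb B_n$ with density $(1-|z|^2)^{-(n+1)}$ with respect to Lebesgue measure. Let $\Omega\subset\mathbb B_n$ be an open connected set containing the origin $0$ such that: (i) $\lambda(\Omega)<\infty$; (ii) for every compact set $K\subset\mathbb B_n$, $\displaystyle\sup_{z\in K}\int_\Omega|\xi-z|^{1-2n}\,d\lambda(\xi)<+\infty$; (iii) $\displaystyle\lim_{r\to1^-}(1-r^2)^{n-2}\sup_{z\in\Omega\cap\{|z|=r\}}\int_\Omega|\xi-z|^{1-2n}\,d\lambda(\xi)=0$; (iv) $\partial\Omega\cap\mathbb B_n=\partial\overline\Omega\cap\mathbb B_n$. Suppose that for every function $f$ which is $M$-harmonic in a neighbourhood of $\overline\Omega\cap\mathbb B_n$ and $\lambda$-integrable on $\Omega$, one has $$\frac1{\lambda(\Omega)}\int_\Omega f\,d\lambda=f(0).$$ Then $\Omega$ is a ball centered at $0$; equivalently, there exists $0<R<1$ such that $\Omega=\{z\in\mathbb B_n:|z|<R\}$.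
   Context: A complex-valued function $f\in C^2(U)$, $U\subset\mathbb B_n$ open, is $M$-harmonic (invariantly harmonic) on $U$ if $\widetilde\Delta f=0$ on $U$, where $\widetilde\Delta$ is the invariant Laplacian (Laplace–Beltrami operator of the Bergman metric, up to a constant factor): $$\widetilde\Delta f(z)=4(1-|z|^2)\sum_{i,j=1}^n(\delta_{ij}-z_i\overline{z_j})\frac{\partial^2 f}{\partial z_i\,\partial\overline{z_j}}(z).$$ Here $\overline\Omega$ is the Euclidean closure in $\mathbb C^n$, and ''neighbourhood of $\overline\Omega\cap\mathbb B_n$'' means an open subset of $\mathbb B_n$ containing $\overline\Omega\cap\mathbb B_n$. The supremum over an empty set of nonnegative quantities is taken to be $0$. *)

(* Defs.v *)
From HB Require Import structures.
From mathcomp Require Import all_boot all_order all_algebra.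
From mathcomp Require Import all_classical all_reals all_analysis.
From mathcomp Require Import measurable_realfun complex.
Set Implicit Arguments.
Unset Strict Implicit.
Unset Printing Implicit Defensive.
Import Order.TTheory GRing.Theory Num.Theory.
Import numFieldNormedType.Exports.
Local Open Scope classical_set_scope.
Local Open Scope ring_scope.
Local Open Scope complex_scope.

(* The alias R[i]^o carries the topology of the norm of R[i], and 'rV[R[i]^o]_n
   the product topology, i.e. the Euclidean topology of C^n. *)
Notation Cn R n := 'rV[R[i]^o]_n.

(* C^n is given the product sigma-algebra of R^(2n), as n.-tuple T is in the
   library; by second countability this is the Borel sigma-algebra. *)
Fact Cn_display : measure_display. Proof. exact: default_measure_display. Qed.

Section measurable_Cn.
Variables (R : realType) (n : nat).

Definition Cn_coord (i : 'I_n) (z : Cn R n) :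
    measurableTypeR R * measurableTypeR R :=
  (complex.Re (z 0 i), complex.Im (z 0 i)).

Let Cn_set0 : g_sigma_preimage Cn_coord set0.
Proof. exact: sigma_algebra0. Qed.

Let Cn_setC A : g_sigma_preimage Cn_coord A -> g_sigma_preimage Cn_coord (~` A).
Proof. exact: sigma_algebraC. Qed.

Let Cn_bigcup (F : (set (Cn R n))^nat) :
  (forall i, g_sigma_preimage Cn_coord (F i)) ->
  g_sigma_preimage Cn_coord (\bigcup_i (F i)).
Proof. exact: sigma_algebra_bigcup. Qed.

HB.instance Definition _ := @isMeasurable.Build Cn_display (Cn R n)
  (g_sigma_preimage Cn_coord) Cn_set0 Cn_setC Cn_bigcup.

Lemma measurable_Cn_coord i : measurable_fun [set: Cn R n] (Cn_coord i).
Proof.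
move=> _ Y mY; rewrite setTI; apply: sub_sigma_algebra => /=.
rewrite -bigcup_seq/=; exists i => /=; first by rewrite mem_index_enum.
by exists Y => //; rewrite setTI.
Qed.

Lemma measurable_Cn_Re i :
  measurable_fun [set: Cn R n] (fun z : Cn R n => complex.Re (z 0 i) : R).
Proof. exact: (measurableT_comp measurable_fst (measurable_Cn_coord i)). Qed.

Lemma measurable_Cn_Im i :
  measurable_fun [set: Cn R n] (fun z : Cn R n => complex.Im (z 0 i) : R).
Proof. exact: (measurableT_comp measurable_snd (measurable_Cn_coord i)). Qed.

Lemma measurable_fun_CnP d (T : measurableType d) (f : T -> Cn R n) :
  measurable_fun [set: T] f <->
  forall i, measurable_fun [set: T] (Cn_coord i \o f).
Proof.
split=> [mf i|mf]; first exact: measurableT_comp (measurable_Cn_coord i) mf.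
suff prefS : g_sigma_preimage (fun i => Cn_coord i \o f) `<=` measurable.
  by move=> _ A mA; apply: prefS; rewrite g_sigma_preimage_comp; exists A.
apply: smallest_sub; first exact: sigma_algebra_measurable.
rewrite -bigcup_seq => A [i /= _] [B mB <-]; exact: mf.
Qed.

End measurable_Cn.

(* The canonical sigma-finite structure of a product measure in the library is
   restricted to finite factors. *)
Lemma sigma_finite_prod d1 d2 (T1 : measurableType d1) (T2 : measurableType d2)
    (R : realType) (m1 : {sigma_finite_measure set T1 -> \bar R})
    (m2 : {sigma_finite_measure set T2 -> \bar R}) :
  sigma_finite setT (m1 \x m2)%E.
Proof.
have /sigma_finiteP[F [TF ndF mF]] := sigma_finiteT m1.
have /sigma_finiteP[G [TG ndG mG]] := sigma_finiteT m2.
exists (fun n => F n `*` G n).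
  rewrite -setXTT TF TG predeqE => -[x y]; split.
    move=> [/= [n _ Fnx] [k _ Gky]]; exists (maxn n k) => //; split.
    - by move: x Fnx; exact/subsetPset/ndF/leq_maxl.
    - by move: y Gky; exact/subsetPset/ndG/leq_maxr.
  by move=> [n _ []/= ? ?]; split; exists n.
move=> k; have [mFk Fk] := mF k; have [mGk Gk] := mG k.
split; first exact: measurableX.
by rewrite product_measure1E// lte_mul_pinfty// ge0_fin_numE.
Qed.

(* Lebesgue measure on C^n = (R^2)^n, as an iterated product measure. *)
Section lebesgue_Cn.
Variable R : realType.

Let RR := (measurableTypeR R * measurableTypeR R)%type.

Definition lebesgue_RR : set RR -> \bar R :=
  (lebesgue_measure \x lebesgue_measure)%E.

HB.instance Definition _ := Measure.on lebesgue_RR.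
HB.instance Definition _ := Measure_isSigmaFinite.Build _ _ _ lebesgue_RR
  (sigma_finite_prod lebesgue_measure lebesgue_measure).

Definition Cn_cons n (p : RR * Cn R n) : Cn R n.+1 :=
  row_mx (\row_(_ < 1) (p.1.1 +i* p.1.2)) p.2.

Definition Cn_uncons n (z : Cn R n.+1) : RR * Cn R n :=
  (Cn_coord 0 z, \row_i z 0 (lift 0 i)).

Lemma Cn_cons_0 n (p : RR * Cn R n) : Cn_cons p 0 0 = p.1.1 +i* p.1.2.
Proof.
have -> : (0 : 'I_n.+1) = lshift n (0 : 'I_1) by exact/val_inj.
by rewrite [LHS](@row_mxEl _ 1 1 n) mxE.
Qed.

Lemma Cn_cons_lift n (p : RR * Cn R n) i : Cn_cons p 0 (lift 0 i) = p.2 0 i.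
Proof.
rewrite (_ : lift 0 i = rshift 1 i); last exact/val_inj.
by rewrite [LHS](@row_mxEr _ 1 1 n).
Qed.

Lemma Cn_coord_cons0 n (p : RR * Cn R n) : Cn_coord 0 (Cn_cons p) = p.1.
Proof. by rewrite /Cn_coord Cn_cons_0; case: p => -[]. Qed.

Lemma Cn_consK n : cancel (@Cn_cons n) (@Cn_uncons n).
Proof.
move=> p; rewrite /Cn_uncons Cn_coord_cons0.
case: p => c z; congr pair; apply/rowP => i.
by rewrite mxE Cn_cons_lift.
Qed.

Lemma measurable_Cn_cons n : measurable_fun setT (@Cn_cons n).
Proof.
apply/measurable_fun_CnP => i; case: (unliftP ord0 i) => [j|] ->.
  rewrite (_ : _ \o _ = Cn_coord j \o snd).
    exact: measurableT_comp (measurable_Cn_coord j) measurable_snd.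
  by apply/funext => p; rewrite /Cn_coord /= Cn_cons_lift.
rewrite (_ : _ \o _ = fst); first exact: measurable_fst.
by apply/funext => p; rewrite /= Cn_coord_cons0.
Qed.

Lemma measurable_Cn_uncons n : measurable_fun setT (@Cn_uncons n).
Proof.
apply/measurable_fun_pair; first exact: measurable_Cn_coord.
apply/measurable_fun_CnP => i.
rewrite (_ : _ \o _ = Cn_coord (lift 0 i)); first exact: measurable_Cn_coord.
by apply/funext => z; rewrite /Cn_coord /= mxE.
Qed.

Section step.
Local Open Scope ereal_scope.
Variables (n : nat) (m : {sigma_finite_measure set (Cn R n) -> \bar R}).

Definition lebesgue_Cn_step : set (Cn R n.+1) -> \bar R :=
  pushforward (lebesgue_RR \x m) (@Cn_cons n).

Let step0 : lebesgue_Cn_step set0 = 0.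
Proof. by rewrite /lebesgue_Cn_step /pushforward preimage_set0 measure0. Qed.

Let step_ge0 A : 0 <= lebesgue_Cn_step A.
Proof. by rewrite /lebesgue_Cn_step /pushforward measure_ge0. Qed.

Let step_sigma_additive : semi_sigma_additive lebesgue_Cn_step.
Proof.
move=> F mF tF mUF; rewrite /lebesgue_Cn_step /pushforward preimage_bigcup.
have mcons A : measurable A -> measurable (@Cn_cons n @^-1` A).
  by move=> mA; rewrite -[X in measurable X]setTI; exact: measurable_Cn_cons.
apply: measure_semi_sigma_additive.
- by move=> k; exact: mcons.
- apply/trivIsetP => /= i j _ _ ij; rewrite -preimage_setI.
  by move/trivIsetP : tF => /(_ _ _ _ _ ij) ->//; rewrite preimage_set0.
- by rewrite -preimage_bigcup; exact: mcons.
Qed.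

HB.instance Definition _ := isMeasure.Build _ _ _ lebesgue_Cn_step
  step0 step_ge0 step_sigma_additive.

Let step_sigma_finite : sigma_finite setT lebesgue_Cn_step.
Proof.
have [F FT mF] := sigma_finite_prod lebesgue_RR m.
exists (fun k => @Cn_uncons n @^-1` F k).
  by rewrite -preimage_bigcup -FT preimage_setT.
move=> k; have [mFk Fk] := mF k; split.
  by rewrite -[X in measurable X]setTI; exact: measurable_Cn_uncons.
rewrite /lebesgue_Cn_step /pushforward -comp_preimage.
by rewrite (_ : _ \o _ = id)//; apply/funext => p; exact: Cn_consK.
Qed.

HB.instance Definition _ := Measure_isSigmaFinite.Build _ _ _ lebesgue_Cn_step
  step_sigma_finite.

End step.

Fixpoint lebesgue_Cn (n : nat) : {sigma_finite_measure set (Cn R n) -> \bar R} :=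
  match n with
  | 0 => \d_(0 : Cn R 0)
  | n'.+1 => lebesgue_Cn_step (lebesgue_Cn n')
  end.

End lebesgue_Cn.

Section ball.
Variables (R : realType) (n : nat).
Implicit Types z : Cn R n.

Definition enorm z : R :=
  Num.sqrt (\sum_i (complex.Re (z 0 i) ^+ 2 + complex.Im (z 0 i) ^+ 2)).

Lemma enorm_ge0 z : 0 <= enorm z. Proof. exact: sqrtr_ge0. Qed.

Definition unit_ball : set (Cn R n) := [set z | enorm z < 1].

Lemma measurable_enorm : measurable_fun [set: Cn R n] enorm.
Proof.
apply: (measurableT_comp (f := @Num.sqrt R)).
  apply: measurable_realfun.continuous_measurable_fun; exact: sqrt_continuous.
apply: measurable_sum => i; apply: measurable_funD; apply: measurable_funX.
  exact: measurable_Cn_Re.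
exact: measurable_Cn_Im.
Qed.

Lemma measurable_unit_ball : measurable unit_ball.
Proof.
rewrite -[unit_ball]setTI (_ : unit_ball = enorm @^-1` [set x | x < 1])//.
by apply: measurable_enorm => //; rewrite -set_itvNyo.
Qed.

End ball.
Arguments unit_ball R n z : clear implicits.

(* The measure (1 - |z|^2)^-(n+1) dz on the unit ball, regarded as a measure on
   C^n that vanishes off the ball. *)
Section invariant_measure.
Variables (R : realType) (n : nat).
Local Open Scope ereal_scope.

Definition invariant_density (z : Cn R n) : R :=
  ((1 - enorm z ^+ 2) ^- n.+1)%R.

Definition invariant_measure (A : set (Cn R n)) : \bar R :=
  \int[lebesgue_Cn R n]_(z in A `&` unit_ball R n) (invariant_density z)%:E.

Lemma invariant_density_ge0 (z : Cn R n) :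
  unit_ball R n z -> 0 <= (invariant_density z)%:E.
Proof.
rewrite /unit_ball/= => z1; rewrite lee_fin invr_ge0 exprn_ge0// subr_ge0.
by rewrite expr_le1 ?enorm_ge0// ltW.
Qed.

Lemma measurable_invariant_density :
  measurable_fun (unit_ball R n) invariant_density.
Proof.
have -> : invariant_density =
    (fun x : R => x ^- n.+1)%R \o (fun z => 1 - enorm z ^+ 2)%R by [].
apply: (measurable_comp (F := [set x : R | (0 < x)%R])).
- by rewrite -set_itvoy.
- move=> _ [z z1 <-] /=; by rewrite subr_gt0 expr_lt1 ?enorm_ge0.
- apply: open_continuous_measurable_fun; first exact: open_gt.
  move=> x; rewrite inE/= => x0.
  apply: (@continuousV R R (fun x => x ^+ n.+1)%R).
    by rewrite expf_neq0// gt_eqF.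
  exact: exprn_continuous.
- apply: measurable_funTS; apply: measurable_funB => //.
  by apply: measurable_funX; exact: measurable_enorm.
Qed.

Let invariant_measure0 : invariant_measure set0 = 0.
Proof. by rewrite /invariant_measure set0I integral_set0. Qed.

Let invariant_measure_ge0 A : 0 <= invariant_measure A.
Proof. by apply: integral_ge0 => z [_]; exact: invariant_density_ge0. Qed.

Let invariant_measure_sigma_additive : semi_sigma_additive invariant_measure.
Proof.
move=> F mF tF mUF; rewrite /invariant_measure setI_bigcupl; apply: cvg_toP.
  apply: ereal_nondecreasing_is_cvgn => m k mk.
  apply: lee_sum_nneg_natr => // j _ _; exact: invariant_measure_ge0.
rewrite ge0_integral_bigcup//=.
- by move=> k; apply: measurableI => //; exact: measurable_unit_ball.
- apply/measurable_EFinP; rewrite -setI_bigcupl.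
  apply: measurable_funS measurable_invariant_density => //.
  exact: measurable_unit_ball.
- by move=> z [k _ [_]]; exact: invariant_density_ge0.
- exact: trivIset_setIr.
Qed.

HB.instance Definition _ := isMeasure.Build _ _ _ invariant_measure
  invariant_measure0 invariant_measure_ge0 invariant_measure_sigma_additive.

End invariant_measure.
Arguments invariant_measure R n A : clear implicits.

Section M_harmonic.
Variables (R : realType) (n : nat).
Implicit Types (f : Cn R n -> R[i]^o) (U : set (Cn R n)) (v z : Cn R n).

Definition real_line z v (t : R) : Cn R n := z + (t%:C : R[i]^o) *: v.

Definition real_derivable f v z : Prop :=
  derivable (fun t : R => complex.Re (f (real_line z v t)) : R) 0 1 /\
  derivable (fun t : R => complex.Im (f (real_line z v t)) : R) 0 1.

Definition real_deriv v f z : R[i]^o :=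
  derive1 (fun t : R => complex.Re (f (real_line z v t)) : R) 0 +i*
  derive1 (fun t : R => complex.Im (f (real_line z v t)) : R) 0.

(* The 2n real coordinate directions of C^n = R^(2n). *)
Definition e_x (i : 'I_n) : Cn R n := delta_mx 0 i.
Definition e_y (i : 'I_n) : Cn R n := ('i : R[i]^o) *: delta_mx 0 i.

Fixpoint Ck (k : nat) U f : Prop :=
  (forall z, U z -> {for z, continuous f}) /\
  match k with
  | 0 => True
  | k'.+1 => forall i,
      [/\ forall z, U z -> real_derivable f (e_x i) z,
          forall z, U z -> real_derivable f (e_y i) z,
          Ck k' U (real_deriv (e_x i) f) &
          Ck k' U (real_deriv (e_y i) f)]
  end.

Definition d_z (i : 'I_n) f z : R[i]^o :=
  2%:R^-1 * (real_deriv (e_x i) f z - 'i * real_deriv (e_y i) f z).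

Definition d_zbar (i : 'I_n) f z : R[i]^o :=
  2%:R^-1 * (real_deriv (e_x i) f z + 'i * real_deriv (e_y i) f z).

Definition invariant_laplacian f z : R[i] :=
  4%:R * (1 - enorm z ^+ 2)%:C *
  \sum_(i < n) \sum_(j < n)
    ((i == j)%:R - z 0 i * (z 0 j)^*) * d_z i (d_zbar j f) z.

Definition M_harmonic U f : Prop :=
  [/\ open U, U `<=` unit_ball R n, Ck 2 U f &
      forall z, U z -> invariant_laplacian f z = 0].

End M_harmonic.

Section mean_value.
Variables (R : realType) (n : nat).
Implicit Types (f : Cn R n -> R[i]^o) (A D : set (Cn R n)).
Local Notation lam := (invariant_measure R n).

Definition boundary A : set (Cn R n) := closure A `\` A°.

Definition complex_integrable D f : Prop :=
  lam.-integrable D (fun z => (complex.Re (f z))%:E) /\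
  lam.-integrable D (fun z => (complex.Im (f z))%:E).

Definition complex_integral D f : R[i] :=
  (\int[lam]_(z in D) complex.Re (f z)) +i*
  (\int[lam]_(z in D) complex.Im (f z)).

(* The value of the integrand at xi = z is irrelevant, {z} being a null set. *)
Definition potential D (z : Cn R n) : \bar R :=
  \int[lam]_(xi in D) (enorm (xi - z) ^ (1 - 2 * n%:Z))%:E.

(* The supremum of the potential of D over A, equal to 0 when A is empty
   (ereal_sup set0 is -oo). *)
Definition sup_potential D A : \bar R :=
  Order.max 0%E (ereal_sup (potential D @` A)).

End mean_value.

(* Main.v *)
(* Kuran's argument.  Let r be maximal such that B = {|z|^2 < r} lies in Omega;
   finiteness of the measure gives r < 1.  For y outside the closure of Omega,
   close to the sphere |z|^2 = r, take a combination f of the invariant Green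
   function with pole y and of its radial derivative in y.  It is M-harmonic off
   y, and f >= f(0) + a outside the ball |z| < |y|, with a > 0 bounded below;
   inside that ball the bound fails by at most C (|y| - |z|) |z - y|^(-2n).
   By the mean value properties of Omega and of a slightly smaller concentric
   ball B', the integral of f - f(0) over E = Omega \ B' vanishes.  The deficit on
   E is supported in a thin shell, and it is at most C |z - y|^(1-2n), which is
   integrable uniformly in y; so its integral tends to 0 as y approaches the
   sphere and B' approaches B.  Hence Omega \ B is a null set, and it cannot be
   one if Omega reaches past B.  Hypothesis (iv) provides the points y. *)

(* In Kuran's Euclidean proof the pole lies on the sphere itself. Here the test function must be
   M-harmonic near every point of the closure of Omega in the ball, so y can only approach the
   sphere, and estimates uniform in y replace a single exact inequality. Exterior points may still
   satisfy |y|^2 = r, which is why the ball whose mean value is subtracted has radius strictly below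
   |y|. The gain a comes from the origin. The radial derivative is bounded below by a function of q
   minus a nonnegative term supported in |z| < |y|; together with the Green function this function
   of q is smallest at q = 1, and a is the discarded term at z = 0, where the bound is an equality.
   The mean value property of balls is obtained without automorphisms or spherical means: a vector
   field built from u vanishes on the sphere and has divergence u times a radial density, so that
   density annihilates u; it is the difference of the invariant density and one that concentrates at
   0. In the final estimate the distance del to the pole is fixed first, to make the singular part
   small; the shell thickness is chosen afterwards, depending on del. *)
Require Import Defs.
From HB Require Import structures.
From mathcomp Require Import all_boot all_order all_algebra.
From mathcomp Require Import all_classical all_reals all_analysis.
From mathcomp Require Import measurable_realfun complex ring lra.
Set Implicit Arguments.
Unset Strict Implicit.
Unset Printing Implicit Defensive.
Import Order.TTheory GRing.Theory Num.Theory.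
Import numFieldNormedType.Exports.
Local Open Scope classical_set_scope.
Local Open Scope ring_scope.
Local Open Scope complex_scope.

(** * Real coordinates of C^n *)

(* The 2n real directions are indexed by 'I_n * bool: (i, false) stands for
   Re z_i and (i, true) for Im z_i.  X and line are locked because unification
   otherwise unfolds the topology of C^n. *)
HB.lock Definition X {R : realType} {n : nat} (d : 'I_n * bool) (z : Cn R n) : R :=
  if d.2 then complex.Im (z 0 d.1) else complex.Re (z 0 d.1).

HB.lock Definition line {R : realType} {n : nat} (z v : Cn R n) (t : R) : Cn R n :=
  real_line z v t.

Section coordinates.
Context {R : realType} {n : nat}.
Implicit Types (z w : Cn R n) (d e : 'I_n * bool).

Definition dir d : Cn R n := if d.2 then e_y R d.1 else e_x R d.1.
(* The d-th real coordinate of 'i z. *)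
Definition JX d z : R := if d.2 then X (d.1, false) z else - X (d.1, true) z.

Lemma sum_dir (V : nmodType) (F : 'I_n * bool -> V) :
  \sum_d F d = \sum_i (F (i, false) + F (i, true)).
Proof.
rewrite (eq_bigr (fun d => F (d.1, d.2))); last by case.
rewrite -(pair_bigA _ (fun i b => F (i, b)))/=; apply: eq_bigr => i _.
by rewrite big_bool addrC.
Qed.

Definition sqn z : R := \sum_d X d z ^+ 2.

Lemma sqn_ge0 z : 0 <= sqn z.
Proof. by apply: sumr_ge0 => d _; rewrite sqr_ge0. Qed.

Lemma enormE z : enorm z = Num.sqrt (sqn z).
Proof. by rewrite /enorm /sqn sum_dir X.unlock. Qed.

Lemma sqr_enorm z : enorm z ^+ 2 = sqn z.
Proof. by rewrite enormE sqr_sqrtr ?sqn_ge0. Qed.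

Lemma XB d z w : X d (z - w) = X d z - X d w.
Proof. by rewrite X.unlock !mxE; case: ifP => _; rewrite raddfB. Qed.

Lemma XD d z w : X d (z + w) = X d z + X d w.
Proof. by rewrite X.unlock !mxE; case: ifP => _; rewrite raddfD. Qed.

Lemma XZ d (t : R) z : X d ((t%:C : R[i]^o) *: z) = t * X d z.
Proof.
rewrite X.unlock !mxE/=; case: (z 0 d.1) => a b /=.
by case: ifP => _; rewrite /= ?mul0r ?subr0 ?addr0.
Qed.

Lemma X0 d : X d (0 : Cn R n) = 0.
Proof. by rewrite X.unlock !mxE; case: ifP. Qed.

Lemma X_dir d e : X d (dir e) = (d == e)%:R.
Proof.
case: d e => [i a] [j b]; rewrite X.unlock /dir /e_x /e_y xpair_eqE /=.
case: a; case: b => /=; rewrite !mxE eqxx /= ?andbT ?andbF; case: eqVneq => //= _; rewrite ?mulr1 ?mulr0 //= ?addr0 ?add0r ?oppr0 //.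
Qed.

Lemma X_line d z v t : X d (line z v t) = X d z + t * X d v.
Proof. by rewrite line.unlock XD XZ. Qed.

Lemma JX_line d z v t : JX d (line z v t) = JX d z + t * JX d v.
Proof. by rewrite /JX; case: ifP => _; rewrite X_line// opprD mulrN. Qed.

Lemma CnP z w : (forall d, X d z = X d w) -> z = w.
Proof.
move=> zw; apply/rowP => i; have /= := zw (i, false); have /= := zw (i, true).
by rewrite X.unlock /=; case: (z 0 i) (w 0 i) => [a b] [c e] /= -> ->.
Qed.

Definition cube z (r : R) : set (Cn R n) := [set w | forall d, `|X d w - X d z| < r].

(** Balls of [Cn R n] have radii in R[i], and a positive element of R[i] has zero imaginary part, so
    its real part serves as radius. Half of it suffices on each real coordinate, since x^2/4 + x^2/4
    < x^2. *)
Lemma nbhs_CnP z (A : set (Cn R n)) :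
  nbhs z A <-> exists2 r : R, 0 < r & cube z r `<=` A.
Proof.
split=> [/nbhs_ballP[e /= e0 eA]|[r r0 rA]].
- move: e0; rewrite ltcE /= => /andP[/eqP ie0 re0].
  exists (complex.Re e / 2) => [|w zw]; first by rewrite divr_gt0.
  apply: eA; split; first by rewrite ltcE /= ie0 eqxx.
  move=> i j; rewrite -ball_normE /ball_ /= (ord1 i) normc_def ltcE /= ie0 eqxx /=.
  have := zw (j, false); have := zw (j, true); rewrite X.unlock /=.
  case: (z 0 j) (w 0 j) => [a b] [c d] /=; rewrite distrC => h1; rewrite distrC => h2.
  rewrite -(ger0_norm (ltW re0)) -sqrtr_sqr ltr_sqrt; last by rewrite exprn_gt0.
  move: h1 h2; set x := complex.Re e in re0 *; rewrite !ltr_norml => /andP[h1 h2] /andP[h3 h4].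
  nra.
- apply/nbhs_ballP; exists r%:C => /=; first by rewrite ltcR.
  move=> w [_ zw]; apply: rA => -[j b].
  have := zw 0 j; rewrite -ball_normE /ball_ /= => h.
  rewrite -ltcR; apply: le_lt_trans h; rewrite X.unlock /=.
  rewrite distrC; case: b => /=; rewrite -raddfB /=.
    case: (z 0 j - w 0 j) => a b; rewrite normc_def lecR /= -sqrtr_sqr.
    by rewrite ler_wsqrtr // lerDr sqr_ge0.
  exact: normc_ge_Re.
Qed.
End coordinates.

Lemma sum_delta (R : pzRingType) (I : finType) (i : I) (F : I -> R) :
  \sum_j F j * (j == i)%:R = F i.
Proof.
rewrite (bigD1 i) //= eqxx mulr1 big1 => [|j /negbTE ->]; first exact: addr0.
exact: mulr0.
Qed.

(** * Calculus along the 2n real directions *)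

Section partial_derivatives.
Context {R : realType} {n : nat}.
Implicit Types (z v : Cn R n) (d e : 'I_n * bool) (U V : set (Cn R n)).

(** [cont] and [pd] are records, hence opaque to unification, with a coercion that lets a proof be
    applied at a point. [pd] names the derivative explicitly, so that second derivatives are
    derivatives of explicit functions. *)
Record cont U (u : Cn R n -> R) : Prop := Cont {
  contP :> forall z, U z -> {for z, continuous u} }.

Record pd d U (u u' : Cn R n -> R) : Prop := Pd {
  pdP :> forall z, U z -> is_derive (0 : R) 1 (fun t : R => u (line z (dir d) t)) (u' z) }.

Lemma continuous_X d : continuous (X d : Cn R n -> R).
Proof.
move=> z A /nbhs_ballP[e /= e0 eA]; apply/nbhs_CnP; exists e => // y /(_ d) zw.
by apply: eA; rewrite -ball_normE /= distrC.
Qed.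

Lemma continuous_line z v : continuous (line z v : R -> Cn R n).
Proof.
move=> t A /nbhs_CnP[r r0 rA].
pose m := \sum_d `|X d v| + 1.
have m0 : 0 < m by rewrite ltr_wpDl ?sumr_ge0.
apply/nbhs_ballP; exists (r / m) => /=; first by rewrite divr_gt0.
move=> s ts; apply: rA => d.
have -> : X d (line z v s) - X d (line z v t) = (s - t) * X d v by rewrite !X_line; ring.
rewrite normrM.
move: ts; rewrite -ball_normE /= distrC ltr_pdivlMr //; apply: le_lt_trans.
apply: ler_wpM2l => //; rewrite /m (bigD1 d) //= -addrA lerDl addr_ge0 ?sumr_ge0 //.
Qed.

Lemma line0 z v : line z v 0 = z.
Proof. by apply: CnP => d; rewrite X_line mul0r addr0. Qed.

Lemma lineD z v (s t : R) : line (line z v s) v t = line z v (s + t).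
Proof. by apply: CnP => d; rewrite !X_line mulrDl addrA. Qed.

Lemma cont_cst U (a : R) : cont U (fun=> a).
Proof. by split=> z _; exact: cst_continuous. Qed.

Lemma cont_X U d : cont U (X d).
Proof. by split=> z _; exact: continuous_X. Qed.

Lemma contD U u w : cont U u -> cont U w -> cont U (fun z => u z + w z).
Proof. by move=> cu cw ; split=> z Uz; exact: (@continuousD R R^o _ u w z (cu z Uz) (cw z Uz)). Qed.

Lemma contN U u : cont U u -> cont U (fun z => - u z).
Proof. by move=> cu ; split=> z Uz; exact: (@continuousN R R^o _ u z (cu z Uz)). Qed.

Lemma cont_JX U d : cont U (JX d).
Proof. by case: d => i []; [exact: cont_X|apply: contN; exact: cont_X]. Qed.

Lemma contM U u w : cont U u -> cont U w -> cont U (fun z => u z * w z).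
Proof. by move=> cu cw ; split=> z Uz; exact: (@continuousM R _ u w z (cu z Uz) (cw z Uz)). Qed.

Lemma cont_sum U (I : finType) (F : I -> Cn R n -> R) :
  (forall i, cont U (F i)) -> cont U (fun z => \sum_i F i z).
Proof.
move=> cF; suff H (s : seq I) : cont U (fun z => \sum_(i <- s) F i z) by exact: H.
elim: s => [|i s IH]; first by under eq_fun do rewrite big_nil; exact: cont_cst.
by under eq_fun do rewrite big_cons; exact: contD (cF i) IH.
Qed.

Lemma cont_comp U u (f : R -> R) :
  cont U u -> (forall z, U z -> {for u z, continuous f}) -> cont U (fun z => f (u z)).
Proof. by move=> cu cf ; split=> z Uz; apply: continuous_comp; [exact: cu|exact: cf]. Qed.

Lemma cont_sub U V u : V `<=` U -> cont U u -> cont V u.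
Proof. by move=> VU cu ; split=> z Vz; exact/cu/VU. Qed.

Lemma pd_sub d U V u u' : V `<=` U -> pd d U u u' -> pd d V u u'.
Proof. by move=> VU cu ; split=> z Vz; exact/cu/VU. Qed.

Lemma pd_eq d U u u' u'' : pd d U u u' -> (forall z, U z -> u' z = u'' z) -> pd d U u u''.
Proof. by move=> h e ; split=> z Uz; rewrite -e //; exact: h. Qed.

Lemma pd_cst d U (a : R) : pd d U (fun=> a) (fun=> 0).
Proof. by split=> z _; exact: is_derive_cst. Qed.

Lemma pd_affine d U u (a : R) :
  (forall z t, u (line z (dir d) t) = u z + t * a) -> pd d U u (fun=> a).
Proof.
move=> uE; split=> z _; rewrite (_ : (fun t => _) = (fun t : R => u z + t * a)); last exact/funext/uE.
by apply: is_derive_eq; rewrite /GRing.scale /=; ring.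
Qed.

Lemma pd_X d e U : pd e U (X d) (fun=> (d == e)%:R).
Proof. by apply: pd_affine => z t; rewrite X_line X_dir. Qed.

Lemma pd_JX d e U : pd e U (JX d) (fun=> JX d (dir e)).
Proof. by apply: pd_affine => z t; rewrite JX_line. Qed.

Lemma pdD d U u u' w w' : pd d U u u' -> pd d U w w' ->
  pd d U (fun z => u z + w z) (fun z => u' z + w' z).
Proof. by move=> hu hw ; split=> z Uz; apply: is_deriveD; [exact: hu|exact: hw]. Qed.

Lemma pdN d U u u' : pd d U u u' -> pd d U (fun z => - u z) (fun z => - u' z).
Proof. by move=> hu ; split=> z Uz; apply: is_deriveN; exact: hu. Qed.

Lemma pdM d U u u' w w' : pd d U u u' -> pd d U w w' ->
  pd d U (fun z => u z * w z) (fun z => u z * w' z + u' z * w z).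
Proof.
move=> hu hw ; split=> z Uz; have := is_deriveM (hu z Uz) (hw z Uz).
by rewrite line0 /GRing.scale /= [w z * _]mulrC.
Qed.

Lemma pd_sum d U (I : finType) (F F' : I -> Cn R n -> R) :
  (forall i, pd d U (F i) (F' i)) ->
  pd d U (fun z => \sum_i F i z) (fun z => \sum_i F' i z).
Proof.
move=> hF; split=> z Uz.
suff H (s : seq I) : is_derive (0 : R) 1 (fun t : R => \sum_(i <- s) F i (line z (dir d) t))
  (\sum_(i <- s) F' i z) by exact: H.
elim: s => [|i s IH].
  rewrite big_nil (_ : (fun t => _) = cst 0); first exact: is_derive_cst.
  by apply/funext => t; rewrite big_nil.
rewrite big_cons (_ : (fun t => _) = (fun t : R => F i (line z (dir d) t)) +
   (fun t => \sum_(i <- s) F i (line z (dir d) t))); first exact: is_deriveD (hF i z Uz) IH.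
by apply/funext => t; rewrite big_cons.
Qed.

Lemma pd_comp d U u u' (f f' : R -> R) : pd d U u u' ->
  (forall z, U z -> is_derive (u z) 1 f (f' (u z))) ->
  pd d U (fun z => f (u z)) (fun z => f' (u z) * u' z).
Proof.
move=> hu hf ; split=> z Uz; have h := hf z Uz.
have h' : is_derive (u (line z (dir d) 0)) 1 f (f' (u z)) by rewrite line0.
exact: (is_derive1_comp h' (hu z Uz)).
Qed.

Lemma pd_line d U u u' z (t : R) : pd d U u u' -> U (line z (dir d) t) ->
  is_derive t 1 (fun s : R => u (line z (dir d) s)) (u' (line z (dir d) t)).
Proof.
move=> hu Uzt; have h := hu _ Uzt.
have {}h : is_derive (t - t) 1 (fun s : R => u (line (line z (dir d) t) (dir d) s))
  (u' (line z (dir d) t)) by rewrite subrr.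
have h2 : is_derive t (1 : R) (fun s : R => s - t) 1 by apply: is_derive_eq; rewrite subr0.
have := @is_derive1_comp _ (fun s => u (line (line z (dir d) t) (dir d) s)) (fun s => s - t) t _ _ h h2.
rewrite mulr1.
rewrite (_ : _ \o _ = (fun s : R => u (line z (dir d) s))) //.
by apply/funext => s /=; rewrite lineD addrC subrK.
Qed.

(** A C^2 function with gradient and Hessian as data; [u2 d e] differentiates in d, then in e.
    Symmetry of the Hessian is carried along, being preserved by sums, products and compositions. *)
Record jet U (u : Cn R n -> R) (u1 : 'I_n * bool -> Cn R n -> R)
    (u2 : 'I_n * bool -> 'I_n * bool -> Cn R n -> R) : Prop := Jet {
  jet_cont : cont U u;
  jet_cont1 : forall d, cont U (u1 d);
  jet_cont2 : forall d e, cont U (u2 d e);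
  jet_pd : forall d, pd d U u (u1 d);
  jet_pd1 : forall d e, pd e U (u1 d) (u2 d e);
  jet_sym : forall d e z, U z -> u2 d e z = u2 e d z }.

Lemma jet_sub U V u u1 u2 : V `<=` U -> jet U u u1 u2 -> jet V u u1 u2.
Proof.
move=> VU [c c1 c2 p p1 s]; split => *.
- exact: cont_sub VU c.
- exact: cont_sub VU (c1 _).
- exact: cont_sub VU (c2 _ _).
- exact: pd_sub VU (p _).
- exact: pd_sub VU (p1 _ _).
- by apply: s; exact: VU.
Qed.

Lemma jet_cst U (a : R) : jet U (fun=> a) (fun _ _ => 0) (fun _ _ _ => 0).
Proof. by split=> *; do ?[exact: cont_cst|exact: pd_cst]. Qed.

Lemma jet_lin U (a : R) (b : 'I_n * bool -> R) :
  jet U (fun z => a + \sum_d b d * X d z) (fun d _ => b d) (fun _ _ _ => 0).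
Proof.
split=> [|d|d e|d|d e|//]; do ?[exact: cont_cst|exact: pd_cst].
  by apply: contD; [exact: cont_cst|apply: cont_sum => e; apply: contM; [exact: cont_cst|exact: cont_X]].
apply: pd_affine => z t; rewrite -addrA; congr (_ + _).
rewrite (eq_bigr (fun e => b e * X e z + t * (b e * (e == d)%:R))); last first.
  by move=> e _; rewrite X_line X_dir; ring.
by rewrite big_split /= -mulr_sumr sum_delta.
Qed.

Lemma jet_sqn U : jet U sqn (fun d z => 2 * X d z) (fun d e _ => 2 * (d == e)%:R).
Proof.
have pX d : pd d U sqn (fun z => 2 * X d z).
  rewrite /sqn; under eq_fun do under eq_bigr do rewrite expr2.
  apply: (pd_eq (pd_sum (fun e => pdM (pd_X e d U) (pd_X e d U)))) => z _.
  rewrite -[RHS](sum_delta d (fun e => 2 * X e z)).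
  by apply: eq_bigr => e _; ring.
split=> [|d|d e|d|d e|d e z _]; do ?[exact: cont_cst|exact: pX].
- by apply: cont_sum => d; under eq_fun do rewrite expr2; apply: contM; exact: cont_X.
- by apply: contM; [exact: cont_cst|exact: cont_X].
- by apply: (pd_eq (pdM (pd_cst _ _ 2) (pd_X _ _ _))) => z _; rewrite mul0r addr0.
- by rewrite eq_sym.
Qed.

Lemma jetD U u u1 u2 w w1 w2 : jet U u u1 u2 -> jet U w w1 w2 ->
  jet U (fun z => u z + w z) (fun d z => u1 d z + w1 d z) (fun d e z => u2 d e z + w2 d e z).
Proof.
move=> ju jw; split=> *.
- exact: contD (jet_cont ju) (jet_cont jw).
- exact: contD (jet_cont1 ju _) (jet_cont1 jw _).
- exact: contD (jet_cont2 ju _ _) (jet_cont2 jw _ _).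
- exact: pdD (jet_pd ju _) (jet_pd jw _).
- exact: pdD (jet_pd1 ju _ _) (jet_pd1 jw _ _).
- by rewrite (jet_sym ju) // (jet_sym jw).
Qed.

Lemma jetM U u u1 u2 w w1 w2 : jet U u u1 u2 -> jet U w w1 w2 ->
  jet U (fun z => u z * w z) (fun d z => u z * w1 d z + u1 d z * w z)
    (fun d e z => u z * w2 d e z + u1 e z * w1 d z + u1 d z * w1 e z + u2 d e z * w z).
Proof.
move=> ju jw; split=> *.
- exact: contM (jet_cont ju) (jet_cont jw).
- exact: contD (contM (jet_cont ju) (jet_cont1 jw _)) (contM (jet_cont1 ju _) (jet_cont jw)).
- exact: contD (contD (contD (contM (jet_cont ju) (jet_cont2 jw _ _))
    (contM (jet_cont1 ju _) (jet_cont1 jw _)))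
    (contM (jet_cont1 ju _) (jet_cont1 jw _))) (contM (jet_cont2 ju _ _) (jet_cont jw)).
- exact: pdM (jet_pd ju _) (jet_pd jw _).
- apply: (pd_eq (pdD (pdM (jet_pd ju _) (jet_pd1 jw _ _)) (pdM (jet_pd1 ju _ _) (jet_pd jw _)))) => z _.
  by rewrite !addrA.
- by rewrite (jet_sym ju) // (jet_sym jw) //; ring.
Qed.

Lemma is_derive_continuous (h : R -> R) (x dh : R) :
  is_derive x (1 : R) h dh -> {for x, continuous h}.
Proof. by case=> dh' _; apply: differentiable_continuous; apply/derivable1_diffP. Qed.

Lemma jet_comp U u u1 u2 (f f1 f2 : R -> R) : jet U u u1 u2 ->
  (forall z, U z -> is_derive (u z) 1 f (f1 (u z))) ->
  (forall z, U z -> is_derive (u z) 1 f1 (f2 (u z))) ->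
  (forall z, U z -> {for u z, continuous f2}) ->
  jet U (fun z => f (u z)) (fun d z => f1 (u z) * u1 d z)
    (fun d e z => f1 (u z) * u2 d e z + f2 (u z) * u1 e z * u1 d z).
Proof.
move=> ju hf hf1 cf2.
have cf z : U z -> {for u z, continuous f} by move=> Uz; exact: is_derive_continuous (hf z Uz).
have cf1 z : U z -> {for u z, continuous f1} by move=> Uz; exact: is_derive_continuous (hf1 z Uz).
split=> *.
- exact: cont_comp (jet_cont ju) cf.
- exact: contM (cont_comp (jet_cont ju) cf1) (jet_cont1 ju _).
- exact: contD (contM (cont_comp (jet_cont ju) cf1) (jet_cont2 ju _ _))
    (contM (contM (cont_comp (jet_cont ju) cf2) (jet_cont1 ju _)) (jet_cont1 ju _)).
- exact: pd_comp (jet_pd ju _) hf.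
- exact: pdM (pd_comp (jet_pd ju _) hf1) (jet_pd1 ju _ _).
- by rewrite (jet_sym ju) //; ring.
Qed.

End partial_derivatives.

(** * From jets to [Ck] and to the complex derivatives *)

Section smoothness.
Context {R : realType} {n : nat}.
Implicit Types (z v : Cn R n) (d e : 'I_n * bool) (U : set (Cn R n)) (f g : Cn R n -> R[i]^o).

Lemma line_near U z v : open U -> U z -> \forall t \near (0 : R), U (line z v t).
Proof.
move=> oU Uz; have := @continuous_line _ _ z v 0 U; rewrite line0; apply.
exact: open_nbhs_nbhs.
Qed.

Lemma continuous_complex (u : Cn R n -> R) z :
  {for z, continuous u} -> {for z, continuous (fun z => (u z)%:C : R[i]^o)}.
Proof.
move=> cu A /nbhs_ballP[e /= e0 eA].
have re0 : 0 < complex.Re e by move: e0; rewrite ltcE => /andP[].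
have ie0 : complex.Im e = 0 by move: e0; rewrite ltcE => /andP[/eqP].
have H : nbhs z (fun y => ball (u z) (complex.Re e) (u y)) by exact: (cu _ (nbhsx_ballx _ _ re0)).
apply: (filterS _ H) => y; rewrite -ball_normE /= => uy; apply: eA.
rewrite -ball_normE /= -raddfB /= normc_def /= expr0n addr0 sqrtr_sqr.
by rewrite ltcE /= ie0 eqxx.
Qed.

Lemma real_deriv_eq U f g v z : open U -> U z -> (forall z, U z -> f z = g z) ->
  real_deriv v f z = real_deriv v g z.
Proof.
move=> oU Uz fg; rewrite /real_deriv !derive1E.
have fg0 : \forall t \near (0 : R), f (real_line z v t) = g (real_line z v t).
  by apply: filterS (line_near v oU Uz) => t; rewrite line.unlock; exact: fg.
by congr (_ +i* _); apply: near_eq_derive; rewrite ?oner_neq0 //; apply: filterS fg0 => t ->.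
Qed.

Lemma real_derivable_eq U f g v z : open U -> U z -> (forall z, U z -> f z = g z) ->
  real_derivable f v z -> real_derivable g v z.
Proof.
move=> oU Uz fg [hr hi].
have fg0 : \forall t \near (0 : R), f (real_line z v t) = g (real_line z v t).
  by apply: filterS (line_near v oU Uz) => t; rewrite line.unlock; exact: fg.
by split; [apply: near_eq_derivable hr|apply: near_eq_derivable hi];
   rewrite ?oner_neq0 //; apply: filterS fg0 => t ->.
Qed.

Lemma near_eq_continuous U f g z : open U -> U z -> (forall z, U z -> f z = g z) ->
  {for z, continuous f} -> {for z, continuous g}.
Proof.
move=> oU Uz fg cf A; rewrite -(fg z Uz) => gA.
have fA : nbhs z (fun y => A (f y)) by exact: (cf _ gA).
have Un : nbhs z U by exact: open_nbhs_nbhs.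
have H : nbhs z (fun y => A (g y)).
  by apply: filterS2 fA Un => y Ay Uy; rewrite -fg.
exact: H.
Qed.

(** [Ck] iterates [real_deriv] on functions defined everywhere, whereas the explicit partials agree
    with these only on U. Openness makes that enough: a line through a point of U stays in U for
    small parameters. *)
Lemma Ck_eq k U f g : open U -> (forall z, U z -> f z = g z) -> Ck k U f -> Ck k U g.
Proof.
move=> oU; elim: k f g => [|k IH] f g fg [cf h].
all: have cg : forall z, U z -> {for z, continuous g}.
1,3: by move=> z Uz; exact: near_eq_continuous fg (cf z Uz).
- by split.
- split=> // i; have [hx hy cx cy] := h i; split.
  + by move=> z Uz; exact: real_derivable_eq fg (hx z Uz).
  + by move=> z Uz; exact: real_derivable_eq fg (hy z Uz).
  + by apply: IH cx => z Uz; exact: real_deriv_eq fg.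
  + by apply: IH cy => z Uz; exact: real_deriv_eq fg.
Qed.

Section real_valued.
Variables (U : set (Cn R n)) (oU : open U).

Lemma real_derivable_real d (u u' : Cn R n -> R) z : pd d U u u' -> U z ->
  real_derivable (fun z => (u z)%:C : R[i]^o) (dir d) z.
Proof.
move=> hu Uz; have [h _] := hu z Uz; split=> /=.
  by move: h; rewrite line.unlock.
exact: derivable_cst.
Qed.

Lemma real_deriv_real d (u u' : Cn R n -> R) z : pd d U u u' -> U z ->
  real_deriv (dir d) (fun z => (u z)%:C : R[i]^o) z = (u' z)%:C.
Proof.
move=> hu Uz; have [_ h] := hu z Uz; rewrite /real_deriv !derive1E /=.
by move: h; rewrite line.unlock => ->; rewrite derive_cst.
Qed.

Lemma Ck0_real u : cont U u -> Ck 0 U (fun z => (u z)%:C : R[i]^o).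
Proof. by move=> cu; split => // z Uz; apply: continuous_complex; exact: cu. Qed.

Lemma CkS_real k (u : Cn R n -> R) (u' : 'I_n * bool -> Cn R n -> R) :
  cont U u -> (forall d, pd d U u (u' d)) ->
  (forall d, Ck k U (fun z => (u' d z)%:C : R[i]^o)) ->
  Ck k.+1 U (fun z => (u z)%:C : R[i]^o).
Proof.
move=> cu hu hu'; split; first by case: (Ck0_real cu).
move=> i; split.
- by move=> z; exact: (real_derivable_real (hu (i, false))).
- by move=> z; exact: (real_derivable_real (hu (i, true))).
- apply: Ck_eq oU _ (hu' (i, false)) => z Uz.
  by rewrite (real_deriv_real (hu (i, false)) Uz).
- apply: Ck_eq oU _ (hu' (i, true)) => z Uz.
  by rewrite (real_deriv_real (hu (i, true)) Uz).
Qed.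

Lemma Ck2_jet u u1 u2 : jet U u u1 u2 -> Ck 2 U (fun z => (u z)%:C : R[i]^o).
Proof.
move=> j; apply: CkS_real (jet_cont j) (jet_pd j) _ => d.
apply: CkS_real (jet_cont1 j d) (jet_pd1 j d) _ => e.
exact: Ck0_real (jet_cont2 j d e).
Qed.

Lemma dz_dzbar_jet u u1 u2 i j z : jet U u u1 u2 -> U z ->
  d_z i (d_zbar j (fun z => (u z)%:C : R[i]^o)) z = 4%:R^-1 *
   ((u2 (i, false) (j, false) z + u2 (i, true) (j, true) z) +i*
    (u2 (i, false) (j, true) z - u2 (i, true) (j, false) z)).
Proof.
move=> ju Uz.
have eqj y : U y -> d_zbar j (fun z => (u z)%:C : R[i]^o) y =
    (u1 (j, false) y / 2) +i* (u1 (j, true) y / 2).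
  move=> Uy; rewrite /d_zbar (real_deriv_real (jet_pd ju (j, false)) Uy).
  rewrite (real_deriv_real (jet_pd ju (j, true)) Uy).
  rewrite -[2%:R^-1](_ : (2^-1)%:C = _); last by rewrite fmorphV rmorphD rmorph1.
  by apply/eqP; rewrite eq_complex /=; apply/andP; split; apply/eqP; field.
have dh b : real_deriv (dir (i, b)) (fun z => (u1 (j, false) z / 2) +i* (u1 (j, true) z / 2) : R[i]^o) z =
    (u2 (j, false) (i, b) z / 2) +i* (u2 (j, true) (i, b) z / 2).
  have H c : is_derive (0 : R) 1 (fun t : R => u1 (j, c) (real_line z (dir (i, b)) t) / 2)
     (u2 (j, c) (i, b) z / 2).
    have := pdM (jet_pd1 ju (j, c) (i, b)) (pd_cst (i, b) U 2^-1).
    by move=> /(_ z Uz); rewrite line.unlock mulr0 add0r.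
  rewrite /real_deriv !derive1E /=.
  by have [_ ->] := H false; have [_ ->] := H true.
rewrite /d_z (real_deriv_eq _ oU Uz eqj) (real_deriv_eq (e_y R i) oU Uz eqj).
rewrite (dh false) (dh true).
rewrite !(jet_sym ju (j, _) (i, _) Uz).
rewrite -[2%:R^-1](_ : (2^-1)%:C = _); last by rewrite fmorphV rmorphD rmorph1.
rewrite -[4%:R^-1](_ : (4^-1)%:C = _); last by rewrite fmorphV rmorph_nat.
by apply/eqP; rewrite eq_complex /=; apply/andP; split; apply/eqP; field.
Qed.

End real_valued.
End smoothness.

(** * The invariant Laplacian in real coordinates *)

Section operator.
Context {R : realType} {n : nat}.
Local Notation D := ('I_n * bool)%type.
Implicit Types (z : Cn R n) (d e : D) (p r : D -> R) (h : D -> D -> R).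

Definition dot p r : R := \sum_d p d * r d.
Notation Xv z := (fun d : D => X d z).
Notation JXv z := (fun d : D => JX d z).

(* Four times the real part of the sesquilinear form (delta_ij - z_i z_j^* ),
   and its contraction with a Hessian, in the 2n real coordinates. *)
Definition GG z p r := dot p r - dot (Xv z) p * dot (Xv z) r - dot (JXv z) p * dot (JXv z) r.
Definition LL z h := \sum_d h d d -
  \sum_d \sum_e (X d z * X e z + JX d z * JX e z) * h d e.

Lemma dotC p r : dot p r = dot r p.
Proof. by apply: eq_bigr => d _; rewrite mulrC. Qed.

Lemma dotDr p r r' : dot p (fun d => r d + r' d) = dot p r + dot p r'.
Proof. by rewrite /dot -big_split /=; apply: eq_bigr => d _; rewrite mulrDr. Qed.

Lemma dotZr p r (c : R) : dot p (fun d => c * r d) = c * dot p r.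
Proof. by rewrite /dot mulr_sumr; apply: eq_bigr => d _; rewrite mulrCA. Qed.

Lemma dotDl p r r' : dot (fun d => r d + r' d) p = dot r p + dot r' p.
Proof. by rewrite dotC dotDr !(dotC p). Qed.

Lemma dotZl p r (c : R) : dot (fun d => c * r d) p = c * dot r p.
Proof. by rewrite dotC dotZr dotC. Qed.

Lemma GGC z p r : GG z p r = GG z r p.
Proof. by rewrite /GG dotC; ring. Qed.

Lemma GGDr z p r r' : GG z p (fun d => r d + r' d) = GG z p r + GG z p r'.
Proof. by rewrite /GG !dotDr; ring. Qed.

Lemma GGZr z p r (c : R) : GG z p (fun d => c * r d) = c * GG z p r.
Proof. by rewrite /GG !dotZr; ring. Qed.

Lemma GGDl z p r r' : GG z (fun d => r d + r' d) p = GG z r p + GG z r' p.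
Proof. by rewrite GGC GGDr !(GGC z p). Qed.

Lemma GGZl z p r (c : R) : GG z (fun d => c * r d) p = c * GG z r p.
Proof. by rewrite GGC GGZr GGC. Qed.

Lemma LLD z h h' : LL z (fun d e => h d e + h' d e) = LL z h + LL z h'.
Proof.
rewrite /LL big_split /= [X in _ - X](_ : _ =
  \sum_d \sum_e (X d z * X e z + JX d z * JX e z) * h d e +
  \sum_d \sum_e (X d z * X e z + JX d z * JX e z) * h' d e); first by ring.
rewrite -big_split; apply: eq_bigr => d _ /=; rewrite -big_split /=.
by apply: eq_bigr => e _; rewrite mulrDr.
Qed.

Lemma LLZ z h (c : R) : LL z (fun d e => c * h d e) = c * LL z h.
Proof.
rewrite /LL mulrBr mulr_sumr; congr (_ - _).
by rewrite mulr_sumr; apply: eq_bigr => d _; rewrite mulr_sumr; apply: eq_bigr => e _; rewrite mulrCA.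
Qed.

Lemma LL_prod z p r : LL z (fun d e => p d * r e) = GG z p r.
Proof.
rewrite /LL /GG -addrA -opprD; congr (_ - _); rewrite /dot !mulr_suml -big_split /=.
apply: eq_bigr => d _; rewrite !mulr_sumr -big_split /=.
by apply: eq_bigr => e _; ring.
Qed.

Lemma LL_prod_sym z p r : LL z (fun d e => p e * r d) = GG z p r.
Proof.
rewrite GGC -LL_prod; congr (LL z _).
by apply/funext => d; apply/funext => e; rewrite mulrC.
Qed.

(** The Hessian on the left has the shape that [jetM] produces, so this is the product rule L(uw) =
    u Lw + 2 G(u,w) + w Lu. [LL_comp] matches [jet_comp] in the same way. *)
Lemma LL_M z (u w : R) p r h k :
  LL z (fun d e => u * k d e + p e * r d + p d * r e + h d e * w) =
  u * LL z k + 2 * GG z p r + w * LL z h.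
Proof.
rewrite !LLD LLZ LL_prod LL_prod_sym; under eq_fun do under eq_fun do rewrite mulrC.
by rewrite LLZ; ring.
Qed.

Lemma LL_comp z (a b : R) p h :
  LL z (fun d e => a * h d e + b * p e * p d) = a * LL z h + b * GG z p p.
Proof.
rewrite LLD LLZ; congr (_ + _); under eq_fun do under eq_fun do rewrite -mulrA.
by rewrite LLZ LL_prod_sym.
Qed.

Lemma dot_X z : dot (Xv z) (Xv z) = sqn z.
Proof. by apply: eq_bigr => d _; rewrite expr2. Qed.

Lemma dot_JXl z y : dot (JXv z) (Xv y) = - dot (Xv z) (JXv y).
Proof.
rewrite /dot !sum_dir -sumrN; apply: eq_bigr => i _; rewrite /JX /=; ring.
Qed.

Lemma dot_JX z y : dot (JXv z) (JXv y) = dot (Xv z) (Xv y).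
Proof.
rewrite /dot !sum_dir; apply: eq_bigr => i _; rewrite /JX /=; ring.
Qed.

Lemma dot_JX_X z : dot (Xv z) (JXv z) = 0.
Proof. by apply/eqP; have /eqP := dot_JXl z z; rewrite dotC -addr_eq0 -mulr2n mulrn_eq0. Qed.

Lemma LL_id z : LL z (fun d e => 2 * (d == e)%:R) = 4 * (n%:R - sqn z).
Proof.
rewrite /LL.
have -> : \sum_(d : D) 2 * (d == d)%:R = 4 * n%:R :> R.
  under eq_bigr do rewrite eqxx mulr1.
  by rewrite sumr_const card_prod card_ord card_bool -[LHS]mulr_natr natrM; ring.
suff -> : \sum_d \sum_e (X d z * X e z + JX d z * JX e z) * (2 * (d == e)%:R) = 4 * sqn z.
  by ring.
transitivity (2 * (dot (Xv z) (Xv z) + dot (JXv z) (JXv z))); last by rewrite dot_JX dot_X; ring.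
rewrite /dot -big_split mulr_sumr; apply: eq_bigr => d _ /=.
rewrite -[RHS](sum_delta d (fun e => 2 * (X d z * X e z + JX d z * JX e z))).
by apply: eq_bigr => e _; rewrite eq_sym; ring.
Qed.

Lemma sum_complex (I : finType) (F H : I -> R) :
  \sum_i ((F i +i* H i)%C : R[i]) = (\sum_i F i) +i* (\sum_i H i).
Proof.
by apply/eqP; rewrite eq_complex !raddf_sum /= !eqxx.
Qed.

(** Both (delta_ij - z_i conj z_j) and the mixed second derivatives of a real function form
    Hermitian matrices, so the double sum is real. The factor 4 of the invariant Laplacian cancels
    the 1/4 from the two complex derivatives. *)
Lemma invariant_laplacian_jet (U : set (Cn R n)) (u : Cn R n -> R) u1 u2 z :
  open U -> jet U u u1 u2 -> U z ->
  invariant_laplacian (fun z => (u z)%:C : R[i]^o) z =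
  ((1 - sqn z) * LL z (fun d e => u2 d e z))%:C.
Proof.
move=> oU ju Uz; rewrite /invariant_laplacian sqr_enorm.
pose h d e := u2 d e z.
have hC d e : h d e = h e d by exact: jet_sym ju _ _ _ Uz.
pose F i j := h (i, false) (j, false) + h (i, true) (j, true).
pose W i j := h (i, false) (j, true) - h (i, true) (j, false).
pose P i j : R := X (i, false) z * X (j, false) z + X (i, true) z * X (j, true) z.
pose Q i j : R := X (i, true) z * X (j, false) z - X (i, false) z * X (j, true) z.
have WN i j : W j i = - W i j by rewrite /W (hC (j, _)) (hC (j, _)); ring.
have termE i j : ((i == j)%:R - z 0 i * (z 0 j)^*) * d_z i (d_zbar j (fun z => (u z)%:C : R[i]^o)) z =
  (4^-1 * (((i == j)%:R - P i j) * F i j + Q i j * W i j)) +i*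
  (4^-1 * (((i == j)%:R - P i j) * W i j - Q i j * F i j)).
  rewrite (dz_dzbar_jet oU i j ju Uz).
  rewrite -[4%:R^-1](_ : (4^-1)%:C = _); last by rewrite fmorphV rmorph_nat.
  rewrite -[(i == j)%:R](_ : ((i == j)%:R)%:C = _); last by rewrite rmorph_nat.
  rewrite /P /Q /F /W /h X.unlock /=.
  by case: (z 0 i) (z 0 j) => [a b] [c e]; apply/eqP; rewrite eq_complex /=;
    apply/andP; split; apply/eqP; ring.
under eq_bigr do under eq_bigr do rewrite termE.
under eq_bigr do rewrite sum_complex.
rewrite sum_complex.
set re := \sum_i _; set im := \sum_i _.
(* [P] and [F] are symmetric in i and j, [Q] and [W] antisymmetric. *)
have -> : im = 0.
  have im2 : im = - im.
    rewrite {1}/im exchange_big /= -sumrN; apply: eq_bigr => i _.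
    rewrite -sumrN; apply: eq_bigr => j _.
    have -> : F j i = F i j by rewrite /F (hC (j, false)) (hC (j, true)).
    rewrite (WN i j) eq_sym /P /Q; ring.
  by lra.
have -> : re = 4^-1 * LL z h.
  rewrite /re /LL sum_dir; under [X in _ - X]eq_bigr do rewrite sum_dir.
  rewrite sum_dir -sumrB mulr_sumr; apply: eq_bigr => i _.
  rewrite -mulr_sumr; congr (_ * _).
  rewrite (eq_bigr (fun j => F i j * (j == i)%:R - (P i j * F i j - Q i j * W i j))); last first.
    by move=> j _; rewrite eq_sym; ring.
  rewrite sumrB sum_delta {1}/F; congr (_ - _); rewrite -big_split /=.
  by apply: eq_bigr => j _; rewrite /P /F /Q /W /JX /=; ring.
rewrite -[4%:R](_ : 4%:C = _); last by rewrite rmorph_nat.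
by apply/eqP; rewrite eq_complex /=; apply/andP; split; apply/eqP; rewrite /h; field.
Qed.

Lemma M_harmonic_jet (U : set (Cn R n)) (u : Cn R n -> R) u1 u2 :
  open U -> U `<=` unit_ball R n -> jet U u u1 u2 ->
  (forall z, U z -> LL z (fun d e => u2 d e z) = 0) ->
  M_harmonic U (fun z => (u z)%:C : R[i]^o).
Proof.
move=> oU UB ju L0; split; [exact: oU|exact: UB|exact: Ck2_jet ju|].
by move=> z Uz; rewrite (invariant_laplacian_jet oU ju Uz) L0 // mulr0.
Qed.

End operator.

Section real_analysis.
Context {R : realType}.

Lemma le_is_derive (f f' : R -> R) (a b : R) : a <= b ->
  (forall x, a <= x <= b -> is_derive x 1 f (f' x)) ->
  (forall x, a < x < b -> 0 <= f' x) -> f a <= f b.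
Proof.
rewrite le_eqVlt => /predU1P[->//|ab] df f'0.
have df1 x : x \in `]a, b[%R -> is_derive x 1 f (f' x).
  by rewrite in_itv /= => /andP[ax xb]; apply: df; rewrite !ltW.
have cf : {within `[a, b], continuous f}.
  by apply: derivable_within_continuous => x; rewrite in_itv /= => /df[].
have [x] := MVT ab df1 cf; rewrite in_itv /= => xab E.
by rewrite -subr_ge0 E mulr_ge0 ?f'0 // subr_ge0 ltW.
Qed.

End real_analysis.

(** * The test function *)

Section profile.
Context {R : realType}.
Implicit Types (x Q c : R).

(* E_m is the primitive of Q^m (1 - Q)^-(m+1) vanishing at 0. *)
Fixpoint green_profile (m : nat) (Q : R) : R :=
  if m is m'.+1 then (Q / (1 - Q)) ^+ m / m%:R - green_profile m' Q else - ln (1 - Q).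
Local Notation E := green_profile.

(** The recursion reflects Q^m (1-Q)^-(m+2) - Q^m (1-Q)^-(m+1) = Q^(m+1) (1-Q)^-(m+2), whose first
    term is the derivative of (Q/(1-Q))^(m+1) / (m+1). *)
Lemma is_derive_green_profile m Q : Q < 1 ->
  is_derive Q 1 (E m) (Q ^+ m * (1 - Q) ^- m.+1).
Proof.
move=> Q1; have Q1' : 0 < 1 - Q by rewrite subr_gt0.
have Q1n : 1 - Q != 0 by rewrite gt_eqF.
have d1 : is_derive Q (1 : R) (fun Q : R => 1 - Q) (-1) by apply: is_derive_eq; ring.
elim: m => [|m IH].
  have h : is_derive Q (1 : R) (fun Q => - ln (1 - Q)) (- ((1 - Q)^-1 * -1)).
    apply: is_deriveN.
    exact: (@is_derive1_comp _ (@ln R) (fun Q => 1 - Q) Q _ _ (is_derive1_ln Q1') d1).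
  by move: h; rewrite mulrN1 opprK expr0 expr1 mul1r.
have dV : is_derive Q (1 : R) (fun Q : R => (1 - Q)^-1) ((1 - Q) ^- 2).
  have := @is_deriveV _ (fun Q => 1 - Q) Q _ _ Q1n d1; by rewrite /GRing.scale /= mulrN1 opprK.
have dq : is_derive Q (1 : R) (fun Q : R => Q / (1 - Q)) ((1 - Q) ^- 2).
  have := @is_deriveM _ _ id (fun Q => (1 - Q)^-1) _ _ _ _ (is_derive_id Q (1 : R)) dV.
  by move=> h; apply: (is_derive_eq h); rewrite /GRing.scale /=; field.
have dX : is_derive Q (1 : R) (fun Q => (Q / (1 - Q)) ^+ m.+1)
    (m.+1%:R * (Q / (1 - Q)) ^+ m * (1 - Q) ^- 2).
  have := @is_deriveX _ _ (fun Q => Q / (1 - Q)) m.+1 _ _ _ dq.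
  by rewrite exprfctE.
have dZ := @is_deriveM _ _ (fun Q => (Q / (1 - Q)) ^+ m.+1) (cst m.+1%:R^-1) _ _ _ _ dX (is_derive_cst (m.+1%:R^-1 : R) Q (1 : R)).
have := @is_deriveB _ _ _ (fun Q => (Q / (1 - Q)) ^+ m.+1 / m.+1%:R) (E m) _ _ _ _ dZ IH.
move=> h; apply: (is_derive_eq h); rewrite /GRing.scale /= mulr0 add0r.
have m0 : m.+1%:R != 0 :> R by rewrite pnatr_eq0.
have Qm : (1 - Q) ^+ m != 0 by rewrite expf_neq0.
rewrite expr_div_n !exprS.
by field; rewrite Qm Q1n nat1r m0.
Qed.

Lemma green_profile0 m : E m 0 = 0.
Proof. by elim: m => [|m /= ->]; rewrite /= ?subr0 ?ln1 ?oppr0 // mul0r expr0n mul0r. Qed.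

Lemma le_green_profile m P Q : 0 <= P -> P <= Q -> Q < 1 -> E m P <= E m Q.
Proof.
move=> P0 PQ Q1; apply: (le_is_derive (f' := fun Q => Q ^+ m * (1 - Q) ^- m.+1)) PQ _ _ => x /andP[Px xQ].
  by apply: is_derive_green_profile; exact: le_lt_trans Q1.
have x0 : 0 <= x by apply: le_trans P0 (ltW _).
have x1 : 0 < 1 - x by rewrite subr_gt0 (lt_trans xQ).
by rewrite mulr_ge0 ?exprn_ge0 // invr_ge0 exprn_ge0 // ltW.
Qed.

Lemma green_profile_ge0 m Q : 0 <= Q -> Q < 1 -> 0 <= E m Q.
Proof. by move=> Q0 Q1; rewrite -(green_profile0 m) le_green_profile. Qed.

(* The radial profiles v^n and F(v) of the test function, as functions of
   q = |1 - <z,y>|^2 / (1 - |z|^2), with v = c / (q - c) and c = 1 - |y|^2. *)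
Definition phi1 (n : nat) c x := (c / (x - c)) ^+ n.
Definition phi2 (n : nat) c x := E n.-1 (c / x).

Lemma is_derive_phi1 n c x : c < x ->
  is_derive x 1 (phi1 n c) (- n%:R * phi1 n c x / (x - c)).
Proof.
move=> cx; have xc0 : x - c != 0 by rewrite gt_eqF ?subr_gt0.
have d1 : is_derive x (1 : R) (fun x : R => x - c) 1 by apply: is_derive_eq; ring.
have dV : is_derive x (1 : R) (fun x => c / (x - c)) (- c / (x - c) ^+ 2).
  have := @is_deriveM _ _ (cst c) (fun x => (x - c)^-1) _ _ _ _ (is_derive_cst c x (1 : R))
    (@is_deriveV _ (fun x => x - c) x _ _ xc0 d1).
  by move=> h; apply: (is_derive_eq h); rewrite /GRing.scale /= ?mulr0 ?addr0; field.
have := @is_deriveX _ _ (fun x => c / (x - c)) n _ _ _ dV; rewrite exprfctE => h.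
apply: (is_derive_eq h); rewrite /phi1 /GRing.scale /=.
case: n {h} => [|n]; first by rewrite !mul0r oppr0 !mul0r.
by rewrite /= [in RHS]exprS; field.
Qed.

(** With Q = c/x and F = E_(n-1), one has Q F'(Q) = (Q/(1-Q))^n = (c/(x-c))^n and dQ/dx = -Q/x. *)
Lemma is_derive_phi2 n c x : (0 < n)%N -> 0 < c -> c < x ->
  is_derive x 1 (phi2 n c) (- phi1 n c x / x).
Proof.
move=> n0 c0 cx; have x0 : x != 0 by rewrite gt_eqF // (lt_trans c0).
have xc0 : x - c != 0 by rewrite gt_eqF ?subr_gt0.
have dV : is_derive x (1 : R) (fun x => c / x) (- c / x ^+ 2).
  have := @is_deriveM _ _ (cst c) (fun x => x^-1) _ _ _ _ (is_derive_cst c x (1 : R))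
    (@is_deriveV _ id x _ _ x0 (is_derive_id _ _)).
  by move=> h; apply: (is_derive_eq h); rewrite /GRing.scale /= ?mulr0 ?addr0; field.
have cx1 : c / x < 1 by rewrite ltr_pdivrMr ?mul1r // (lt_trans c0).
have h := @is_derive1_comp _ (E n.-1) (fun x => c / x) x _ _ (is_derive_green_profile n.-1 cx1) dV.
apply: (is_derive_eq h); case: n n0 {h} => // n _ /=.
have -> : 1 - c / x = (x - c) / x by field.
rewrite /phi1 !expr_div_n !exprS.
have h1 : (x - c) ^+ n != 0 by rewrite expf_neq0.
have h2 : x ^+ n != 0 by rewrite expf_neq0.
by field; rewrite h1 h2 x0 xc0.
Qed.

End profile.

Section test_function.
Context {R : realType} {n : nat}.
Variable y : Cn R n.
Implicit Types (z : Cn R n).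
Local Notation D := ('I_n * bool)%type.

(* c = 1 - |y|^2, A = 1 - |z|^2, and b1 + i b2 = 1 - <z, y> up to the sign of b2. *)
Definition yc : R := 1 - sqn y.
Definition yA z : R := 1 - sqn z.
Definition yb1 z : R := 1 - dot (X^~ y) (X^~ z).
Definition yb2 z : R := dot (JX^~ y) (X^~ z).
(* |1 - <z, y>|^2 *)
Definition yS z : R := yb1 z ^+ 2 + yb2 z ^+ 2.
Definition yq z : R := yS z / yA z.
(** This is the derivative at t = 1 of log Q with y replaced by t y, namely 2 Re 1/(1 - <z,y>) -
    2/(1 - |y|^2). As Q F'(Q) = (Q/(1-Q))^n, its product with [phi1 n yc (yq z)] is the radial
    derivative of F(Q). *)
Definition yM z : R := 2 * yb1 z / yS z - 2 / yc.
Local Notation c := yc.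
Local Notation A := yA.
Local Notation b1 := yb1.
Local Notation b2 := yb2.
Local Notation S := yS.
Local Notation q := yq.
Local Notation M := yM.

Definition yalpha : R := (2 - c) * (n%:R - c) / c.
(* With G(y, z) = F(Q), Q = (1-|y|^2)(1-|z|^2)/|1-<z,y>|^2, the Green function
   of the invariant Laplacian, phi2 (q z) is G and phi1 (q z) * M z is, up to a
   factor, its radial derivative in y.  The choice of yalpha puts the minimum of
   psi below at q = 1, which is the value of q at the origin. *)
Definition test_fun z : R := phi1 n c (q z) * M z + yalpha * phi2 n c (q z).

Definition punctured_ball : set (Cn R n) := [set z | sqn z < 1 /\ z <> y].
Local Notation U := punctured_ball.

Lemma sqnB z w : sqn (z - w) = sqn z - 2 * dot (X^~ w) (X^~ z) + sqn w.
Proof.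
rewrite /sqn /dot mulr_sumr -sumrB -big_split /=.
by apply: eq_bigr => d _; rewrite XB; ring.
Qed.

(** The last two squares add up to |<z - y, y>|^2. Positivity of the right side off the pole gives q
    > c, and its first term controls the singularity at y. *)
Lemma yS_subE z : S z - c * A z = c * sqn (z - y) +
  (dot (X^~ y) (X^~ z) - sqn y) ^+ 2 + b2 z ^+ 2.
Proof. by rewrite sqnB /S /A /c /b1; ring. Qed.

Lemma sqn_gt0 z : z <> 0 -> 0 < sqn z.
Proof.
move=> z0; rewrite lt_neqAle sqn_ge0 andbT eq_sym; apply/eqP => s0; apply: z0.
apply: CnP => d; rewrite X0; apply/eqP; rewrite -sqrf_eq0.
move/eqP: s0; rewrite psumr_eq0 => [/allP/(_ d)|e _]; last exact: sqr_ge0.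
by rewrite mem_index_enum => /(_ isT).
Qed.

(** The Hermitian Cauchy-Schwarz inequality: the vector [W] below is |z|^2 times the component of y
    orthogonal to the complex line through z. *)
Lemma hermitian_CS z : dot (X^~ y) (X^~ z) ^+ 2 + b2 z ^+ 2 <= sqn y * sqn z.
Proof.
have [->|/eqP z0] := eqVneq z 0.
  rewrite /b2 /dot big1 => [|d _]; last by rewrite X0 mulr0.
  rewrite big1 => [|d _]; last by rewrite X0 mulr0.
  by rewrite expr0n addr0 mulr_ge0 ?sqn_ge0.
have t0 := sqn_gt0 z0.
set al := dot (X^~ y) (X^~ z); set be := b2 z; set t := sqn z in t0 *; set r := sqn y.
pose W d := t * X d y + - al * X d z + be * JX d z.
have W0 : 0 <= dot W W by apply: sumr_ge0 => d _; rewrite -expr2 sqr_ge0.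
have WE : dot W W = t * (t * r - al ^+ 2 - be ^+ 2).
  rewrite /W !dotDl !dotDr !dotZl !dotZr [dot (JX^~ z) (X^~ z)]dotC dot_JX_X.
  rewrite [dot (X^~ z) (X^~ y)]dotC [dot (X^~ y) (JX^~ z)]dotC dot_JXl dot_JX !dot_X.
  rewrite [dot _ (JX^~ y)]dotC -/(yb2 z) -/al -/be -/t -/r; ring.
move: W0; rewrite WE pmulr_rge0 // => W0; rewrite mulrC; lra.
Qed.

(** Since c + A - c A = 1 - |y|^2 |z|^2 and S - 2 b1 = |<z,y>|^2 - 1, this is Cauchy-Schwarz again,
    in the form that bounds [yM] from below. *)
Lemma yb1_ge z : S z + c + A z - c * A z <= 2 * b1 z.
Proof. by have := hermitian_CS z; rewrite /S /A /c /b1; set p := dot _ _; lra. Qed.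

Hypothesis y1 : sqn y < 1.

Lemma yc_gt0 : 0 < c. Proof. by rewrite subr_gt0. Qed.

Lemma yA_gt0 z : U z -> 0 < A z. Proof. by rewrite subr_gt0 => -[]. Qed.

Lemma yS_gt z : U z -> c * A z < S z.
Proof.
move=> [z1 zy]; rewrite -subr_gt0 yS_subE -addrA ltr_wpDr //.
  by rewrite addr_ge0 // sqr_ge0.
by rewrite mulr_gt0 ?yc_gt0 // sqn_gt0 // => /eqP; rewrite subr_eq0 => /eqP.
Qed.

Lemma yS_gt0 z : U z -> 0 < S z.
Proof. by move=> Uz; apply: lt_trans (yS_gt Uz); rewrite mulr_gt0 ?yc_gt0 ?yA_gt0. Qed.

Lemma yq_gt z : U z -> c < q z.
Proof. by move=> Uz; rewrite ltr_pdivlMr ?yA_gt0 // yS_gt. Qed.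

(** All second-order terms and gradient products of A, b1 and S are polynomials in A, b1, S and c,
    so applying the operator to functions of these three becomes algebra. *)
Lemma jet_base : exists A1 A2 b11 S1 S2,
  [/\ jet U A A1 A2, jet U b1 b11 (fun _ _ _ => 0), jet U S S1 S2 &
  forall z, U z -> let p u := fun d : D => (u d z : R) in
   [/\ LL z (fun d e => A2 d e z) = - 4 * (n%:R - 1 + A z),
       LL z (fun d e => S2 d e z) = 4 * (2 * b1 z - S z - c),
       GG z (p A1) (p A1) = 4 * A z * (1 - A z),
       GG z (p S1) (p A1) = 4 * A z * (b1 z - S z) &
    [/\ GG z (p S1) (p S1) = 4 * S z * (2 * b1 z - S z - c),
       GG z (p b11) (p A1) = 2 * A z * (1 - b1 z),
       GG z (p b11) (p S1) = 2 * b1 z * (2 * b1 z - S z - c) &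
       GG z (p b11) (p b11) = 2 * b1 z - S z - c]] ].
Proof.
have jb1 : jet U b1 (fun d _ => - X d y) (fun _ _ _ => 0).
  rewrite (_ : b1 = fun z => 1 + \sum_d - X d y * X d z); first exact: jet_lin.
  by apply/funext => z; rewrite /b1 /dot -sumrN; congr (1 + _); apply: eq_bigr => d _; rewrite mulNr.
have jb2 : jet U b2 (fun d _ => JX d y) (fun _ _ _ => 0).
  rewrite (_ : b2 = fun z => 0 + \sum_d JX d y * X d z); first exact: jet_lin.
  by apply/funext => z; rewrite add0r.
have jA : jet U A (fun d z => -1 * (2 * X d z)) (fun d e z => -1 * (2 * (d == e)%:R)).
  have := jetD (jet_cst U 1) (jetM (jet_cst U (-1)) (jet_sqn U)).
  rewrite (_ : (fun z => 1 + -1 * sqn z) = A); last by apply/funext => z; rewrite mulN1r.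
  congr (jet _ _ _ _).
    by apply/funext => d; apply/funext => z; rewrite mul0r addr0 add0r.
  by do 3 (apply/funext => ?); ring.
have jS := jetD (jetM jb1 jb1) (jetM jb2 jb2).
rewrite (_ : (fun z => b1 z * b1 z + b2 z * b2 z) = S) in jS; last first.
  by apply/funext => z; rewrite /S !expr2.
do 5 eexists; split; [exact: jA|exact: jb1|exact: jS|] => z Uz p; rewrite /p.
have hA r : GG z (fun d => -1 * (2 * X d z)) r = - 2 * A z * dot (X^~ z) r.
  by rewrite /GG !dotZl !dotZr dot_X [dot (JX^~ z) _]dotC dot_JX_X /A; ring.
have XY : dot (X^~ z) (X^~ y) = 1 - b1 z by rewrite /b1 dotC opprB addrC subrK.
have XJY : dot (X^~ z) (JX^~ y) = b2 z by rewrite dotC.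
have JXY : dot (JX^~ z) (X^~ y) = - b2 z by rewrite dot_JXl XJY.
have YE : dot (X^~ y) (X^~ y) = 1 - c by rewrite dot_X /c; ring.
(* As b1 and b2 are, up to sign, the real and imaginary parts of the holomorphic function 1 - <z,y>,
   their gradients have equal length and are orthogonal for the form [GG]. *)
have G11 : GG z (fun d => - X d y) (fun d => - X d y) = 2 * b1 z - S z - c.
  rewrite /GG; under eq_fun do rewrite -mulN1r; rewrite !dotZl !dotZr.
  by rewrite YE XY JXY /S; ring.
have G22 : GG z (fun d => JX d y) (fun d => JX d y) = 2 * b1 z - S z - c.
  by rewrite /GG dot_JX YE XJY dot_JX XY /S; ring.
have G12 : GG z (fun d => - X d y) (fun d => JX d y) = 0.
  rewrite /GG; under eq_fun do rewrite -mulN1r; rewrite !dotZl !dotZr.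
  by rewrite dot_JX_X XY XJY JXY dot_JX XY; ring.
have cM (u : R) (r : D -> R) : (fun d => r d * u) = (fun d => u * r d).
  by apply/funext => d; rewrite mulrC.
have G1A : GG z (fun d => - X d y) (fun d => -1 * (2 * X d z)) = 2 * A z * (1 - b1 z).
  rewrite GGC hA; under [X in dot _ X]eq_fun do rewrite -mulN1r.
  by rewrite dotZr XY; ring.
have G2A : GG z (fun d => JX d y) (fun d => -1 * (2 * X d z)) = - 2 * A z * b2 z.
  by rewrite GGC hA XJY.
split.
- by under eq_fun do under eq_fun do rewrite mulN1r -mulN1r; rewrite LLZ LL_id /A; ring.
- under eq_fun do under eq_fun do rewrite !mulr0 !mul0r !addr0 !add0r.
  rewrite !LLD !LL_prod_sym !LL_prod G11 G22; ring.
- by rewrite hA !dotZr dot_X /A; ring.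
- rewrite !GGDl !cM !GGZl G1A G2A /S; ring.
split.
- by rewrite !GGDl !GGDr !cM !GGZl !GGZr [GG z (JX^~ y) _]GGC G11 G12 G22 /S; ring.
- exact: G1A.
- by rewrite !GGDr !cM !GGZr G11 G12; ring.
- exact: G11.
Qed.

Lemma jetV (V : set (Cn R n)) (u : Cn R n -> R) u1 u2 :
  jet V u u1 u2 -> (forall z, V z -> u z != 0) ->
  jet V (fun z => (u z)^-1) (fun d z => - (u z) ^- 2 * u1 d z)
    (fun d e z => - (u z) ^- 2 * u2 d e z + 2 * (u z) ^- 3 * u1 e z * u1 d z).
Proof.
move=> ju u0.
have dV (x : R) : x != 0 -> is_derive x (1 : R) (fun x : R => x^-1) (- x ^- 2).
  move=> x0; have h := @is_deriveV _ id x _ _ x0 (is_derive_id x (1 : R)).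
  by apply: (is_derive_eq h); rewrite /GRing.scale /= mulr1.
apply: (jet_comp (f := fun x => x^-1) (f1 := fun x => - x ^- 2) (f2 := fun x => 2 * x ^- 3) ju) => z /u0 x0.
- exact: dV.
- have h := @is_deriveX _ _ (fun x : R => x^-1) 2 _ _ _ (dV _ x0).
  have {}h := is_deriveN h; rewrite exprfctE in h.
  rewrite (_ : (fun x : R => - x ^- 2) = - (fun x : R => (x^-1) ^+ 2)); last first.
    by apply/funext => x /=; rewrite -exprVn.
  by apply: (is_derive_eq h); rewrite /GRing.scale /=; field.
- have cV : {for u z, continuous (fun x : R => x^-1)} by exact: inv_continuous.
  apply: (@continuousM R R (cst 2) (fun x => x ^- 3)); first exact: cst_continuous.
  rewrite (_ : (fun x : R => x ^- 3) = (fun x => x^-1 * (x^-1 * x^-1))).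
    do 2 (apply: continuousM; first exact: cV); exact: cV.
  by apply/funext => x; rewrite -exprVn !exprS expr0 mulr1.
Qed.

(** After multiplication by A, Lq and G(q,q) depend on q alone and G(q,M) is a multiple of M, while
    LM = 0 because M is the real part of a holomorphic function. Hence M-harmonicity of phi(q) M and
    of phi(q) amounts to an ordinary differential equation for phi. *)
Lemma jet_qM : exists q1 q2 M1 M2,
  [/\ jet U q q1 q2, jet U M M1 M2 &
  forall z, U z -> let p u := fun d : D => (u d z : R) in
   [/\ A z * LL z (fun d e => q2 d e z) = 4 * ((n%:R + 1) * q z - c),
       A z * GG z (p q1) (p q1) = 4 * q z * (q z - c),
       LL z (fun d e => M2 d e z) = 0 &
       A z * GG z (p q1) (p M1) = 2 * c * M z]].
Proof.
have [A1 [A2 [b11 [S1 [S2 [jA jb1 jS H]]]]]] := jet_base.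
have jAV := jetV jA (fun z Uz => lt0r_neq0 (yA_gt0 Uz)).
have jSV := jetV jS (fun z Uz => lt0r_neq0 (yS_gt0 Uz)).
have jq := jetM jS jAV.
have jM := jetD (jetM (jetM (jet_cst U 2) jb1) jSV) (jet_cst U (- (2 / c))).
do 4 eexists; split; [exact: jq|exact: jM|] => z Uz p; rewrite /p.
have [LA LS GAA GSA [GSS GbA GbS Gbb]] := H z Uz.
have A0 := lt0r_neq0 (yA_gt0 Uz); have S0 := lt0r_neq0 (yS_gt0 Uz).
have c0 := lt0r_neq0 yc_gt0.
have cM (u : R) (r : D -> R) : (fun d => r d * u) = (fun d => u * r d).
  by apply/funext => d; rewrite mulrC.
set w := A1^~ z in LA GAA GSA GbA *; set s := S1^~ z in LS GSA GSS GbS *.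
set b := b11^~ z in GbA GbS Gbb *.
have GAS : GG z w s = 4 * A z * (b1 z - S z) by rewrite GGC.
have GAb : GG z w b = 2 * A z * (1 - b1 z) by rewrite GGC.
have GSb : GG z s b = 2 * b1 z * (2 * b1 z - S z - c) by rewrite GGC.
have E0 : (fun d : D => 2 * b11 d z + 0 * b1 z) = (fun d => 2 * b11 d z).
  by apply/funext => d; rewrite mul0r addr0.
split.
- rewrite LL_M LL_comp LA LS GGZr GSA GAA /q; field; exact: A0.
- rewrite !GGDl !GGDr !cM !(GGZl, GGZr) GSA GAA GAS GSS /q; field; exact: A0.
- under eq_fun do under eq_fun do rewrite addr0; rewrite LL_M.
  rewrite E0 !GGZl GGZr GbS LL_comp LS GSS.
  rewrite (_ : (fun d e : D => _) = fun _ _ => 0 * 0); last by do 2 (apply/funext => ?); ring.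
  rewrite LLZ; field; exact: S0.
- under [X in GG z _ X]eq_fun do rewrite addr0 mul0r addr0.
  rewrite !GGDl !GGDr !cM !(GGZl, GGZr) GSb GAb GAS GSS /q /M; field.
  by rewrite A0 S0 c0.
Qed.

Lemma jet_phi1 (V : set (Cn R n)) (u : Cn R n -> R) u1 u2 k :
  jet V u u1 u2 -> (forall z, V z -> c < u z) ->
  jet V (fun z => phi1 k c (u z)) (fun d z => - k%:R * phi1 k c (u z) / (u z - c) * u1 d z)
   (fun d e z => - k%:R * phi1 k c (u z) / (u z - c) * u2 d e z +
     (k%:R * (k%:R + 1) * phi1 k c (u z) / (u z - c) ^+ 2) * u1 e z * u1 d z).
Proof.
move=> ju uc; have dsub x : is_derive x (1 : R) (fun x : R => x - c) 1.
  by apply: is_derive_eq; ring.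
have dV x : c < x -> is_derive x (1 : R) (fun x : R => (x - c)^-1) (- (x - c) ^- 2).
  move=> cx; have x0 : x - c != 0 by rewrite gt_eqF ?subr_gt0.
  have h := @is_deriveV _ (fun x => x - c) x _ _ x0 (dsub x).
  by apply: (is_derive_eq h); rewrite /GRing.scale /= mulr1.
apply: (jet_comp (f := phi1 k c) (f1 := fun x => - k%:R * phi1 k c x / (x - c))
  (f2 := fun x => k%:R * (k%:R + 1) * phi1 k c x / (x - c) ^+ 2) ju) => z /uc x0.
- exact: is_derive_phi1.
- have h := @is_deriveM _ _ (cst (- k%:R)) (phi1 k c) _ _ _ _ (is_derive_cst _ _ _) (is_derive_phi1 k x0).
  have {}h := @is_deriveM _ _ (cst (- k%:R) * phi1 k c) (fun x => (x - c)^-1) _ _ _ _ h (dV _ x0).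
  apply: (is_derive_eq h); rewrite /GRing.scale /= mulr0 addr0 mulrfctE /cst.
  by field; rewrite gt_eqF ?subr_gt0.
- have c1 := is_derive_continuous (is_derive_phi1 k x0).
  have c2 := is_derive_continuous (dV _ x0).
  rewrite (_ : (fun x => _) = (fun x : R => (k%:R * (k%:R + 1)) * (phi1 k c x * ((x - c)^-1 * (x - c)^-1)))).
    apply: (@continuousM R R (cst _) (fun x => phi1 k c x * ((x - c)^-1 * (x - c)^-1))).
      exact: cst_continuous.
    apply: (@continuousM R R (phi1 k c)) => //.
    exact: (@continuousM R R (fun x => (x - c)^-1)).
  by apply/funext => x; rewrite -!mulrA -exprVn expr2.
Qed.

Lemma jet_phi2 (V : set (Cn R n)) (u : Cn R n -> R) u1 u2 k : (0 < k)%N ->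
  jet V u u1 u2 -> (forall z, V z -> c < u z) ->
  jet V (fun z => phi2 k c (u z)) (fun d z => - phi1 k c (u z) / u z * u1 d z)
   (fun d e z => - phi1 k c (u z) / u z * u2 d e z +
     (k%:R * phi1 k c (u z) / ((u z - c) * u z) + phi1 k c (u z) / u z ^+ 2) * u1 e z * u1 d z).
Proof.
move=> k0 ju uc.
have pos x : c < x -> x != 0 by move=> cx; rewrite gt_eqF // (lt_trans yc_gt0).
have dV (x : R) : x != 0 -> is_derive x (1 : R) (fun x : R => x^-1) (- x ^- 2).
  move=> x0; have h := @is_deriveV _ id x _ _ x0 (is_derive_id x (1 : R)).
  by apply: (is_derive_eq h); rewrite /GRing.scale /= mulr1.
have dN (x : R) : c < x -> is_derive x (1 : R) (fun x : R => - phi1 k c x / x)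
   (k%:R * phi1 k c x / ((x - c) * x) + phi1 k c x / x ^+ 2).
  move=> cx; have h := @is_deriveM _ _ (- phi1 k c) (fun x => x^-1) _ _ _ _
    (is_deriveN (is_derive_phi1 k cx)) (dV _ (pos _ cx)).
  apply: (is_derive_eq h); rewrite /GRing.scale /= opprfctE.
  by field; rewrite pos // gt_eqF ?subr_gt0.
apply: (jet_comp (f := phi2 k c) (f1 := fun x => - phi1 k c x / x)
  (f2 := fun x => k%:R * phi1 k c x / ((x - c) * x) + phi1 k c x / x ^+ 2) ju) => z /uc x0.
- exact: is_derive_phi2 k0 yc_gt0 x0.
- exact: dN.
- have c1 := is_derive_continuous (is_derive_phi1 k x0).
  have c2 := is_derive_continuous (dV _ (pos _ x0)).
  have c3 : {for u z, continuous (fun x : R => (x - c)^-1)}.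
    have h := @is_deriveV _ (fun x => x - c) (u z) 1 1 _ _.
    apply: is_derive_continuous (h _ _); first by rewrite gt_eqF ?subr_gt0.
    by apply: is_derive_eq; ring.
  rewrite (_ : (fun x => _) = (fun x : R => k%:R * (phi1 k c x * ((x - c)^-1 * x^-1)))
     + (fun x => phi1 k c x * (x^-1 * x^-1))).
    apply: (@continuousD R R^o R).
      apply: (@continuousM R R (cst _)); first exact: cst_continuous.
      apply: (@continuousM R R (phi1 k c)) => //.
      exact: (@continuousM R R (fun x => (x - c)^-1)).
    apply: (@continuousM R R (phi1 k c)) => //.
    exact: (@continuousM R R (fun x => x^-1)).
  by apply/funext => x; rewrite -!mulrA invfM -exprVn expr2.
Qed.

Lemma jet_test_fun : (0 < n)%N -> exists u1 u2, jet U test_fun u1 u2 /\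
  forall z, U z -> LL z (fun d e => u2 d e z) = 0.
Proof.
move=> n0; have [q1 [q2 [M1 [M2 [jq jM H]]]]] := jet_qM.
have ju := jetD (jetM (jet_phi1 n jq yq_gt) jM)
  (jetM (jet_cst U yalpha) (jet_phi2 n0 jq yq_gt)).
do 2 eexists; split; [exact: ju|] => z Uz.
have [Lq Gqq LM GqM] := H z Uz.
have A0 := lt0r_neq0 (yA_gt0 Uz); have cq := yq_gt Uz.
have q0 : q z != 0 by rewrite gt_eqF // (lt_trans yc_gt0).
have qc0 : q z - c != 0 by rewrite gt_eqF // subr_gt0.
rewrite LLD !LL_M !LL_comp LM.
rewrite (_ : (fun d e : D => 0) = fun _ _ => 0 * 0); last by do 2 (apply/funext => ?); rewrite mul0r.
rewrite LLZ !GGZl.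
rewrite (_ : GG z (fun _ => 0) _ = 0); last first.
  rewrite (_ : (fun=> 0) = fun _ : D => 0 * 0); last by apply/funext => ?; rewrite mul0r.
  by rewrite GGZl mul0r.
apply: (mulfI A0); rewrite mulr0.
set f1 := phi1 _ _ _; set lq := LL _ _ in Lq *; set gq := GG _ _ _ in Gqq *.
set gM := GG _ _ _ in GqM *.
(* Once the values of [jet_qM] are inserted, the part proportional to M and the part proportional to
   [yalpha] vanish separately: both summands of the test function are M-harmonic. *)
transitivity (M z * (- n%:R * f1 / (q z - c) * (A z * lq)
   + n%:R * (n%:R + 1) * f1 / (q z - c) ^+ 2 * (A z * gq))
   + 2 * (- n%:R * f1 / (q z - c)) * (A z * gM)
   + yalpha * (- f1 / q z * (A z * lq) + (n%:R * f1 / ((q z - c) * q z) + f1 / q z ^+ 2) * (A z * gq))).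
  by field; rewrite q0 qc0.
by rewrite Lq Gqq GqM; field; rewrite q0 qc0.
Qed.

End test_function.

(** * Lower bound and size of the test function *)

Section test_function_bounds.
Context {R : realType} {n : nat}.
Variable y : Cn R n.
Hypotheses (n0 : (0 < n)%N) (y1 : sqn y < 1).
Implicit Types (z : Cn R n).
Local Notation c := (yc y).
Local Notation A := yA.
Local Notation S := (yS y).
Local Notation q := (yq y).
Local Notation M := (yM y).
Local Notation U := (punctured_ball y).

Let c0 : 0 < c := yc_gt0 y1.

Lemma phi1_ge0 k x : c < x -> 0 <= phi1 k c x.
Proof. by move=> cx; rewrite exprn_ge0 // divr_ge0 ?subr_ge0 // ltW. Qed.

(** Replacing M by -(2-c)/c (1 - c/q) in the test function leaves (2-c)/c times [psi] at q. *)
Definition psi x := (n%:R - c) * phi2 n c x - phi1 n c x * (x - c) / x.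

(** The coefficient n - c is tuned here: the terms in n cancel, and what remains changes sign
    exactly at x = 1. *)
Lemma is_derive_psi x : c < x ->
  is_derive x 1 psi (phi1 n c x * c / x * (1 - x^-1)).
Proof.
move=> cx; have x0 : x != 0 by rewrite gt_eqF // (lt_trans c0).
have xc0 : x - c != 0 by rewrite gt_eqF // subr_gt0.
have h1 := @is_deriveM _ _ (cst (n%:R - c)) (phi2 n c) _ _ _ _ (is_derive_cst _ x (1 : R)) (is_derive_phi2 n0 c0 cx).
have d1 : is_derive x (1 : R) (fun x : R => x - c) 1 by apply: is_derive_eq; ring.
have h2 := @is_deriveM _ _ (phi1 n c) (fun x : R => x - c) _ _ _ _ (is_derive_phi1 n cx) d1.
have h3 := @is_deriveM _ _ (phi1 n c * (fun x : R => x - c)) (fun x => x^-1) _ _ _ _ h2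
  (@is_deriveV _ id x _ _ x0 (is_derive_id x (1 : R))).
have := @is_deriveB _ _ _ _ _ _ _ _ _ h1 h3.
move=> h; apply: (is_derive_eq h); rewrite /GRing.scale /= mulr0 addr0 mulrfctE /cst.
by field; rewrite x0 xc0.
Qed.

Hypothesis cl1 : c < 1.

Lemma psi_min x : c < x -> psi 1 <= psi x.
Proof.
move=> cx; have [x1|x1] := leP 1 x.
  apply: (@le_is_derive R psi (fun x => phi1 n c x * c / x * (1 - x^-1)) 1 x x1) => t /andP[t1 _].
    by apply: is_derive_psi; exact: lt_le_trans cl1 t1.
  have ct : c < t by exact: lt_trans t1.
  rewrite mulr_ge0 //; first by rewrite divr_ge0 ?mulr_ge0 ?phi1_ge0 // ltW // (lt_trans c0).
  by rewrite subr_ge0 invf_le1 ?(lt_trans c0) // ltW.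
rewrite -lerN2.
apply: (@le_is_derive R (- psi) (fun x => - (phi1 n c x * c / x * (1 - x^-1))) x 1 (ltW x1)) => t /andP[xt t1].
  by apply: is_deriveN; apply: is_derive_psi; exact: lt_le_trans cx xt.
have ct : c < t by exact: lt_trans xt.
rewrite -mulrN mulr_ge0 //; first by rewrite divr_ge0 ?mulr_ge0 ?phi1_ge0 // ltW // (lt_trans c0).
rewrite opprB subr_ge0 invf_ge1 ?(lt_trans c0) //; exact: ltW.
Qed.

(** M is at least -(2-c)/c (1 - c/q) minus max(0, A - c)/S; then [psi_min] applies. At z = 0 one has
    q = S = A = 1 and equality holds, so (2-c)/c [psi 1] exceeds the value at 0 by the deficit
    there, (1-c) [phi1 n c 1]. *)
Lemma test_fun_ge z : U z ->
  test_fun y 0 + (1 - c) * phi1 n c 1 - phi1 n c (q z) * (Num.max 0 (A z - c) / S z) <= test_fun y z.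
Proof.
move=> Uz; have cq := yq_gt y1 Uz; have S0 := yS_gt0 y1 Uz; have A0 := yA_gt0 Uz.
have q0 : 0 < q z by exact: lt_trans cq.
have A0E : A (0 : Cn R n) = 1 by rewrite /yA /sqn big1 ?subr0 // => d _; rewrite X0 expr0n.
have b10 : yb1 y 0 = 1 by rewrite /yb1 /dot big1 ?subr0 // => d _; rewrite X0 mulr0.
have b20 : yb2 y 0 = 0 by rewrite /yb2 /dot big1 // => d _; rewrite X0 mulr0.
have S0E : S 0 = 1 by rewrite /yS b10 b20 expr1n expr0n addr0.
have q0E : q 0 = 1 by rewrite /yq S0E A0E divr1.
have E0 : test_fun y 0 + (1 - c) * phi1 n c 1 = (2 - c) / c * psi 1.
  rewrite /test_fun q0E /yM b10 S0E /psi /yalpha.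
  by field; rewrite gt_eqF.
have E1 : yalpha y * phi2 n c (q z) = (2 - c) / c * (psi (q z) + phi1 n c (q z) * (1 - c * A z / S z)).
  have -> : c * A z / S z = c / q z by rewrite /yq; field; rewrite !gt_eqF.
  by rewrite /psi /yalpha; field; rewrite !gt_eqF.
rewrite E0 /test_fun E1.
have c2 : 0 <= (2 - c) / c by rewrite divr_ge0 ?(ltW c0) // subr_ge0 (le_trans (ltW cl1)) // ler1n.
have h1 : (2 - c) / c * psi 1 <= (2 - c) / c * psi (q z) by rewrite ler_wpM2l // psi_min.
have p0 : 0 <= phi1 n c (q z) by exact: phi1_ge0.
(* Multiplied by S this is 2 b1 - S - (2-c) A + max(0, A-c), which by [yb1_ge] is at least c - A +
   max(0, A-c) >= 0. *)
suff h2 : 0 <= M z + (2 - c) / c * (1 - c * A z / S z) + Num.max 0 (A z - c) / S z.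
  rewrite -subr_ge0 [X in 0 <= X](_ : _ = ((2 - c) / c * psi (q z) - (2 - c) / c * psi 1) +
    phi1 n c (q z) * (M z + (2 - c) / c * (1 - c * A z / S z) + Num.max 0 (A z - c) / S z)).
    by rewrite addr_ge0 ?mulr_ge0 // subr_ge0.
  by ring.
have -> : M z + (2 - c) / c * (1 - c * A z / S z) + Num.max 0 (A z - c) / S z =
  (2 * yb1 y z - S z - (2 - c) * A z + Num.max 0 (A z - c)) / S z.
  by rewrite /yM; field; rewrite !gt_eqF.
rewrite divr_ge0 ?(ltW S0) //.
have := yb1_ge y z; have : A z - c <= Num.max 0 (A z - c) by rewrite le_max lexx orbT.
lra.
Qed.

(** Re <z,y> <= (|z|^2 + |y|^2)/2 <= (1 + |y|^2)/2, so Re (1 - <z,y>) >= c/2. *)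
Lemma yS_ge z : sqn z < 1 -> c ^+ 2 / 4 <= S z.
Proof.
move=> z1; have : 0 <= sqn (z - y) by exact: sqn_ge0.
rewrite sqnB => h; have hb : c / 2 <= yb1 y z by rewrite /yb1 /yc; lra.
rewrite /yS; have := sqr_ge0 (yb2 y z).
have c20 : 0 <= c / 2 by rewrite divr_ge0 // ltW.
have : (c / 2) ^+ 2 <= yb1 y z ^+ 2 by rewrite ler_sqr // nnegrE // (le_trans c20).
by rewrite expr_div_n; lra.
Qed.

Lemma yS_le4 z : sqn z < 1 -> S z <= 4.
Proof.
move=> z1; have := hermitian_CS y z.
have : sqn y * sqn z <= 1 by rewrite mulr_ile1 ?sqn_ge0 // ltW.
rewrite /yS /yb1; set p := dot _ _ => h1 h2.
have := sqr_ge0 (p + 1); have := sqr_ge0 (yb2 y z).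
nra.
Qed.

(** By [yS_subE], c/(q - c) = c A / (S - c A) <= A / |z - y|^2, and A <= 1. *)
Lemma phi1_le z : U z -> phi1 n c (q z) <= sqn (z - y) ^- n.
Proof.
move=> Uz; have cq := yq_gt y1 Uz; have S0 := yS_gt0 y1 Uz; have A0 := yA_gt0 Uz.
have D0 := yS_gt y1 Uz.
have Z0 : 0 < sqn (z - y).
  by case: Uz => _ zy; apply: sqn_gt0 => /eqP; rewrite subr_eq0 => /eqP.
rewrite /phi1 -exprVn lerXn2r ?nnegrE ?invr_ge0 ?(ltW Z0) ?divr_ge0 ?(ltW c0) ?subr_ge0 ?(ltW cq) //.
have -> : c / (q z - c) = c * A z / (S z - c * A z).
  have h : S z - c * A z != 0 by rewrite gt_eqF // subr_gt0.
  by rewrite {1}/yq; field; rewrite h gt_eqF.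
rewrite ler_pdivrMr ?subr_gt0 // ler_pdivlMl //.
have h : c * sqn (z - y) <= S z - c * A z.
  by rewrite yS_subE -addrA lerDl addr_ge0 ?sqr_ge0.
apply: le_trans h; rewrite mulrCA ler_wpM2l ?(ltW c0) // ler_piMr ?(ltW Z0) //.
by rewrite /yA lerBlDr lerDl sqn_ge0.
Qed.

Lemma test_fun_bounded (del : R) : 0 < del ->
  exists K, forall z, U z -> del <= sqn (z - y) -> `|test_fun y z| <= K.
Proof.
move=> del0; pose Q1 := 1 - Num.min (1 / 2) (c * del / 4).
(* Away from the pole, 1 - c/q = (S - c A)/S >= c del / 4 because S <= 4; so the argument of the
   profile stays below 1 - m. *)
pose m := Num.min (1 / 2) (c * del / 4).
have m0 : 0 < m by rewrite lt_min divr_gt0 //= divr_gt0 // mulr_gt0.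
have m1 : m <= 1 / 2 by rewrite ge_min lexx.
have m2 : m <= c * del / 4 by rewrite ge_min lexx orbT.
exists (del ^- n * (1 + 4 / c ^+ 2 + 2 / c) + `|yalpha y| * green_profile n.-1 (1 - m)).
move=> z Uz dz; have cq := yq_gt y1 Uz; have S0 := yS_gt0 y1 Uz; have A0 := yA_gt0 Uz.
have q0 : 0 < q z by exact: lt_trans cq.
have z1 : sqn z < 1 by case: Uz.
have Z0 : 0 < sqn (z - y) by exact: lt_le_trans dz.
rewrite /test_fun (le_trans (ler_normD _ _)) // !normrM lerD //.
  rewrite ler_pM //; first rewrite ger0_norm ?phi1_ge0 // (le_trans (phi1_le Uz)) //.
    by rewrite lef_pV2 ?posrE ?exprn_gt0 // lerXn2r ?nnegrE ?(ltW del0) ?(ltW Z0).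
  rewrite /yM (le_trans (ler_normB _ _)) // lerD //; last by rewrite ger0_norm // divr_ge0 // ltW.
  rewrite normrM [`|(S z)^-1|]ger0_norm ?invr_ge0 ?(ltW S0) //.
  have Sge := yS_ge z1.
  have hb : `|2 * yb1 y z| <= 1 + S z.
    rewrite ler_norml /yS; have := sqr_ge0 (yb2 y z).
    have := sqr_ge0 (yb1 y z - 1); have := sqr_ge0 (yb1 y z + 1).
    by move=> h1 h2 h3; apply/andP; split; nra.
  apply: le_trans (ler_wpM2r _ hb) _; first by rewrite invr_ge0 ltW.
  rewrite mulrDl divff ?gt_eqF // addrC lerD2l mul1r.
  have -> : 4 / c ^+ 2 = (c ^+ 2 / 4)^-1 by rewrite invf_div.
  by rewrite lef_pV2 // posrE // divr_gt0 // exprn_gt0.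
rewrite ler_wpM2l // ger0_norm; last first.
  apply: green_profile_ge0; first by rewrite divr_ge0 // ltW.
  by rewrite ltr_pdivrMr // mul1r.
apply: le_green_profile; first by rewrite divr_ge0 // ltW.
  have -> : c / q z = 1 - (S z - c * A z) / S z by rewrite /yq; field; rewrite !gt_eqF.
  rewrite lerD2l lerN2 (le_trans m2) // ler_pdivlMr //.
  have h : c * sqn (z - y) <= S z - c * A z.
    by rewrite yS_subE -addrA lerDl addr_ge0 ?sqr_ge0.
  apply: le_trans h.
  have h4 : c * del / 4 * S z <= c * del / 4 * 4.
    by rewrite ler_wpM2l ?yS_le4 // ltW // divr_gt0 // mulr_gt0.
  apply: (le_trans h4); rewrite divfK // ler_wpM2l //; exact: ltW.
by rewrite ltrBlDr ltrDl.
Qed.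

(** |y|^2 - |z|^2 = -|z-y|^2 - 2 Re <z-y, y>, and |y| < 1. This is what lowers the order of the
    singularity from 2n to 2n - 1. *)
Lemma sqn_sub_le z : sqn y - sqn z <= 2 * enorm (z - y).
Proof.
have h1 : sqn y - sqn z <= 2 * `|dot (X^~ y) (X^~ (z - y))|.
  have -> : dot (X^~ y) (X^~ (z - y)) = dot (X^~ y) (X^~ z) - sqn y.
    by rewrite -dot_X /dot -sumrB; apply: eq_bigr => d _; rewrite XB mulrBr.
  have : 0 <= sqn (z - y) by exact: sqn_ge0.
  rewrite sqnB; set p := dot _ _ => h.
  have := ler_norm (- (p - sqn y)); rewrite normrN; lra.
apply: (le_trans h1); rewrite ler_pM2l // -ler_sqr ?nnegrE ?enorm_ge0 //.
rewrite real_normK ?num_real // sqr_enorm.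
have := hermitian_CS y (z - y); have := sqr_ge0 (yb2 y (z - y)) => h2 h3.
have : sqn y * sqn (z - y) <= sqn (z - y) by rewrite ler_piMl ?sqn_ge0 // ltW.
lra.
Qed.

End test_function_bounds.

(** * Lebesgue measure and the invariant measure *)

Section borel.
Context {R : realType} {n : nat}.
Implicit Types (z : Cn R n) (U : set (Cn R n)).
Local Notation D := ('I_n * bool)%type.

Lemma measurable_X d : measurable_fun [set: Cn R n] (X d : Cn R n -> R).
Proof. by case: d => i []; rewrite X.unlock; [exact: measurable_Cn_Im|exact: measurable_Cn_Re]. Qed.

Lemma cubeE z (r : R) : cube z r = \bigcap_(d in [set: D]) (X d @^-1` `](X d z - r), (X d z + r)[%classic).
Proof.
apply/seteqP; split=> w /= h d.
  by move=> _ /=; have := h d; rewrite in_itv /= ltr_distl.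
by have /= := h d I; rewrite in_itv /= ltr_distl.
Qed.

Lemma measurable_box (a b : D -> R) :
  measurable (\bigcap_(d in [set: D]) (X d @^-1` `](a d), (b d)[%classic) : set (Cn R n)).
Proof.
apply: fin_bigcap_measurable => // d _; rewrite -[_ @^-1` _]setTI.
exact: measurable_X.
Qed.

Lemma measurable_cube z (r : R) : measurable (cube z r).
Proof. by rewrite cubeE; exact: measurable_box. Qed.

(** The sigma-algebra is generated by the coordinates, so an open set is written as the union of the
    countably many boxes with rational ends that it contains. *)
Lemma open_measurable_Cn U : open U -> measurable U.
Proof.
move=> oU.
pose B (f : {ffun D -> rat * rat}) : set (Cn R n) :=
  \bigcap_(d in [set: D]) (X d @^-1` `](ratr (f d).1), (ratr (f d).2)[%classic).
rewrite (_ : U = \bigcup_f (if `[< B f `<=` U >] then B f else set0)).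
  apply: countable_bigcupT_measurable; first exact: countableP.
  by move=> f; case: asboolP => // _; exact: measurable_box.
apply/seteqP; split=> [z Uz|z [f _]]; last by case: asboolP => // h; exact: h.
have /nbhs_CnP[r r0 rU] : nbhs z U by exact: open_nbhs_nbhs.
have h1 d : exists q : rat, ratr q \in `]X d z - r, X d z[ by apply: rat_in_itvoo; lra.
have h2 d : exists q : rat, ratr q \in `]X d z, X d z + r[ by apply: rat_in_itvoo; lra.
have [f1 H1] := choice h1; have [f2 H2] := choice h2.
exists [ffun d => (f1 d, f2 d)] => //; case: asboolP => [_ d _ /=|[] w Bw].
  rewrite in_itv /= ffunE /=; have := H1 d; have := H2 d; rewrite !in_itv /=.
  by move=> /andP[-> _] /andP[_ ->].
apply: rU => d; have := Bw d I; rewrite /= in_itv /= ffunE /= ltr_distl.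
have := H1 d; have := H2 d; rewrite !in_itv /= => /andP[_ a1] /andP[a2 _] /andP[a3 a4].
by rewrite (lt_trans a2) // (lt_trans a4).
Qed.

Lemma cont_measurable U (u : Cn R n -> R) : open U -> cont U u -> measurable_fun U u.
Proof.
move=> oU cu; apply: (measurability _ (RGenOInfty.measurableE R)) => _ [_ [x ->] <-].
apply: open_measurable_Cn.
rewrite openE => z [Uz /= uz]; rewrite /interior.
have Un : nbhs z U by exact: open_nbhs_nbhs.
have H : nbhs z (fun w => x < u w).
  by apply: (cu z Uz [set t | x < t]); apply: open_nbhs_nbhs; split; [exact: open_gt|move: uz; rewrite in_itv /= andbT].
by apply: filterS2 Un H => w Uw xu; split => //=; rewrite in_itv /= andbT.
Qed.

End borel.

Section line_cons.
Context {R : realType}.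
Local Notation RR := (measurableTypeR R * measurableTypeR R)%type.
Implicit Types (c : RR).

Lemma line_cons_lift n (i : 'I_n) b c (z : Cn R n) (s : R) :
  line (Cn_cons (c, z)) (dir (lift ord0 i, b)) s = Cn_cons (c, line z (dir (i, b)) s).
Proof.
apply: CnP => -[j b']; rewrite X_line X_dir.
case: (unliftP ord0 j) => [k|] ->.
  have XE w : X (lift ord0 k, b') (Cn_cons (c, w)) = X (k, b') w.
    by rewrite X.unlock /= Cn_cons_lift.
  by rewrite !XE X_line X_dir !xpair_eqE (inj_eq lift_inj).
have XE w : X (ord0, b') (Cn_cons (c, w)) = X (ord0, b') (Cn_cons (c, z)).
  by rewrite X.unlock /= !Cn_cons_0.
by rewrite XE xpair_eqE (negbTE (neq_lift _ _)) mulr0 addr0.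
Qed.

Lemma line_cons_0 n (b : bool) (x y : R) (z : Cn R n) (s : R) :
  line (Cn_cons ((x, y), z)) (dir (ord0, b)) s =
  Cn_cons ((if b then (x, y + s) else (x + s, y)), z).
Proof.
apply: CnP => -[j b']; rewrite X_line X_dir xpair_eqE.
case: (unliftP ord0 j) => [k|] ->.
  have XE c w : X (lift ord0 k, b') (Cn_cons (c, w)) = X (k, b') w.
    by rewrite X.unlock /= Cn_cons_lift.
  by rewrite !XE eq_sym (negbTE (neq_lift _ _)) mulr0 addr0.
rewrite eqxx X.unlock /= !Cn_cons_0; case: b b' => -[] /=; by rewrite ?mulr0 ?mulr1 ?addr0.
Qed.

End line_cons.

(** * Tonelli on C^n, one complex coordinate at a time *)

Section tonelli.
Context {R : realType}.
Local Open Scope ereal_scope.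
Local Notation mu := (@lebesgue_measure R).
Local Notation RR := (measurableTypeR R * measurableTypeR R)%type.

Lemma integral_Cn_S n (f : Cn R n.+1 -> \bar R) :
  measurable_fun setT f -> (forall z, 0 <= f z) ->
  \int[lebesgue_Cn R n.+1]_z f z =
  \int[@lebesgue_RR R]_c \int[lebesgue_Cn R n]_z f (Cn_cons (c, z)).
Proof.
move=> mf f0.
transitivity (\int[pushforward (@lebesgue_RR R \x lebesgue_Cn R n) (@Cn_cons R n)]_z f z).
  by [].
rewrite (ge0_integral_pushforward (@measurable_Cn_cons R n)) //=.
rewrite preimage_setT fubini_tonelli1 //.
exact: measurableT_comp mf (@measurable_Cn_cons R n).
Qed.

Lemma measurable_Cn_consl n (f : Cn R n.+1 -> \bar R) c :
  measurable_fun setT f -> measurable_fun setT (fun z => f (Cn_cons (c, z))).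
Proof.
move=> mf; apply: measurableT_comp mf (measurableT_comp (@measurable_Cn_cons R n) _).
by apply/measurable_fun_pair => //; exact: measurable_cst.
Qed.

Lemma measurable_Cn_consr n (f : Cn R n.+1 -> \bar R) z :
  measurable_fun setT f -> measurable_fun setT (fun c => f (Cn_cons (c, z))).
Proof.
move=> mf; apply: measurableT_comp mf (measurableT_comp (@measurable_Cn_cons R n) _).
by apply/measurable_fun_pair => //; exact: measurable_cst.
Qed.

Lemma integral_Cn_S' n (f : Cn R n.+1 -> \bar R) :
  measurable_fun setT f -> (forall z, 0 <= f z) ->
  \int[lebesgue_Cn R n.+1]_z f z =
  \int[lebesgue_Cn R n]_z \int[@lebesgue_RR R]_c f (Cn_cons (c, z)).
Proof.
move=> mf f0; rewrite integral_Cn_S //.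
apply: (@fubini_tonelli _ _ _ _ _ _ _ (fun p => f (Cn_cons p))) => //.
exact: measurableT_comp mf (@measurable_Cn_cons R n).
Qed.

Lemma integral_RR (f : RR -> \bar R) : measurable_fun setT f -> (forall c, 0 <= f c) ->
  \int[@lebesgue_RR R]_c f c = \int[mu]_x \int[mu]_y f (x, y).
Proof. by move=> mf f0; rewrite /lebesgue_RR fubini_tonelli1. Qed.

Lemma integral_RR' (f : RR -> \bar R) : measurable_fun setT f -> (forall c, 0 <= f c) ->
  \int[@lebesgue_RR R]_c f c = \int[mu]_y \int[mu]_x f (x, y).
Proof.
move=> mf f0; rewrite (integral_RR mf f0).
exact: (@fubini_tonelli _ _ _ _ _ mu mu f).
Qed.

(** Induction on n peels off the first complex coordinate. Comparing two nonnegative functions,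
    rather than asserting that one integral vanishes, keeps everything within Tonelli; it will be
    used for a positive and a negative part. *)
Lemma eq_integral_slice n (d : 'I_n * bool) (f g : Cn R n -> \bar R) :
  measurable_fun setT f -> (forall z, 0 <= f z) ->
  measurable_fun setT g -> (forall z, 0 <= g z) ->
  (forall z, \int[mu]_s f (line z (dir d) s) = \int[mu]_s g (line z (dir d) s)) ->
  \int[lebesgue_Cn R n]_z f z = \int[lebesgue_Cn R n]_z g z.
Proof.
elim: n d f g => [[[]]//|n IH] [i b] f g mf f0 mg g0 fg.
case: (unliftP ord0 i) fg => [j|] -> fg.
  rewrite (integral_Cn_S mf f0) (integral_Cn_S mg g0); apply: eq_integral => c _.
  apply: (IH (j, b)) => //; [exact: measurable_Cn_consl|exact: measurable_Cn_consl|].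
  by move=> z; have := fg (Cn_cons (c, z)); under eq_integral do rewrite line_cons_lift;
     move=> ->; apply: eq_integral => s _; rewrite line_cons_lift.
(* The direction lies in the first complex coordinate, so that coordinate is integrated
   innermost. *)
rewrite (integral_Cn_S' mf f0) (integral_Cn_S' mg g0); apply: eq_integral => z _.
have mfz := measurable_Cn_consr z mf; have mgz := measurable_Cn_consr z mg.
case: b fg => fg.
  rewrite (integral_RR mfz (fun c => f0 _)) (integral_RR mgz (fun c => g0 _)).
  apply: eq_integral => x _; have := fg (Cn_cons ((x, 0%R), z)).
  under eq_integral do rewrite line_cons_0 add0r; move=> ->.
  by apply: eq_integral => s _; rewrite line_cons_0 add0r.
rewrite (integral_RR' mfz (fun c => f0 _)) (integral_RR' mgz (fun c => g0 _)).
apply: eq_integral => y _; have := fg (Cn_cons ((0%R, y), z)).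
under eq_integral do rewrite line_cons_0 add0r; move=> ->.
by apply: eq_integral => s _; rewrite line_cons_0 add0r.
Qed.

End tonelli.

Section cube_volume.
Context {R : realType}.
Local Notation mu := (@lebesgue_measure R).

Lemma lebesgue_measure_itv_center (a r : R) : 0 < r ->
  mu `](a - r), (a + r)[%classic = (2 * r)%:E.
Proof.
move=> r0; rewrite lebesgue_measure_itv /= lte_fin ifT; last by lra.
by rewrite -EFinB; congr (_%:E); ring.
Qed.

Lemma cube_volume n (z : Cn R n) (r : R) : 0 < r ->
  lebesgue_Cn R n (cube z r) = ((2 * r) ^+ (2 * n))%:E.
Proof.
move=> r0; elim: n z => [|n IH] z.
  rewrite muln0 expr0 /= diracE mem_set // => -[[]]//.
pose I1 : set (measurableTypeR R) := `](X (ord0, false) z - r), (X (ord0, false) z + r)[%classic.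
pose I2 : set (measurableTypeR R) := `](X (ord0, true) z - r), (X (ord0, true) z + r)[%classic.
transitivity (((@lebesgue_RR R) \x lebesgue_Cn R n)%E ((I1 `*` I2) `*` cube (Cn_uncons z).2 r)).
  rewrite /= /lebesgue_Cn_step /pushforward; congr ((_ \x _)%E _).
  have XE (c : measurableTypeR R * measurableTypeR R) (w : Cn R n) k b :
      X (lift ord0 k, b) (Cn_cons (c, w)) = X (k, b) w.
    by rewrite X.unlock /= Cn_cons_lift.
  have XE0 (c : measurableTypeR R * measurableTypeR R) (w : Cn R n) b :
      X (ord0, b) (Cn_cons (c, w)) = if b then c.2 else c.1.
    by rewrite X.unlock /= !Cn_cons_0; case: b.
  have XU k b : X (k, b) (Cn_uncons z).2 = X (lift ord0 k, b) z.
    by rewrite X.unlock /= !mxE.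
  apply/seteqP; split=> [[c w] /= h|[c w] /= [[h1 h2] h] [j b]].
    split=> /=; first split.
    - by have := h (ord0, false); rewrite XE0 /I1 /= in_itv /= ltr_distl.
    - by have := h (ord0, true); rewrite XE0 /I2 /= in_itv /= ltr_distl.
    - by move=> [k b]; have := h (lift ord0 k, b); rewrite XE XU.
  case: (unliftP ord0 j) => [k|] ->; first by rewrite XE -XU.
  move: h1 h2; rewrite XE0 /I1 /I2 /= !in_itv /= -!ltr_distl.
  by case: b.
rewrite product_measure1E; [|by apply: measurableX; exact: measurable_itv|exact: measurable_cube].
have RRE : lebesgue_RR (I1 `*` I2) = (mu I1 * mu I2)%E.
  by apply: product_measure1E; exact: measurable_itv.
transitivity (lebesgue_RR (I1 `*` I2) * ((2 * r) ^+ (2 * n))%:E)%E; first by rewrite -(IH (Cn_uncons z).2).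
rewrite RRE !lebesgue_measure_itv_center // -!EFinM.
by rewrite mulnS exprD expr2.
Qed.

End cube_volume.

Section density.
Local Open Scope ereal_scope.
Context {d} {T : measurableType d} {R : realType}.
Variables (m nu : {measure set T -> \bar R}) (D : set T) (g : T -> R).
Hypotheses (mD : measurable D) (mg : measurable_fun D g)
  (g0 : forall x, D x -> (0 <= g x)%R)
  (nuE : forall A, measurable A -> nu A = \int[m]_(x in A `&` D) (g x)%:E).

Let mgE : measurable_fun D (EFin \o g). Proof. exact/measurable_EFinP. Qed.

Let integral_density_indic (E : set T) : measurable E ->
  \int[nu]_x (\1_E x)%:E = \int[m]_(x in D) ((\1_E x)%:E * (g x)%:E).
Proof.
move=> mE; rewrite integral_indic // setIT nuE // setIC integral_mkcondr.
apply: eq_integral => x _; rewrite patchE indicE.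
by case: ifPn => xE; rewrite ?mul1e ?mul0e.
Qed.

Import HBNNSimple.

Let integral_density_nnsfun (f : {nnsfun T >-> R}) :
  \int[nu]_x (f x)%:E = \int[m]_(x in D) ((f x)%:E * (g x)%:E).
Proof.
under [LHS]eq_integral do rewrite fimfunE -fsumEFin//.
rewrite [LHS]ge0_integral_fsum//; last 2 first.
- by move=> r; exact/measurable_EFinP/measurableT_comp.
- by move=> n x _; rewrite EFinM nnfun_muleindic_ge0.
under [RHS]eq_integral => x xD.
  rewrite fimfunE -fsumEFin// ge0_mule_fsuml; last first.
    by move=> r; rewrite EFinM nnfun_muleindic_ge0.
  over.
have mi r : measurable_fun D (fun x => (\1_(f @^-1` [set r]) x)%:E : \bar R).
  by apply/measurable_EFinP; apply: measurable_funTS.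
rewrite [RHS]ge0_integral_fsum//; last 2 first.
- move=> r; apply: emeasurable_funM => //; apply/measurable_EFinP.
  by apply: measurable_funM => //; apply: measurable_funTS.
- by move=> n x Dx; rewrite EFinM mule_ge0 ?nnfun_muleindic_ge0 // lee_fin g0.
apply: eq_fsbigr => r /[!inE] -[x _ fxr]; rewrite integralZl_indic_nnsfun //=.
rewrite integral_density_indic // -ge0_integralZl //.
- by apply: eq_integral => t _; rewrite EFinM muleA.
- exact: emeasurable_funM.
- by move=> t Dt; rewrite mule_ge0 ?lee_fin ?g0.
- by rewrite -fxr lee_fin.
Qed.

Lemma integral_density (f : T -> \bar R) : measurable_fun setT f -> (forall x, 0 <= f x) ->
  \int[nu]_x f x = \int[m]_(x in D) (f x * (g x)%:E).
Proof.
move=> mf f0; pose f_ := nnsfun_approx measurableT mf.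
have cf x : (f_ n x)%:E @[n --> \oo] --> f x by exact: cvg_nnsfun_approx.
have ndf x : {homo (fun n => (f_ n x)%:E) : n k / (n <= k)%N >-> n <= k}.
  by move=> n k nk; rewrite lee_fin; exact/lefP/nd_nnsfun_approx.
transitivity (lim (\int[nu]_x (f_ n x)%:E @[n --> \oo])).
  rewrite -monotone_convergence//=.
  - by apply: eq_integral => x _; apply/esym/cvg_lim => //; exact: cf.
  - by move=> n; exact/measurable_EFinP/measurable_funTS.
  - by move=> n x _; rewrite lee_fin.
transitivity (lim (\int[m]_(x in D) ((f_ n x)%:E * (g x)%:E) @[n --> \oo])).
  by apply: congr_lim; apply/funext => n; exact: integral_density_nnsfun.
rewrite -monotone_convergence//=.
- apply: eq_integral => x xD; apply/cvg_lim => //.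
  by apply: cvgeZr => //; exact: cf.
- by move=> n; apply: emeasurable_funM => //; exact/measurable_EFinP/measurable_funTS.
- by move=> n x Dx; rewrite mule_ge0 ?lee_fin ?g0.
- by move=> x Dx n k nk; rewrite lee_wpmul2r ?ndf // lee_fin g0.
Qed.

End density.

Section invariant_integral.
Local Open Scope ereal_scope.
Context {R : realType} {n : nat}.

Lemma integral_invariant (E : set (Cn R n)) (f : Cn R n -> \bar R) :
  measurable E -> E `<=` unit_ball R n -> measurable_fun E f -> (forall z, E z -> 0 <= f z) ->
  \int[invariant_measure R n]_(z in E) f z =
  \int[lebesgue_Cn R n]_(z in E) (f z * (invariant_density z)%:E).
Proof.
move=> mE EB mf f0; rewrite integral_mkcond (integral_density (m := lebesgue_Cn R n)
  (@measurable_unit_ball R n) (@measurable_invariant_density R n)) //.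
- rewrite [RHS]integral_mkcond [LHS]integral_mkcond; apply: eq_integral => z _.
  rewrite !patchE; case: (boolP (z \in E)) => zE.
    by rewrite ifT // inE; apply: EB; rewrite inE in zE.
  by case: ifP => // _; rewrite mul0e.
- by move=> z /invariant_density_ge0; rewrite lee_fin.
- exact/(measurable_restrictT f mE).
- by move=> z; rewrite patchE; case: ifPn => // /[!inE]; exact: f0.
Qed.

(** The invariant density is at least 1 on the ball, so the measure dominates the Lebesgue volume of
    a small cube. *)
Lemma open_measure_gt0 (U : set (Cn R n)) : open U -> U !=set0 -> U `<=` unit_ball R n ->
  0 < invariant_measure R n U.
Proof.
move=> oU [z Uz] UB.
have /nbhs_CnP[r r0 rU] : nbhs z U by exact: open_nbhs_nbhs.
have mU := open_measurable_Cn oU; have mC := measurable_cube z r.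
apply: (@lt_le_trans _ _ (lebesgue_Cn R n (cube z r))).
  by rewrite cube_volume // lte_fin exprn_gt0 // mulr_gt0.
apply: (@le_trans _ _ (invariant_measure R n (cube z r))); last first.
  by apply: le_measure; rewrite ?inE.
rewrite -[leLHS]mul1e -integral_cst // /invariant_measure setIidl; last exact: subset_trans UB.
apply: ge0_le_integral => //.
- apply/measurable_EFinP; apply: measurable_funS (@measurable_invariant_density R n).
    exact: measurable_unit_ball.
  exact: subset_trans UB.
- move=> w /rU /UB wB; rewrite lee_fin /invariant_density.
  have w1 : (0 < 1 - enorm w ^+ 2)%R by rewrite subr_gt0 expr_lt1 ?enorm_ge0.
  rewrite invf_ge1 ?exprn_gt0 // exprn_ile1 ?(ltW w1) //.
  by rewrite lerBlDr lerDl sqr_ge0.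
Qed.

End invariant_integral.

(** * The mean value property of balls *)

Section closed_ball.
Context {R : realType} {n : nat}.
Implicit Types (z : Cn R n) (U : set (Cn R n)).

Lemma cont_sqn U : cont U (sqn : Cn R n -> R).
Proof. exact: jet_cont (jet_sqn U). Qed.

Lemma open_cont_lt U (u : Cn R n -> R) (r : R) : open U -> cont U u -> open (U `&` [set z | u z < r]).
Proof.
move=> oU cu; rewrite openE => z [Uz uz]; rewrite /interior.
have Un : nbhs z U by exact: open_nbhs_nbhs.
have H : nbhs z (fun w => u w < r).
  by apply: (cu z Uz [set t | t < r]); apply: open_nbhs_nbhs; split => //; exact: open_lt.
by apply: filterS2 Un H => w Uw uw.
Qed.

Lemma open_sqn_lt (r : R) : open [set z : Cn R n | sqn z < r].
Proof.
by rewrite -[X in open X]setTI; exact: open_cont_lt openT (cont_sqn setT).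
Qed.

Lemma closed_sqn_le (r : R) : closed [set z : Cn R n | sqn z <= r].
Proof.
rewrite -openC (_ : ~` _ = setT `&` [set z | - sqn z < - r]); last first.
  apply/seteqP; split=> z /=; rewrite ltrN2; first by move/negP; rewrite -ltNge.
  by move=> [_ zr]; apply/negP; rewrite -ltNge.
exact: open_cont_lt openT (contN (cont_sqn setT)).
Qed.

Lemma X_sqr_le_sqn d z : X d z ^+ 2 <= sqn z.
Proof. by rewrite /sqn (bigD1 d) //= lerDl sumr_ge0 // => e _; rewrite sqr_ge0. Qed.

Lemma compact_sqn_le (r : R) : r <= 1 -> compact [set z : Cn R n | sqn z <= r].
Proof.
move=> r1; pose h (p : R * R) : R[i]^o := (p.1 +i* p.2)%C.
have ch : continuous h.
  move=> p A /nbhs_ballP[e /= e0 eA].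
  have re0 : 0 < complex.Re e by move: e0; rewrite ltcE => /andP[].
  have ie0 : complex.Im e = 0 by move: e0; rewrite ltcE => /andP[/eqP].
  apply/nbhs_ballP; exists (complex.Re e / 2) => /=; first by rewrite divr_gt0.
  move=> q [] /=; rewrite -!ball_normE /= => h1 h2; apply: eA.
  rewrite -ball_normE /= normc_def ltcE /= ie0 eqxx /=.
  rewrite -(ger0_norm (ltW re0)) -sqrtr_sqr ltr_sqrt; last by rewrite exprn_gt0.
  move: h1 h2; set x := complex.Re e in re0 *; rewrite !ltr_norml => /andP[h1 h2] /andP[h3 h4].
  nra.
have cK : compact (h @` (`[(-1), 1]%classic `*` `[(-1), 1]%classic)).
  apply: continuous_compact; first by apply: continuous_subspaceT; exact: ch.
  by apply: compact_setX; exact: segment_compact.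
have := compact_closedI (rV_compact (fun _ : 'I_n => cK)) (@closed_sqn_le r).
congr compact; apply/seteqP; split=> z /=; first by case.
move=> zr; split => // i; exists (X (i, false) z, X (i, true) z); last first.
  by rewrite /h X.unlock /=; case: (z _ i).
have b d : X d z \in `[(-1), 1].
  rewrite in_itv /= -ler_norml -(@expr_le1 _ 2) // real_normK ?num_real //.
  exact: le_trans (X_sqr_le_sqn d z) (le_trans zr r1).
by split; exact: b.
Qed.

Lemma bounded_closed_ball U (u : Cn R n -> R) (r : R) : r <= 1 -> [set z | sqn z <= r] `<=` U ->
  cont U u -> exists2 K, 0 <= K & forall z, sqn z <= r -> `|u z| <= K.
Proof.
move=> r1 rU cu.
have ck : compact (u @` [set z | sqn z <= r]).
  apply: continuous_compact; last exact: compact_sqn_le.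
  by apply: continuous_in_subspaceT => z; rewrite inE => zr; exact: cu (rU _ zr).
have [M [_ HM]] := compact_bounded ck.
exists (`|M| + 1); first by rewrite addr_ge0.
move=> z zr; apply: (HM (`|M| + 1)); first by rewrite (le_lt_trans (ler_norm _)) // ltrDl.
by exists z.
Qed.

Lemma measurable_sqn_lt (r : R) : measurable [set z : Cn R n | sqn z < r].
Proof. exact: (open_measurable_Cn (open_sqn_lt (r := r))). Qed.

Lemma volume_sqn_lt (r : R) : r <= 1 -> (lebesgue_Cn R n [set z : Cn R n | (sqn z < r)%R] < +oo)%E.
Proof.
move=> r1; apply: (@le_lt_trans _ _ (lebesgue_Cn R n (cube 0 1))); last by rewrite cube_volume // ltry.
apply: le_measure; rewrite ?inE; [exact: measurable_sqn_lt|exact: measurable_cube|].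
move=> z /= zr d; rewrite X0 subr0 -(@expr_lt1 _ 2) // real_normK ?num_real //.
exact: le_lt_trans (X_sqr_le_sqn d z) (lt_le_trans zr r1).
Qed.

Lemma integrable_ball U (u : Cn R n -> R) (r : R) : r <= 1 -> open U -> [set z | sqn z <= r] `<=` U ->
  cont U u -> (lebesgue_Cn R n).-integrable [set z | sqn z < r] (EFin \o u).
Proof.
move=> r1 oU rU cu; have [K K0 uK] := bounded_closed_ball r1 rU cu.
apply: measurable_bounded_integrable.
- exact: measurable_sqn_lt.
- exact: volume_sqn_lt.
- apply: (measurable_funS (open_measurable_Cn oU) _ (cont_measurable oU cu)).
  by move=> z /= zr; apply: rU; exact: ltW.
- exists K; split; first exact: num_real.
  by move=> M KM z /= zr; apply: le_trans (ltW KM); apply: uK; exact: ltW.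
Qed.

(** * Integral of a partial derivative over a ball *)

Section divergence.
Local Open Scope ereal_scope.
Variables (U : set (Cn R n)) (r : R) (d : 'I_n * bool) (G Gd : Cn R n -> R).
Hypotheses (r1 : (r <= 1)%R) (oU : open U) (rU : [set z : Cn R n | (sqn z <= r)%R] `<=` U)
  (dG : pd d U G Gd) (cG : cont U Gd) (G0 : forall z : Cn R n, sqn z = r -> G z = 0%R).
Local Notation B := [set z : Cn R n | (sqn z < r)%R].
Local Notation mu := (@lebesgue_measure R).
Let h : Cn R n -> \bar R := (EFin \o Gd) \_ B.

Lemma sqn_line z (s : R) :
  sqn (line z (dir d) s) = ((s + X d z) ^+ 2 + (sqn z - X d z ^+ 2))%R.
Proof.
rewrite /sqn (bigD1 d) //= [in RHS](bigD1 d) //= X_line X_dir eqxx mulr1.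
rewrite (eq_bigr (fun e => X e z ^+ 2)%R); first by ring.
by move=> e ed; rewrite X_line X_dir (negbTE ed) mulr0 addr0.
Qed.

(** The open ball meets the line in an interval ]a, b[ or not at all. In the first case G vanishes
    at both ends, so the fundamental theorem of calculus gives integral 0. *)
Let slice z : \int[mu]_s h^\+ (line z (dir d) s) = \int[mu]_s h^\- (line z (dir d) s).
Proof.
pose k (s : R) := h (line z (dir d) s).
suff [ik k0] : mu.-integrable setT k /\ \int[mu]_s k s = 0.
  have := integralE mu setT k; rewrite k0.
  have fp := integrable_pos_fin_num measurableT ik.
  have fn := integrable_neg_fin_num measurableT ik.
  move=> k00; have E : \int[mu]_s k^\+ s = \int[mu]_s k^\- s.
    by rewrite -[LHS](subeK _ fn) -k00 add0e.
  have kp : k^\+ = h^\+ \o line z (dir d) by exact: funepos_comp.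
  have kn : k^\- = h^\- \o line z (dir d) by exact: funeneg_comp.
  by rewrite kp kn in E; exact: E.
have [mr|mr] := leP r (sqn z - X d z ^+ 2)%R.
  have kE : k = cst 0.
    apply/funext => s; rewrite /k /h patchE memNset //= sqn_line.
    by apply/negP; rewrite -leNgt (le_trans mr) // lerDr sqr_ge0.
  by rewrite kE; split; [exact: integrable0|rewrite integral0_eq].
(* Half the length of the chord: sqn z - X d z ^+ 2 is the squared distance from the origin to the
   line. *)
pose c := Num.sqrt (r - (sqn z - X d z ^+ 2))%R.
have c0 : (0 < c)%R by rewrite sqrtr_gt0 subr_gt0.
have c2 : (c ^+ 2 = r - (sqn z - X d z ^+ 2))%R by rewrite sqr_sqrtr // subr_ge0 ltW.
pose a := (- X d z - c)%R; pose b := (- X d z + c)%R.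
have ab : (a < b)%R by rewrite /a /b; lra.
have inside s : (sqn (line z (dir d) s) < r)%R = (s \in `]a, b[).
  rewrite sqn_line -ltrBrDr -c2 in_itv /= -ltr_sqrt ?exprn_gt0 // !sqrtr_sqr (gtr0_norm c0) ltr_norml.
  by rewrite /a /b; congr andb; apply/idP/idP; lra.
have insidec s : (sqn (line z (dir d) s) <= r)%R = (s \in `[a, b]).
  rewrite sqn_line -lerBrDr -c2 in_itv /= -ler_sqrt ?exprn_ge0 ?(ltW c0) // !sqrtr_sqr (gtr0_norm c0) ler_norml.
  by rewrite /a /b; congr andb; apply/idP/idP; lra.
pose v (s : R) := Gd (line z (dir d) s).
have kE : k = (EFin \o v) \_ `]a, b[.
  apply/funext => s; rewrite /k /h !patchE; congr (if _ then _ else _).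
  by apply/idP/idP; rewrite !inE /= inside.
have cv : {within `[a, b], continuous v}.
  apply: continuous_in_subspaceT => s; rewrite inE /= -insidec => /rU Us.
  by apply: continuous_comp; [exact: continuous_line|exact: cG].
have iv : mu.-integrable `[a, b] (EFin \o v).
  by apply: continuous_compact_integrable cv; exact: segment_compact.
have ivo : mu.-integrable `]a, b[ (EFin \o v).
  by apply: integrableS iv => //; exact: subset_itv_oo_cc.
split; first by rewrite kE; apply/(integrable_mkcond _ _).1.
rewrite kE -integral_mkcond -(integral_itv_bndoo true false); last by case/integrableP: ivo.
pose w (s : R) := G (line z (dir d) s).
have dw s : s \in `[a, b] -> is_derive s (1 : R)%R w (v s).
  by rewrite -insidec => /rU Us; exact: pd_line dG Us.
have w0 s : (s = a \/ s = b)%R -> w s = 0%R.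
  move=> sab; apply: G0; rewrite sqn_line -[RHS](subrK (sqn z - X d z ^+ 2)%R) -c2.
  by congr (_ + _)%R; case: sab => ->; rewrite /a /b; ring.
have cw s : s \in `[a, b] -> {for s, continuous w}.
  by move=> /dw; exact: is_derive_continuous.
rewrite (@continuous_FTC2 _ v w) //.
- by rewrite (w0 a (or_introl erefl)) (w0 b (or_intror erefl)) subee.
- split.
  + by move=> s /subset_itv_oo_cc /dw [].
  + by apply: cvg_at_right_filter; apply: cw; rewrite in_itv /= lexx ltW.
  + by apply: cvg_at_left_filter; apply: cw; rewrite in_itv /= lexx ltW.
- by move=> s /subset_itv_oo_cc /dw [? ?]; rewrite derive1E.
Qed.

Lemma integral_partial_ball : \int[lebesgue_Cn R n]_(z in B) (Gd z)%:E = 0.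
Proof.
have iG := integrable_ball r1 oU rU cG.
have mB := @measurable_sqn_lt r.
have ih : (lebesgue_Cn R n).-integrable setT h by apply/(integrable_mkcond _ mB).1.
have mh : measurable_fun setT h by case/integrableP: ih.
rewrite integral_mkcond integralE -/h (eq_integral_slice (d := d) _ _ _ _ slice) //.
- by rewrite subee // integrable_neg_fin_num.
- exact: measurable_funepos.
- exact: measurable_funeneg.
Qed.

End divergence.

End closed_ball.

Section primitives.
Context {R : realType}.

(** The primitive is the integral from a'. Starting strictly left of the points of interest yields
    two-sided derivatives there, in particular at 0 when a' < 0. *)
Lemma primitive_exists (f : R -> R) (a a' b : R) : a < a' ->
  (forall x, a < x < b -> {for x, continuous f}) ->
  exists F : R -> R, forall x, a' < x < b -> is_derive x 1 F (f x).
Proof.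
move=> aa' cf.
exists (fun x => \int[lebesgue_measure]_(t in `[a', x]) f t)%R => x /andP[a'x xb].
pose u := (x + b) / 2.
have xu : x < u by rewrite /u; lra.
have ub : u < b by rewrite /u; lra.
have cx y : y \in `[a', u] -> {for y, continuous f}.
  by rewrite in_itv /= => /andP[y1 y2]; apply: cf; rewrite (lt_le_trans aa') // (le_lt_trans y2).
have ci : lebesgue_measure.-integrable `[a', u] (EFin \o f).
  apply: continuous_compact_integrable; first exact: segment_compact.
  by apply: continuous_in_subspaceT => y; rewrite inE; exact: cx.
have xI : x \in `[a', u] by rewrite in_itv /= (ltW a'x) ltW.
have [dF F'] := continuous_FTC1_closed xu ci a'x (cx _ xI).
by split; [exact: dF|rewrite -derive1E; exact: F'].
Qed.

Lemma is_derive_affineVn (k : nat) (a b x : R) : a + b * x != 0 ->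
  is_derive x 1 (fun x => (a + b * x) ^- k) (- (k%:R * b * (a + b * x) ^- k.+1)).
Proof.
move=> x0; have d1 : is_derive x (1 : R) (fun x : R => a + b * x) b.
  by apply: is_derive_eq; rewrite /GRing.scale /=; ring.
have dV := @is_deriveV _ (fun x => a + b * x) x _ _ x0 d1.
have := @is_deriveX _ _ (fun x => (a + b * x)^-1) k _ _ _ dV; rewrite exprfctE => h.
have -> : (fun x => (a + b * x) ^- k) = (fun x => (a + b * x)^-1 ^+ k).
  by apply/funext => t; rewrite exprVn.
apply: (is_derive_eq h); rewrite /GRing.scale /=.
case: k {h} => [|k]; first by rewrite !mul0r oppr0.
by rewrite /= -!exprVn !exprS; ring.
Qed.

End primitives.

(** * A divergence identity for M-harmonic functions *)

Section mean_value_identity.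
Context {R : realType} {n : nat}.
Local Notation D := ('I_n * bool)%type.
Variables (U : set (Cn R n)) (u : Cn R n -> R) (u1 : D -> Cn R n -> R) (u2 : D -> D -> Cn R n -> R).
Variables (r : R) (g g' w : R -> R).
Hypotheses (oU : open U) (ju : jet U u u1 u2) (Lu : forall z, U z -> LL z (fun d e => u2 d e z) = 0)
  (r1 : r < 1) (rU : [set z | sqn z <= r] `<=` U) (U1 : forall z, U z -> sqn z < 1)
  (dg : forall t : R, 0 <= t < 1 -> is_derive t 1 g (g' t))
  (cg' : forall t : R, 0 <= t < 1 -> {for t, continuous g'})
  (gr : g r = 0) (wr : w r = 0)
  (dw : forall t : R, 0 <= t < 1 -> is_derive t 1 w ((g t + n%:R * w t) / (1 - t))).

Let Ru z : R := \sum_e X e z * u1 e z.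
Let Tu z : R := \sum_e JX e z * u1 e z.
Let Z d z : R := u1 d z - (X d z * Ru z + JX d z * Tu z).
(* The divergence of Y is 4 (n g + t g') u at t = |z|^2: the equation for w
   cancels the first derivatives of u.  Moreover Y vanishes on the sphere. *)
Let Y d z : R := (2 * g (sqn z)) * (X d z * u z) - w (sqn z) * Z d z.
Let R' d z : R := \sum_e (X e z * u2 e d z + (e == d)%:R * u1 e z).
Let T' d z : R := \sum_e (JX e z * u2 e d z + JX e (dir d) * u1 e z).
Let Z' d z : R := u2 d d z - ((X d z * R' d z + (d == d)%:R * Ru z) +
   (JX d z * T' d z + JX d (dir d) * Tu z)).
Let w' t : R := (g t + n%:R * w t) / (1 - t).
Let Y' d z : R := ((2 * g (sqn z)) * (X d z * u1 d z + (d == d)%:R * u z)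
     + (2 * (g' (sqn z) * (2 * X d z))) * (X d z * u z))
   - (w (sqn z) * Z' d z + (w' (sqn z) * (2 * X d z)) * Z d z).

Let t01 z : U z -> 0 <= sqn z < 1. Proof. by move=> /U1 ->; rewrite sqn_ge0. Qed.

Let pR d : pd d U Ru (R' d).
Proof. by apply: pd_sum => e; exact: pdM (pd_X _ _ _) (jet_pd1 ju _ _). Qed.

Let pT d : pd d U Tu (T' d).
Proof. by apply: pd_sum => e; exact: pdM (pd_JX _ _ _) (jet_pd1 ju _ _). Qed.

Let pZ d : pd d U (Z d) (Z' d).
Proof.
apply: pdD; first exact: jet_pd1 ju _ _.
by apply: pdN; apply: pdD; apply: pdM => //; [exact: pd_X|exact: pd_JX].
Qed.

Let pt d := jet_pd (jet_sqn U) d : pd d U sqn _.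

Let pY d : pd d U (Y d) (Y' d).
Proof.
apply: pdD.
  apply: pdM.
    apply: (pd_eq (pdM (pd_cst d U 2) (pd_comp (f := g) (f' := g') (pt d) _))) => z Uz.
      exact: dg (t01 Uz).
    by rewrite mul0r addr0.
  exact: pdM (pd_X _ _ _) (jet_pd ju d).
by apply: pdN; apply: pdM => //; apply: pd_comp (pt d) _ => z Uz; exact: dw (t01 Uz).
Qed.

Let cRu : cont U Ru.
Proof. by apply: cont_sum => e; apply: contM; [exact: cont_X|exact: jet_cont1 ju _]. Qed.

Let cTu : cont U Tu.
Proof. by apply: cont_sum => e; apply: contM; [exact: cont_JX|exact: jet_cont1 ju _]. Qed.

Let cg : cont U (fun z => g (sqn z)).
Proof. by apply: cont_comp (cont_sqn U) _ => z Uz; exact: is_derive_continuous (dg (t01 Uz)). Qed.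

Let cw : cont U (fun z => w (sqn z)).
Proof. by apply: cont_comp (cont_sqn U) _ => z Uz; exact: is_derive_continuous (dw (t01 Uz)). Qed.

Let cw' : cont U (fun z => w' (sqn z)).
Proof.
apply: contM; first by apply: contD => //; apply: contM => //; exact: cont_cst.
have c1 : cont U (fun z => 1 - sqn z) by apply: contD; [exact: cont_cst|apply: contN; exact: cont_sqn].
apply: cont_comp c1 _ => z Uz; apply: inv_continuous.
by rewrite subr_eq0 eq_sym lt_eqF // U1.
Qed.

Let cZ d : cont U (Z d).
Proof.
apply: contD; first exact: jet_cont1 ju _.
by apply: contN; apply: contD; apply: contM => //; [exact: cont_X|exact: cont_JX].
Qed.

Let cZ' d : cont U (Z' d).
Proof.
apply: contD; first exact: jet_cont2 ju _ _.
apply: contN; apply: contD; apply: contD; apply: contM => //; do ?[exact: cont_X|exact: cont_JX|exact: cont_cst].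
- apply: cont_sum => e; apply: contD; apply: contM;
    do ?[exact: cont_X|exact: cont_cst|exact: jet_cont1 ju _|exact: jet_cont2 ju _ _].
- apply: cont_sum => e; apply: contD; apply: contM;
    do ?[exact: cont_JX|exact: cont_cst|exact: jet_cont1 ju _|exact: jet_cont2 ju _ _].
Qed.

Let cY' d : cont U (Y' d).
Proof.
have c2X : cont U (fun z => 2 * X d z) by apply: contM; [exact: cont_cst|exact: cont_X].
have cu := jet_cont ju.
apply: contD; first (apply: contD; apply: contM).
- by apply: contM => //; exact: cont_cst.
- by apply: contD; apply: contM; do ?[exact: cont_X|exact: cont_cst|exact: jet_cont1 ju _|exact: cu].
- apply: contM; first exact: cont_cst.
  by apply: contM => //; apply: cont_comp (cont_sqn U) _ => z Uz; exact: cg' (t01 Uz).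
- by apply: contM; [exact: cont_X|exact: cu].
- by apply: contN; apply: contD; apply: contM => //; exact: contM.
Qed.

(** Z is the coefficient matrix of L applied to the gradient of u, so its divergence is Lu = 0 plus
    a first-order term. In that term the X-part contributes 2n + 1 and the JX-part -1 times the
    radial derivative [Ru], with a minus sign overall. *)
Let sumZ' z : U z -> \sum_d Z' d z = - (2 * n%:R * Ru z).
Proof.
move=> Uz.
have E1 : \sum_d X d z * R' d z = \sum_d \sum_e X d z * X e z * u2 d e z + Ru z.
  rewrite /Ru -big_split /=; apply: eq_bigr => d _.
  rewrite /R' big_split /= mulrDr mulr_sumr; congr (_ + _).
    by apply: eq_bigr => e _; rewrite (jet_sym ju) // mulrA.
  by under eq_bigr do rewrite mulrC; rewrite sum_delta.
have E2 : \sum_d JX d z * T' d z = \sum_d \sum_e JX d z * JX e z * u2 d e z - Ru z.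
  rewrite /T'; under eq_bigr do rewrite big_split /= mulrDr !mulr_sumr.
  rewrite big_split /=; congr (_ + _).
    by apply: eq_bigr => d _; apply: eq_bigr => e _; rewrite (jet_sym ju) // mulrA.
  rewrite exchange_big /= /Ru -sumrN; apply: eq_bigr => e _.
  under eq_bigr do rewrite mulrA; rewrite -mulr_suml -mulNr; congr (_ * _).
  case: e => i b; rewrite sum_dir.
  rewrite (eq_bigr (fun j => - X (j, b) z * (j == i)%:R)); first by rewrite (sum_delta i (fun j => - X (j, b) z)).
  move=> j _; case: b; rewrite /JX /= !X_dir !xpair_eqE /= ?andbT ?andbF [i == j]eq_sym !mulr0n; ring.
have JXdd d : JX d (dir d) = 0.
  by case: d => i []; rewrite /JX /= X_dir xpair_eqE andbF ?oppr0.
have L0 := Lu Uz.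
rewrite /LL in L0.
transitivity (\sum_d u2 d d z - (\sum_d X d z * R' d z + \sum_d JX d z * T' d z) - \sum_(d : D) Ru z).
  rewrite -big_split /= -!sumrB; apply: eq_bigr => d _.
  by rewrite /Z' eqxx mulr1n JXdd; ring.
rewrite E1 E2 sumr_const card_prod card_ord card_bool -[Ru z *+ _]mulr_natr natrM.
have -> : \sum_d u2 d d z = \sum_d \sum_e X d z * X e z * u2 d e z +
    \sum_d \sum_e JX d z * JX e z * u2 d e z.
  move/eqP: L0; rewrite subr_eq0 => /eqP ->; rewrite -big_split /=; apply: eq_bigr => d _.
  by rewrite -big_split /=; apply: eq_bigr => e _; rewrite mulrDl.
by ring.
Qed.

Let sumXZ z : \sum_d X d z * Z d z = (1 - sqn z) * Ru z.
Proof.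
transitivity (Ru z - (dot (X^~ z) (X^~ z) * Ru z + dot (X^~ z) (JX^~ z) * Tu z)).
  rewrite (eq_bigr (fun d => X d z * u1 d z - (X d z * X d z * Ru z + X d z * JX d z * Tu z))).
    by rewrite sumrB big_split /= -!mulr_suml.
  by move=> d _; rewrite /Z; ring.
by rewrite dot_JX_X dot_X; ring.
Qed.

Let sumY' z : U z -> \sum_d Y' d z = 4 * (n%:R * g (sqn z) + sqn z * g' (sqn z)) * u z.
Proof.
move=> Uz; have t1 := t01 Uz; set t := sqn z in t1 *.
transitivity (2 * g t * Ru z + (\sum_(d : D) 2 * g t * u z) + 4 * g' t * u z * dot (X^~ z) (X^~ z)
  - w t * \sum_d Z' d z - 2 * w' t * \sum_d X d z * Z d z).
  rewrite /dot {1}/Ru !mulr_sumr -!big_split /= -!sumrB; apply: eq_bigr => d _.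
  by rewrite /Y' eqxx mulr1n -/t; ring.
rewrite sumZ' // sumXZ dot_X sumr_const card_prod card_ord card_bool -[2 * g t * u z *+ _]mulr_natr natrM -/t.
rewrite /w'; field.
by rewrite subr_eq0 eq_sym lt_eqF //; case/andP: t1.
Qed.

(** With t = |z|^2 the density is 4 t^(1-n) (t^n g)', a radial density of total mass zero since g
    vanishes at r. Each component of Y vanishes on the sphere because g and w do. *)
Lemma mean_value_identity :
  (\int[lebesgue_Cn R n]_(z in [set z : Cn R n | (sqn z < r)%R])
    (4 * (n%:R * g (sqn z) + sqn z * g' (sqn z)) * u z)%:E = 0)%E.
Proof.
rewrite (eq_integral (fun z => (\sum_(d <- index_enum D) (Y' d z)%:E)%E)); last first.
  by move=> z; rewrite inE /= => zr; rewrite sumEFin sumY' //; apply: rU; exact: ltW.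
rewrite integral_sum; last 2 first.
- exact: measurable_sqn_lt.
- by move=> d; exact: integrable_ball (ltW r1) oU rU (cY' d).
apply: big1 => d _; apply: integral_partial_ball (ltW r1) oU rU (pY d) (cY' d) _ => z zr.
by rewrite /Y zr gr wr; ring.
Qed.

End mean_value_identity.

(** * Letting the second density concentrate at the origin *)

Section mean_value.
Context {R : realType} {n : nat}.
Local Notation D := ('I_n * bool)%type.
Hypothesis n0 : (0 < n)%N.
Local Notation leb := (lebesgue_Cn R n).

(* Two densities with the same integral against M-harmonic functions; as eps
   tends to 0 the second one concentrates at the origin. *)
Lemma weighted_mean_identity (U : set (Cn R n)) (u : Cn R n -> R) u1 u2 (r eps : R) :
  open U -> jet U u u1 u2 -> (forall z, U z -> LL z (fun d e => u2 d e z) = 0) ->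
  0 < r -> r < 1 -> [set z | sqn z <= r] `<=` U -> 0 < eps ->
  (\int[leb]_(z in [set z : Cn R n | (sqn z < r)%R])
    (((1 - sqn z) ^- n.+1 - ((r + eps) / (1 - r)) ^+ n * eps * (sqn z + eps) ^- n.+1) * u z)%:E = 0)%E.
Proof.
move=> oU ju Lu r0 r1 rU e0.
pose V := U `&` [set z : Cn R n | sqn z < 1].
have VU : V `<=` U by move=> z [].
have oV : open V by apply: openI => //; exact: open_sqn_lt.
pose C := ((r + eps) / (1 - r)) ^+ n.
(* Solves 4 (n g + t g') = (1-t)^-(n+1) - C eps (t+eps)^-(n+1); the constant C is fixed by g r =
   0. *)
pose g (t : R) := (4 * n%:R)^-1 * ((1 + -1 * t) ^- n - C * (eps + 1 * t) ^- n).
pose g' (t : R) := 4^-1 * ((1 + -1 * t) ^- n.+1 + C * (eps + 1 * t) ^- n.+1).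
have nn0 : n%:R != 0 :> R by rewrite pnatr_eq0 -lt0n.
have pos1 (t : R) : t < 1 -> 0 < 1 + -1 * t by lra.
have pos2 (t : R) : - eps < t -> 0 < eps + 1 * t by lra.
have dg (t : R) : - eps < t < 1 -> is_derive t 1 g (g' t).
  move=> /andP[te t1].
  have h1 := @is_derive_affineVn _ n 1 (-1) t (lt0r_neq0 (pos1 _ t1)).
  have h2 := @is_derive_affineVn _ n eps 1 t (lt0r_neq0 (pos2 _ te)).
  have h3 := @is_deriveM _ _ (cst C) _ _ _ _ _ (is_derive_cst C t (1 : R)) h2.
  have h4 := @is_deriveM _ _ (cst ((4 * n%:R)^-1 : R)) _ _ _ _ _ (is_derive_cst ((4 * n%:R)^-1 : R) t (1 : R)) (is_deriveB h1 h3).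
  apply: (is_derive_eq h4); rewrite /GRing.scale /= !mulr0 !addr0 /g'.
  set a := _ ^- n.+1; set b := _ ^- n.+1; by field.
have cVn k (a b t : R) : a + b * t != 0 -> {for t, continuous (fun t => (a + b * t) ^- k)}.
  by move=> h; exact: is_derive_continuous (is_derive_affineVn k h).
have cg' (t : R) : 0 <= t < 1 -> {for t, continuous g'}.
  move=> /andP[t0 t1]; apply: (@continuousM R R (cst _)); first exact: cst_continuous.
  apply: (@continuousD R R^o R).
    exact: cVn (lt0r_neq0 (pos1 _ t1)).
  apply: (@continuousM R R (cst C)); first exact: cst_continuous.
  by apply: cVn; rewrite lt0r_neq0 // pos2 // (lt_le_trans _ t0) // oppr_lt0.
have gr : g r = 0.
  rewrite /g /C (_ : 1 + -1 * r = 1 - r); last by ring.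
  rewrite (_ : eps + 1 * r = r + eps); last by ring.
  rewrite expr_div_n; set a := (r + eps) ^+ n; set b := (1 - r) ^+ n.
  have a0 : a != 0 by rewrite expf_neq0 // gt_eqF // addr_gt0.
  have b0 : b != 0 by rewrite expf_neq0 // gt_eqF // subr_gt0.
  by field; rewrite a0 b0 nn0.
(* (1-t)^n is an integrating factor of the equation for w: ((1-t)^n w)' = g (1-t)^(n-1). *)
pose f (t : R) := g t * (1 + -1 * t) ^+ n.-1.
have cf (t : R) : - eps < t < 1 -> {for t, continuous f}.
  move=> h; apply: (@continuousM R R g).
    exact: is_derive_continuous (dg _ h).
  have d1 : is_derive t (1 : R) (fun t : R => 1 + -1 * t) (-1).
    by apply: is_derive_eq; rewrite /GRing.scale /=; ring.
  have := @is_deriveX _ _ (fun x : R => 1 + -1 * x) n.-1 _ _ _ d1; rewrite exprfctE.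
  exact: is_derive_continuous.
(* g is regular on ]-eps, 1[, so starting the primitive at -eps/2 makes it differentiable at t = 0
   too. *)
have ha : - eps < - eps / 2 by lra.
have [om dom] := primitive_exists ha cf.
have {}dom : forall t : R, 0 <= t < 1 -> is_derive t 1 om (f t).
  move=> t /andP[t0 t1]; apply: dom; rewrite t1 andbT; lra.
pose w (t : R) := (1 + -1 * t) ^- n * (om t - om r).
have dw (t : R) : 0 <= t < 1 -> is_derive t 1 w ((g t + n%:R * w t) / (1 - t)).
  move=> t01; have /andP[t0 t1] := t01.
  have h1 := @is_derive_affineVn _ n 1 (-1) t (lt0r_neq0 (pos1 _ t1)).
  have h2 := is_deriveB (dom _ t01) (is_derive_cst (om r) t (1 : R)).
  apply: (is_derive_eq (is_deriveM h1 h2)); rewrite /GRing.scale /= /w /f.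
  have t1' : 1 - t != 0 by rewrite gt_eqF // subr_gt0.
  rewrite (_ : 1 + -1 * t = 1 - t); last by ring.
  have -> : (om - cst (om r)) t = om t - om r by [].
  have -> : (1 - t) ^+ n.+1 = (1 - t) * (1 - t) ^+ n by rewrite exprS.
  have -> : (1 - t) ^+ n = (1 - t) * (1 - t) ^+ n.-1 by rewrite -exprS prednK.
  have h : (1 - t) ^+ n.-1 != 0 by rewrite expf_neq0.
  by field; rewrite h t1'.
have wr : w r = 0 by rewrite /w subrr mulr0.
have rV : [set z | sqn z <= r] `<=` V.
  by move=> z /= zr; split; [exact: rU|exact: le_lt_trans zr r1].
have H := mean_value_identity oV (jet_sub VU ju) (fun z Vz => Lu z (VU z Vz)) r1 rV
  (fun z Vz => proj2 Vz) _ cg' gr wr dw.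
rewrite -[RHS]H; last by move=> t /andP[t0 t1]; apply: dg; rewrite t1 andbT (lt_le_trans _ t0) // oppr_lt0.
apply: eq_integral => z; rewrite inE /= => zr; congr (_ * _)%:E.
have t0 := sqn_ge0 z; have t1 : sqn z < 1 by exact: lt_trans zr r1.
rewrite /g /g' -/C; set t := sqn z in zr t0 t1 *.
rewrite (_ : 1 + -1 * t = 1 - t); last by ring.
rewrite (_ : eps + 1 * t = t + eps); last by ring.
have h1 : 1 - t != 0 by rewrite gt_eqF // subr_gt0.
have h2 : t + eps != 0 by rewrite gt_eqF // ltr_wpDl.
rewrite !exprS; have h3 : (1 - t) ^+ n != 0 by rewrite expf_neq0.
have h4 : (t + eps) ^+ n != 0 by rewrite expf_neq0.
by field; rewrite h1 h2 h3 h4 nn0.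
Qed.

Lemma jet_affine (U : set (Cn R n)) (u : Cn R n -> R) u1 u2 (a b : R) : jet U u u1 u2 ->
  jet U (fun z => a * u z + b) (fun d z => a * u1 d z) (fun d e z => a * u2 d e z).
Proof.
move=> ju; have := jetD (jetM (jet_cst U a) ju) (jet_cst U b).
congr (jet _ _ _ _); first by apply/funext => d; apply/funext => z; ring.
by do 3 (apply/funext => ?); ring.
Qed.

Lemma integrable_density_ball (V : set (Cn R n)) (v : Cn R n -> R) (phi : R -> R) (r : R) :
  open V -> cont V v -> 0 < r -> r < 1 -> [set z | sqn z <= r] `<=` V ->
  (forall t : R, 0 <= t < 1 -> {for t, continuous phi}) ->
  leb.-integrable [set z | sqn z < r] (fun z => (phi (sqn z) * v z)%:E).
Proof.
move=> oV cv r0 r1 rV cphi.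
have oW : open (V `&` [set z : Cn R n | sqn z < 1]) by apply: openI => //; exact: open_sqn_lt.
apply: (integrable_ball (ltW r1) oW) => [z /= zr|]; first by split; [exact: rV|exact: le_lt_trans zr r1].
apply: contM; last by apply: cont_sub cv => z [].
apply: cont_comp; first exact: cont_sqn.
by move=> z [_ z1]; apply: cphi; rewrite sqn_ge0.
Qed.

Lemma continuous_affineVn (k : nat) (c a b t : R) : a + b * t != 0 ->
  {for t, continuous (fun t : R => c * (a + b * t) ^- k)}.
Proof.
move=> h; apply: (@continuousM R R (cst c)); first exact: cst_continuous.
exact: is_derive_continuous (is_derive_affineVn k h).
Qed.

Section mean_le.
Variables (U : set (Cn R n)) (u : Cn R n -> R) (u1 : D -> Cn R n -> R) (u2 : D -> D -> Cn R n -> R) (r : R).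
Hypotheses (oU : open U) (ju : jet U u u1 u2) (Lu : forall z, U z -> LL z (fun d e => u2 d e z) = 0)
  (r0 : 0 < r) (r1 : r < 1) (rU : [set z | sqn z <= r] `<=` U).
Local Notation B := [set z : Cn R n | (sqn z < r)%R].
Local Notation k t := ((1 + -1 * t) ^- n.+1).
Local Notation nu e t := (((r + e) / (1 - r)) ^+ n * e * (e + 1 * t) ^- n.+1).

Let ck (t : R) : 0 <= t < 1 -> {for t, continuous (fun t : R => k t)}.
Proof.
move=> /andP[t0 t1].
have h : 1 + -1 * t != 0 by rewrite gt_eqF //; lra.
exact: is_derive_continuous (is_derive_affineVn _ h).
Qed.

Let cnu e : 0 < e -> forall t : R, 0 <= t < 1 -> {for t, continuous (fun t : R => nu e t)}.
Proof.
move=> e0 t /andP[t0 t1]; apply: continuous_affineVn.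
by rewrite gt_eqF //; lra.
Qed.

(** Stated for any v because it is also applied to the constant 1: the mass of [nu e] on the ball is
    then the same for all e. *)
Lemma mean_density_eq e v v1 v2 : jet U v v1 v2 -> (forall z, U z -> LL z (fun d e => v2 d e z) = 0) -> 0 < e ->
  (\int[leb]_(z in B) (k (sqn z) * v z)%:E = \int[leb]_(z in B) (nu e (sqn z) * v z)%:E)%E.
Proof.
move=> jv Lv e0.
have i1 := integrable_density_ball oU (jet_cont jv) r0 r1 rU ck.
have i2 := integrable_density_ball oU (jet_cont jv) r0 r1 rU (cnu e0).
have := weighted_mean_identity oU jv Lv r0 r1 rU e0.
rewrite (eq_integral (fun z => (k (sqn z) * v z)%:E - (nu e (sqn z) * v z)%:E)%E).
  rewrite integralB //; last exact: measurable_sqn_lt.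
  have f2 := integrable_fin_num (@measurable_sqn_lt R n r) i2.
  by move=> E; rewrite -[LHS](subeK _ f2) E add0e.
move=> z _; rewrite -EFinB; congr (_%:E).
rewrite (_ : 1 + -1 * sqn z = 1 - sqn z); last by ring.
by rewrite (_ : e + 1 * sqn z = sqn z + e); ring.
Qed.

Let nu_ge0 e t : 0 < e -> 0 <= t -> 0 <= nu e t.
Proof.
move=> e0 t0; have hr0 := r0; have hr1 := r1.
apply: mulr_ge0; last by rewrite invr_ge0 exprn_ge0 //; lra.
by apply: mulr_ge0; [apply/exprn_ge0/divr_ge0; lra|exact: ltW].
Qed.

Let nu_le e s t : 0 < e -> e <= 1 -> 0 < s -> s <= t ->
  nu e t <= ((r + 1) / (1 - r)) ^+ n * s ^- n.+1 * e.
Proof.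
move=> e0 e1 s0 st; have hr0 := r0; have hr1 := r1.
rewrite mulrAC -!mulrA ler_pM //.
- by apply/exprn_ge0/divr_ge0; lra.
- by rewrite mulr_ge0 ?(ltW e0) // invr_ge0 exprn_ge0 //; lra.
- rewrite lerXn2r ?nnegrE ?divr_ge0 //; try lra.
  by rewrite ler_wpM2r ?invr_ge0 //; lra.
rewrite ler_wpM2r ?(ltW e0) // lef_pV2 ?posrE ?exprn_gt0 //; last by lra.
by rewrite lerXn2r ?nnegrE //; lra.
Qed.

(** [nu e] acts as an approximate identity: near 0 the function u is small and the mass is fixed,
    while on |z|^2 >= s the density is O(e). An inequality suffices, as it will be applied to both
    signs of u - u(0). *)
Lemma mean_le0 : u 0 = 0 -> (\int[leb]_(z in B) (k (sqn z) * u z)%:E <= 0)%E.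
Proof.
have hr0 := r0; have hr1 := r1.
move=> u00; apply/lee_addgt0Pr => tau tau0; rewrite add0e.
have mB := @measurable_sqn_lt R n r.
have j1 := jet_cst U (1 : R).
have L1 z : U z -> LL z (fun _ _ : D => 0) = 0.
  by move=> _; have := @LLZ R n z (fun _ _ => 0) 0; under eq_fun do under eq_fun do rewrite mul0r; rewrite mul0r.
have ik := integrable_density_ball oU (jet_cont j1) r0 r1 rU ck.
pose V := fine (\int[leb]_(z in B) (k (sqn z) * 1)%:E)%E.
have VE : (\int[leb]_(z in B) (k (sqn z) * 1)%:E = V%:E)%E.
  by rewrite fineK //; exact: integrable_fin_num.
have kpos z : B z -> 0 <= k (sqn z).
  by move=> /= zr; rewrite invr_ge0 exprn_ge0 //; move: r1 zr; lra.
have V0 : 0 <= V.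
  by apply/fine_ge0/integral_ge0 => z Bz; rewrite mulr1 lee_fin kpos.
pose vol := fine (leb B).
have volE : leb B = vol%:E.
  by rewrite fineK // ge0_fin_numE ?measure_ge0 // volume_sqn_lt // ltW.
have vol0 : 0 <= vol by rewrite fine_ge0.
have [K K0 uK] := bounded_closed_ball (ltW r1) rU (jet_cont ju).
(* The part near 0 contributes at most tau' V <= tau / 2; adding 1 covers V = 0. *)
pose tau' := tau / 2 / (V + 1).
have V1 : 0 < V + 1 by rewrite ltr_wpDl.
have tau'0 : 0 < tau' by rewrite !divr_gt0.
have U0 : U 0 by apply: rU; rewrite /= /sqn big1 ?ltW // => d _; rewrite X0 expr0n.
have [s s0 us] : exists2 s : R, 0 < s & forall z, sqn z < s -> `|u z| <= tau'.
  have h : nbhs (0 : Cn R n) (fun z => ball (u 0) tau' (u z)).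
    by exact: (jet_cont ju _ U0 _ (nbhsx_ballx _ _ tau'0)).
  have [s s0 us] := (nbhs_CnP _ _).1 h.
  exists (s ^+ 2); first by rewrite exprn_gt0.
  move=> z zs; have := us z; rewrite -ball_normE /= u00 sub0r normrN => /(_ _)/ltW; apply => d.
  rewrite X0 subr0 -(@ltr_pXn2r _ 2) ?nnegrE ?(ltW s0) // real_normK ?num_real //.
  exact: le_lt_trans (X_sqr_le_sqn d z) zs.
pose C1 := ((r + 1) / (1 - r)) ^+ n.
have C10 : 0 <= C1.
  by apply/exprn_ge0/divr_ge0; [exact: addr_ge0 (ltW r0) ler01|rewrite subr_ge0; exact: ltW].
pose c0 := K * C1 * s ^- n.+1 * vol.
have c00 : 0 <= c0 by rewrite !mulr_ge0 // invr_ge0 exprn_ge0 // ltW.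
(* The part away from 0 contributes at most c0 e <= tau / 2; e <= 1 lets the power of (r + e)/(1 -
   r) be bounded independently of e. *)
pose e := Num.min 1 (tau / 2 / (c0 + 1)).
have c01 : 0 < c0 + 1 by rewrite ltr_wpDl.
have e0 : 0 < e by rewrite lt_min ltr01 !divr_gt0.
have e1 : e <= 1 by rewrite ge_min lexx.
have e2 : c0 * e <= tau / 2.
  have : e <= tau / 2 / (c0 + 1) by rewrite ge_min lexx orbT.
  rewrite ler_pdivlMr // mulrDr mulr1 => h; move: (ltW e0); lra.
rewrite (mean_density_eq ju Lu e0).
have inu := integrable_density_ball oU (jet_cont j1) r0 r1 rU (cnu e0).
have inuu := integrable_density_ball oU (jet_cont ju) r0 r1 rU (cnu e0).
pose q := K * C1 * s ^- n.+1 * e.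
have q0 : 0 <= q by rewrite !mulr_ge0 ?(ltW e0) // invr_ge0 exprn_ge0 // ltW.
have ic : leb.-integrable B (EFin \o cst q).
  exact: (integrable_ball (ltW r1) oU rU (cont_cst _ _)).
apply: (@le_trans _ _ (\int[leb]_(z in B) (tau'%:E * (nu e (sqn z) * 1)%:E + q%:E))%E).
  apply: le_integral => //.
    by apply: integrableD => //; exact: integrableZl.
  move=> z; rewrite inE /= => zr; rewrite -EFinM -EFinD lee_fin mulr1.
  have t0 := sqn_ge0 z.
  have nu0 : 0 <= nu e (sqn z) by exact: nu_ge0.
  have [zs|zs] := ltP (sqn z) s.
    apply: ler_wpDr => //; rewrite mulrC ler_wpM2r //.
    exact: le_trans (ler_norm _) (us z zs).
  apply: ler_wpDl; first by rewrite mulr_ge0 // ltW.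
  apply: (@le_trans _ _ (nu e (sqn z) * K)).
    by rewrite ler_wpM2l // (le_trans (ler_norm _)) // uK // ltW.
  by rewrite mulrC /q -!mulrA ler_wpM2l // mulrA [leRHS]mulrA; exact: nu_le.
rewrite integralD //; last exact: integrableZl.
have cE : (\int[leb]_(z in B) q%:E = (q * vol)%:E)%E.
  by transitivity (q%:E * leb B)%E; [exact: integral_cst|rewrite volE EFinM].
rewrite integralZl // -(mean_density_eq j1 L1 e0) VE cE -!EFinM -EFinD lee_fin.
have -> : q * vol = c0 * e by rewrite /q /c0; ring.
have h : tau' * V <= tau / 2.
  rewrite /tau' mulrAC ler_pdivrMr // mulrDr mulr1 lerDl; lra.
lra.
Qed.

End mean_le.

End mean_value.

Section invariant_mean_value.
Context {R : realType} {n : nat}.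
Local Notation D := ('I_n * bool)%type.
Hypothesis n0 : (0 < n)%N.
Local Notation leb := (lebesgue_Cn R n).
Local Notation lam := (invariant_measure R n).

Lemma unit_ballE : unit_ball R n = [set z | sqn z < 1].
Proof.
apply/seteqP; split=> z /=; rewrite /unit_ball /= -sqr_enorm.
  by move=> z1; rewrite expr_lt1 ?enorm_ge0.
by rewrite expr_lt1 ?enorm_ge0.
Qed.

Lemma invariant_densityE (z : Cn R n) : invariant_density z = (1 - sqn z) ^- n.+1.
Proof. by rewrite /invariant_density sqr_enorm. Qed.

Lemma measurable_density_ball (E : set (Cn R n)) : E `<=` unit_ball R n ->
  measurable_fun E (@invariant_density R n).
Proof.
move=> EB; apply: (measurable_funS (@measurable_unit_ball R n) EB).
exact: measurable_invariant_density.
Qed.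

Lemma integral_invariant_real (E : set (Cn R n)) (f : Cn R n -> R) :
  measurable E -> E `<=` unit_ball R n -> measurable_fun E f ->
  (\int[lam]_(z in E) (f z)%:E = \int[leb]_(z in E) (f z * invariant_density z)%:E)%E.
Proof.
move=> mE EB mf; have mfE : measurable_fun E (EFin \o f) by exact/measurable_EFinP.
have d0 z : E z -> 0 <= invariant_density z.
  by move=> /EB/invariant_density_ge0; rewrite lee_fin.
rewrite integralE [RHS]integralE.
rewrite (integral_invariant mE EB (measurable_funepos mfE)) //.
rewrite (integral_invariant mE EB (measurable_funeneg mfE)) //.
congr (_ - _)%E; apply: eq_integral => z; rewrite inE => /d0 dz.
  by rewrite !funeposE -!EFin_max -EFinM maxr_pMl // mul0r.
by rewrite !funenegE -!EFinN -!EFin_max -EFinM maxr_pMl // mul0r mulNr.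
Qed.

Lemma sub_unit_ball (r : R) : r <= 1 -> [set z | sqn z < r] `<=` unit_ball R n.
Proof. by move=> r1 z /= zr; rewrite unit_ballE /=; exact: lt_le_trans zr r1. Qed.

Lemma invariant_mean_value (U : set (Cn R n)) (u : Cn R n -> R) u1 u2 (r : R) :
  open U -> jet U u u1 u2 -> (forall z, U z -> LL z (fun d e => u2 d e z) = 0) ->
  0 < r -> r < 1 -> [set z | sqn z <= r] `<=` U ->
  (\int[lam]_(z in [set z | (sqn z < r)%R]) (u z - u 0)%:E = 0)%E.
Proof.
move=> oU ju Lu r0 r1 rU.
(* Used with a = 1 and a = -1; the two inequalities give equality. *)
have half (a : R) : a * (u 0) + - a * u 0 = 0 ->
  (\int[leb]_(z in [set z : Cn R n | (sqn z < r)%R]) ((1 + -1 * sqn z) ^- n.+1 * (a * u z + - a * u 0))%:E <= 0)%E.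
  move=> a0; apply: (mean_le0 n0 oU (jet_affine a (- a * u 0) ju) _ r0 r1 rU a0) => z Uz.
  by rewrite LLZ Lu // mulr0.
rewrite integral_invariant_real; [|exact: measurable_sqn_lt|exact: sub_unit_ball (ltW r1)|].
  have E (a : R) : (\int[leb]_(z in [set z : Cn R n | (sqn z < r)%R]) ((1 + -1 * sqn z) ^- n.+1 * (a * u z + - a * u 0))%:E =
     \int[leb]_(z in [set z : Cn R n | (sqn z < r)%R]) (a%:E * ((u z - u 0) * invariant_density z)%:E))%E.
    apply: eq_integral => z _; rewrite -EFinM invariant_densityE; congr (_%:E).
    by rewrite (_ : 1 + -1 * sqn z = 1 - sqn z); ring.
  have iu : leb.-integrable [set z : Cn R n | (sqn z < r)%R] (fun z => ((u z - u 0) * invariant_density z)%:E).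
    have ck (t : R) : 0 <= t < 1 -> {for t, continuous (fun t : R => (1 + -1 * t) ^- n.+1)}.
      by move=> /andP[t0 t1]; apply: is_derive_continuous (is_derive_affineVn n.+1 _); rewrite gt_eqF //; lra.
    have := integrable_density_ball oU (jet_cont (jet_affine 1 (- u 0) ju)) r0 r1 rU ck.
    congr (integrable _ _ _); apply/funext => z; rewrite invariant_densityE; congr (_%:E).
    by rewrite (_ : 1 + -1 * sqn z = 1 - sqn z); ring.
  apply/eqP; rewrite eq_le; apply/andP; split.
    have h : 1 * u 0 + - 1 * u 0 = 0 by ring.
    by have := half 1 h; rewrite E; under eq_integral do rewrite mul1e.
  have h : -1 * u 0 + - (-1) * u 0 = 0 by ring.
  have := half (-1) h; rewrite E integralZl //; last exact: measurable_sqn_lt.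
  by rewrite mulN1e oppe_le0.
apply: measurable_funB => //.
apply: (measurable_funS (open_measurable_Cn oU) _ (cont_measurable oU (jet_cont ju))).
by move=> z /= zr; apply: rU; exact: ltW.
Qed.

(* Exchanging densities for the constant 1 with e = 1 replaces the invariant
   density on {|z|^2 < r} by one that is at least 2^-(n+1) / (1 - r). *)
Lemma invariant_measure_unit_ball : lam (unit_ball R n) = +oo%E.
Proof.
pose U1 : set (Cn R n) := [set z | sqn z < 1].
pose b := fine (leb [set z : Cn R n | (sqn z < 2^-1)%R]).
have bE : leb [set z : Cn R n | (sqn z < 2^-1)%R] = b%:E.
  by rewrite fineK // ge0_fin_numE ?measure_ge0 // volume_sqn_lt // invf_le1 // ler1n.
have b0 : 0 < b.
  rewrite -lte_fin -bE.
  have : nbhs (0 : Cn R n) [set z : Cn R n | (sqn z < 2^-1)%R].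
    apply: open_nbhs_nbhs; split; first exact: open_sqn_lt.
    by rewrite /= /sqn big1 ?invr_gt0 // => d _; rewrite X0 expr0n.
  move=> /nbhs_CnP[s s0 sB].
  apply: (@lt_le_trans _ _ (leb (cube 0 s))).
    by rewrite cube_volume // lte_fin exprn_gt0 // mulr_gt0.
  by apply: le_measure; rewrite ?inE; [exact: measurable_cube|exact: measurable_sqn_lt|].
have key (r : R) : 2^-1 <= r -> r < 1 -> (((1 - r)^-1 * 2 ^- n.+1 * b)%R%:E <= lam (unit_ball R n))%E.
  move=> r2 r1; have r0 : 0 < r by lra.
  have mB := @measurable_sqn_lt R n r.
  apply: (@le_trans _ _ (lam [set z : Cn R n | (sqn z < r)%R])); last first.
    by apply: le_measure; rewrite ?inE //; [exact: measurable_unit_ball|exact: sub_unit_ball (ltW r1)].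
  have rU : [set z : Cn R n | sqn z <= r] `<=` U1 by move=> z /= zr; exact: le_lt_trans zr r1.
  have L1 z : U1 z -> LL z (fun _ _ : D => 0 : R) = 0.
    by move=> _; have := @LLZ R n z (fun _ _ => 0) 0; under eq_fun do under eq_fun do rewrite mul0r; rewrite mul0r.
  have E := mean_density_eq n0 (open_sqn_lt (r := 1)) r0 r1 rU (jet_cst U1 1) L1 ltr01.
  have -> : lam [set z : Cn R n | (sqn z < r)%R] =
     (\int[leb]_(z in [set z : Cn R n | (sqn z < r)%R]) ((1 + -1 * sqn z) ^- n.+1 * 1)%:E)%E.
    rewrite /invariant_measure setIidl; last exact: sub_unit_ball (ltW r1).
    apply: eq_integral => z _; rewrite invariant_densityE mulr1; congr (_%:E).
    by rewrite (_ : 1 + -1 * sqn z = 1 - sqn z); ring.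
  rewrite E.
  apply: (@le_trans _ _ (\int[leb]_(z in [set z : Cn R n | (sqn z < r)%R]) ((1 - r)^-1 * 2 ^- n.+1)%:E)%E).
    have -> : (\int[leb]_(z in [set z : Cn R n | (sqn z < r)%R]) ((1 - r)^-1 * 2 ^- n.+1)%:E =
        ((1 - r)^-1 * 2 ^- n.+1)%:E * leb [set z : Cn R n | (sqn z < r)%R])%E by exact: integral_cst.
    rewrite EFinM -bE lee_wpmul2l //.
      by rewrite lee_fin mulr_ge0 // ?invr_ge0 ?exprn_ge0 // subr_ge0 ltW.
    by apply: le_measure; rewrite ?inE //; [exact: measurable_sqn_lt|move=> z /= zr; exact: lt_le_trans zr r2].
  apply: ge0_le_integral => //.
  - by move=> z _; rewrite lee_fin mulr_ge0 // ?invr_ge0 ?exprn_ge0 // subr_ge0 ltW.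
  - have cU : cont U1 (fun z => ((r + 1) / (1 - r)) ^+ n * 1 * (1 + 1 * sqn z) ^- n.+1 * 1).
      apply: contM; last exact: cont_cst.
      apply: (cont_comp (f := fun t => ((r + 1) / (1 - r)) ^+ n * 1 * (1 + 1 * t) ^- n.+1) (cont_sqn U1)) => z z1.
      apply: continuous_affineVn.
      by rewrite gt_eqF //; have := sqn_ge0 z; lra.
    apply/measurable_EFinP; apply: (measurable_funS (@measurable_sqn_lt R n 1) _ (cont_measurable (open_sqn_lt (r := 1)) cU)).
    by move=> z /= zr; exact: lt_trans zr r1.
  - move=> z /= zr; have z0 := sqn_ge0 z; rewrite lee_fin !mulr1.
    have r1' : 0 < 1 - r by lra.
    apply: ler_pM; rewrite ?invr_ge0 ?exprn_ge0 ?(ltW r1') //.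
      rewrite -(prednK n0) exprS -[leLHS]mulr1 ler_pM ?invr_ge0 ?(ltW r1') //.
        by rewrite -[leLHS]mul1r ler_wpM2r ?invr_ge0 ?(ltW r1') //; lra.
      by apply: exprn_ege1; rewrite ler_pdivlMr //; lra.
    rewrite lef_pV2 ?posrE ?exprn_gt0 //; last by lra.
    by rewrite lerXn2r ?nnegrE //; lra.
apply/eqP; rewrite -[_ == _]negbK; apply/negP => Lfin.
have : lam (unit_ball R n) \is a fin_num by rewrite ge0_fin_numE ?measure_ge0 // ltey.
move=> /fineK LE; pose L := fine (lam (unit_ball R n)).
have L0 : 0 <= L by rewrite fine_ge0 // measure_ge0.
pose c := 2 ^- n.+1 * b; have c0 : 0 < c by rewrite mulr_gt0 // invr_gt0 exprn_gt0.
(* At radius parameter 1 - e, [key] reads c / e <= L, whereas c / e >= 2 (L + 1). *)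
pose e := Num.min 2^-1 (c / (2 * (L + 1))).
have L1 : 0 < 2 * (L + 1) by rewrite mulr_gt0 // ltr_wpDl.
have e0 : 0 < e by rewrite lt_min invr_gt0 divr_gt0 // ltr0n.
have e1 : e <= 2^-1 by rewrite ge_min lexx.
have e2 : e <= c / (2 * (L + 1)) by rewrite ge_min lexx orbT.
have := key (1 - e); rewrite -LE lee_fin opprB addrCA subrr addr0 -mulrA -/c -/L.
have h1 : 2^-1 <= 1 - e by lra.
have h2 : 1 - e < 1 by lra.
move=> /(_ h1 h2); rewrite ler_pdivrMl //.
move: e2; rewrite ler_pdivlMr // => e2; apply/negP; rewrite -ltNge.
by apply: (lt_le_trans _ e2); nra.
Qed.

End invariant_mean_value.

(** * Comparison of Omega with the inscribed ball *)

Section singular_integral.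
Context {R : realType} {n : nat}.
Hypothesis n0 : (0 < n)%N.
Variables (y : Cn R n) (del : R).
Hypothesis del0 : 0 < del.
Local Notation leb := (lebesgue_Cn R n).
Local Notation m := (2 * n).-1.

Definition punctured_nbhd : set (Cn R n) := [set z : Cn R n | 0 < sqn (z - y) /\ enorm (z - y) < del].

Lemma cont_sqnB (U : set (Cn R n)) : cont U (fun z : Cn R n => sqn (z - y)).
Proof.
rewrite (_ : (fun z => _) = fun z : Cn R n => (sqn z + (sqn y + \sum_d (- 2 * X d y) * X d z))).
  by apply: contD; [exact: cont_sqn|exact: jet_cont (jet_lin U _ _)].
apply/funext => z; rewrite sqnB /dot mulr_sumr -addrA; congr (_ + _).
rewrite addrC; congr (_ + _); rewrite -sumrN; apply: eq_bigr => d _; ring.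
Qed.

Lemma enorm_ltE (z : Cn R n) (r : R) : 0 < r -> (enorm z < r) = (sqn z < r ^+ 2).
Proof. by move=> r0; rewrite -sqr_enorm ltr_pXn2r ?nnegrE ?enorm_ge0 // ltW. Qed.

Lemma cont_enormB U : cont U (fun z : Cn R n => enorm (z - y)).
Proof.
rewrite (_ : (fun z => _) = fun z : Cn R n => Num.sqrt (sqn (z - y))); last by apply/funext => z; rewrite enormE.
by apply: cont_comp (cont_sqnB U) _ => z _; exact: sqrt_continuous.
Qed.

Lemma open_punctured : open punctured_nbhd.
Proof.
have o1 := open_cont_lt (r := 0) openT (contN (cont_sqnB setT)).
have o2 := open_cont_lt (r := del) openT (cont_enormB setT).
have := openI o1 o2; rewrite !setTI.
by congr open; apply/seteqP; split=> z [] /=; rewrite ?oppr_lt0 //; split; rewrite ?oppr_lt0.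
Qed.

Lemma ball_sub_cube (r : R) : [set z : Cn R n | enorm (z - y) < r] `<=` cube y r.
Proof.
move=> z /= zr d; rewrite -XB; apply: le_lt_trans zr.
by rewrite enormE -sqrtr_sqr ler_wsqrtr // X_sqr_le_sqn.
Qed.

(* h k bounds the singularity on the shell del / 2^(k+1) <= |z - y| < del / 2^k. *)
Let h (k : nat) (z : Cn R n) : R := (2 ^+ k.+1 / del) ^+ m * \1_(cube y (del / 2 ^+ k)) z.

Let h_ge0 k z : 0 <= h k z.
Proof. by rewrite mulr_ge0 // exprn_ge0 // divr_ge0 // ltW. Qed.

Let dyadic N z : del / 2 ^+ N <= enorm (z - y) -> enorm (z - y) < del ->
  enorm (z - y) ^- m <= \sum_(0 <= k < N) h k z.
Proof.
elim: N => [|N IH] ze zd; first by move: ze; rewrite expr0 divr1 leNgt zd.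
rewrite big_nat_recr //=; have [zN|zN] := leP (del / 2 ^+ N) (enorm (z - y)).
  by apply: ler_wpDr; [exact: h_ge0|exact: IH].
apply: ler_wpDl; first by apply: sumr_ge0 => k _; exact: h_ge0.
rewrite /h indicE mem_set ?mulr1; last exact: ball_sub_cube.
have e0 : 0 < del / 2 ^+ N.+1 by rewrite divr_gt0 // exprn_gt0.
rewrite -invf_div exprVn lef_pV2 ?posrE ?exprn_gt0 //; last exact: lt_le_trans ze.
by rewrite lerXn2r ?nnegrE ?(ltW e0) ?enorm_ge0.
Qed.

(** The exponent 2n - 1 is one below the real dimension, so each halving of the scale halves the
    integral. *)
Let integral_h k : (\int[leb]_z (h k z)%:E = (2 ^+ (4 * n) * del / (2 ^ k.+1)%:R)%:E)%E.
Proof.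
have mC := measurable_cube y (del / 2 ^+ k).
under eq_integral do rewrite EFinM.
rewrite ge0_integralZl //; last 2 first.
- exact/measurable_EFinP/measurable_indic.
- by rewrite lee_fin exprn_ge0 // divr_ge0 // ltW.
rewrite integral_indic // setIT.
transitivity (((2 ^+ k.+1 / del) ^+ m)%:E * ((2 * (del / 2 ^+ k)) ^+ (2 * n))%:E)%E.
  by congr (_ * _)%E; apply: cube_volume; rewrite divr_gt0 // exprn_gt0.
rewrite -EFinM natrX; congr (_%:E).
have d0 : del != 0 by rewrite gt_eqF.
have t0 k' : (2 : R) ^+ k' != 0 by rewrite expf_neq0.
have e2 : (2 * n = m.+1)%N by rewrite prednK // muln_gt0.
have e4 : (4 * n = m.+1 + m.+1)%N by rewrite -e2 -mulnDl.
rewrite e4; move: e2; set mm := m; move=> ->.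
rewrite !exprD !exprMn !exprVn [(2 ^+ k.+1) ^+ mm]exprAC !exprS [(2 ^+ k) ^+ mm]exprAC.
have a0 : ((2 : R) ^+ mm) ^+ k != 0 by rewrite !expf_neq0.
have b0 : del ^+ mm != 0 by rewrite expf_neq0.
by field; rewrite ?a0 ?b0 ?t0 ?d0.
Qed.

Lemma measurable_singular : measurable_fun punctured_nbhd (fun z : Cn R n => enorm (z - y) ^- m).
Proof.
apply: cont_measurable open_punctured _.
apply: (cont_comp (f := fun t => t ^- m) (cont_enormB _)) => z [z0 _].
have e0 : enorm (z - y) != 0 by rewrite enormE gt_eqF // sqrtr_gt0.
have := @is_derive_affineVn R m 0 1 (enorm (z - y)); rewrite add0r mul1r => /(_ e0).
rewrite (_ : (fun x : R => (0 + 1 * x) ^- m) = (fun x => x ^- m)); last first.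
  by apply/funext => x; rewrite add0r mul1r.
exact: is_derive_continuous.
Qed.

(** The geometric series sums to a bound that is linear in del and independent of y; this uniformity
    is what allows y to vary later. *)
Lemma integral_singular_le :
  (\int[leb]_(z in punctured_nbhd) (enorm (z - y) ^- m)%:E <= (2 ^+ (4 * n) * del)%:E)%E.
Proof.
have mh k : measurable_fun setT (fun z => (h k z)%:E).
  apply/measurable_EFinP; rewrite /h; apply: measurable_funM => //.
  exact: measurable_indic (measurable_cube y (del / 2 ^+ k)).
have mS : measurable_fun setT (fun z => \sum_(k <oo) (h k z)%:E)%E.
  by apply: ge0_emeasurable_sum => // k z _ _; rewrite lee_fin h_ge0.
have S0 z : (0 <= \sum_(k <oo) (h k z)%:E)%E.
  by apply: nneseries_ge0 => k _ _; rewrite lee_fin h_ge0.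
apply: (@le_trans _ _ (\int[leb]_z (\sum_(k <oo) (h k z)%:E))%E); last first.
  rewrite integral_nneseries //; last by move=> k z _; rewrite lee_fin h_ge0.
  under eq_eseriesr do rewrite integral_h.
  by apply: epsilon_trick0; rewrite mulr_ge0 // ?exprn_ge0 // ltW.
have mP := open_measurable_Cn open_punctured.
apply: (@le_trans _ _ (\int[leb]_(z in punctured_nbhd) (\sum_(k <oo) (h k z)%:E))%E); last first.
  by apply: ge0_subset_integral => // z _; exact: S0.
apply: ge0_le_integral => //.
- by move=> z _; rewrite lee_fin invr_ge0 exprn_ge0 // enorm_ge0.
- by apply/measurable_EFinP; exact: measurable_singular.
- exact: measurable_funTS.
move=> z [z0 zd].
have e0 : 0 < enorm (z - y) by rewrite enormE sqrtr_gt0.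
have [N HN] : exists N, del / 2 ^+ N <= enorm (z - y).
  have [N hN] : exists N, del / enorm (z - y) < 2 ^+ N.
    pose N := Num.truncn (del / enorm (z - y)).
    exists N.+1; apply: (lt_trans (y := N.+1%:R)).
      exact: truncnS_gt.
    by rewrite -natrX ltr_nat ltn_expl.
  exists N; rewrite ler_pdivrMr ?exprn_gt0 // -ler_pdivrMl //; move: hN => /ltW.
  by rewrite mulrC.
apply: (@le_trans _ _ (\sum_(0 <= k < N) (h k z)%:E)%E).
  by rewrite sumEFin lee_fin dyadic.
by apply: nneseries_lim_ge => k _; rewrite lee_fin h_ge0.
Qed.

End singular_integral.

(** * The deficit of the lower bound *)

Section excess.
Context {R : realType} {n : nat}.
Variable y : Cn R n.
Local Notation leb := (lebesgue_Cn R n).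
Local Notation lam := (invariant_measure R n).
Local Notation U := (punctured_ball y).
Local Notation c := (yc y).

Lemma open_punctured_ball : open U.
Proof.
have o1 := open_cont_lt (r := 0) openT (contN (cont_sqnB y setT)).
have := openI (@open_sqn_lt R n 1) o1; congr open; apply/seteqP; split=> z /=.
  move=> [z1 [_]]; rewrite oppr_lt0 => zy; split => // E.
  by move: zy; rewrite E subrr /sqn big1 ?ltxx // => d _; rewrite X0 expr0n.
move=> [z1 zy]; split=> //; split => //; rewrite oppr_lt0; apply: sqn_gt0.
by move=> /eqP; rewrite subr_eq0 => /eqP.
Qed.

(* The deficit in test_fun_ge; it vanishes unless |z| < |y|. *)
Definition excess (z : Cn R n) : R := phi1 n c (yq y z) * (Num.max 0 (yA z - c) / yS y z).

Hypothesis y1 : sqn y < 1.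

Lemma excess_ge0 z : U z -> 0 <= excess z.
Proof.
move=> Uz; rewrite mulr_ge0 ?phi1_ge0 ?yq_gt // divr_ge0 ?le_max ?lexx //.
by apply: ltW; apply: yS_gt0.
Qed.

Lemma measurable_excess : measurable_fun U excess.
Proof.
have oU := open_punctured_ball.
have [q1 [q2 [M1 [M2 [jq _ _]]]]] := jet_qM y1.
have [A1 [A2 [b11 [S1 [S2 [jA _ jS _]]]]]] := jet_base y.
apply: measurable_funM.
  apply: cont_measurable oU _.
  exact: jet_cont (jet_phi1 n jq (fun z Uz => yq_gt y1 Uz)).
apply: measurable_funM.
  apply: measurable_maxr => //; apply: measurable_funB => //.
  exact: cont_measurable oU (jet_cont jA).
apply: cont_measurable oU _.
exact: jet_cont (jetV jS (fun z Uz => lt0r_neq0 (yS_gt0 y1 Uz))).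
Qed.

Let K : R := 4 / c ^+ 2 / c ^+ n.+1.

Let c0 : 0 < c. Proof. by rewrite subr_gt0. Qed.

Let K_gt0 : 0 < K.
Proof. by rewrite !divr_gt0 // ?exprn_gt0. Qed.

(** Where the deficit is nonzero, A > c, so the invariant density is at most c^-(n+1) and does not
    blow up; the other factor of K bounds 1/S. The number m is left free: near the pole it is 2 |z -
    y|, elsewhere the shell thickness. *)
Lemma excess_le z (m : R) : U z -> 0 <= m -> sqn y - sqn z <= m ->
  excess z * invariant_density z <= K * (enorm (z - y) ^- (2 * n) * m).
Proof.
move=> Uz m0 zm; have Z0 : 0 <= enorm (z - y) ^- (2 * n).
  by rewrite invr_ge0 exprn_ge0 // enorm_ge0.
rewrite /excess.
have [Ac|cA] := leP (yA z - c) 0.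
  rewrite mul0r mulr0 mul0r; apply: mulr_ge0 (ltW K_gt0) _; exact: mulr_ge0.
have z1 : sqn z < 1 by case: Uz.
have A0 := yA_gt0 Uz; have S0 := yS_gt0 y1 Uz.
have q1 := phi1_le y1 Uz; rewrite -sqr_enorm -exprM in q1.
have q0 := phi1_ge0 y1 n (yq_gt y1 Uz).
have S1 : (yS y z)^-1 <= 4 / c ^+ 2.
  have -> : 4 / c ^+ 2 = (c ^+ 2 / 4)^-1 by rewrite invf_div.
  by rewrite lef_pV2 ?yS_ge // posrE ?divr_gt0 // exprn_gt0.
have d1 : invariant_density z <= (c ^+ n.+1)^-1.
  rewrite invariant_densityE lef_pV2 ?posrE ?exprn_gt0 //.
  by rewrite lerXn2r ?nnegrE ?(ltW c0) ?(ltW A0) // ltW // -subr_gt0.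
have d0 : 0 <= invariant_density z by rewrite invariant_densityE invr_ge0 exprn_ge0 // ltW.
have A1 : yA z - c <= m by apply: le_trans zm; rewrite /yA /yc; lra.
have -> : K * (enorm (z - y) ^- (2 * n) * m) = enorm (z - y) ^- (2 * n) * (m * (4 / c ^+ 2)) * (c ^+ n.+1)^-1.
  by rewrite /K; ring.
apply: ler_pM => //; first by rewrite !mulr_ge0 // ?invr_ge0 ltW.
apply: ler_pM => //; first by rewrite mulr_ge0 // ?invr_ge0 ltW.
by apply: ler_pM => //; rewrite ?invr_ge0 ltW.
Qed.

(** Within distance del of y, [sqn_sub_le] yields the integrable singularity and a term linear in
    del, whatever eta is. Farther away the singularity is at most del^-(2n), and the shell gives the
    factor eta. *)
Lemma integral_excess_le (E : set (Cn R n)) (eta del : R) : (0 < n)%N ->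
  measurable E -> E `<=` U -> 0 <= eta -> 0 < del ->
  (forall z, E z -> sqn y - sqn z <= eta) ->
  (\int[lam]_(z in E) (excess z)%:E <=
   (K * (2 * (2 ^+ (4 * n) * del) +
      del ^- (2 * n) * eta * fine (leb [set z : Cn R n | (sqn z < 1)%R])))%:E)%E.
Proof.
move=> n0 mE EU eta0 del0 Eeta; have oU := open_punctured_ball.
have EB : E `<=` unit_ball R n by move=> z /EU[]; rewrite unit_ballE.
have mh : measurable_fun E excess.
  exact: measurable_funS (open_measurable_Cn oU) EU measurable_excess.
have mhd : measurable_fun E (fun z => ((excess z)%:E * (invariant_density z)%:E)%E).
  apply/measurable_EFinP; apply: measurable_funM => //.
  exact: measurable_density_ball.
have hd0 z : E z -> (0 <= (excess z)%:E * (invariant_density z)%:E)%E.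
  by move=> Ez; rewrite mule_ge0 ?lee_fin ?excess_ge0 //; [exact: EU|apply: invariant_density_ge0; exact: EB].
have V_fin : leb [set z : Cn R n | (sqn z < 1)%R] \is a fin_num.
  by rewrite ge0_fin_numE ?measure_ge0 // volume_sqn_lt.
rewrite integral_invariant //; first last.
- by move=> z /EU Uz; rewrite lee_fin excess_ge0.
- exact/measurable_EFinP.
set P := punctured_nbhd y del.
have mP : measurable P := open_measurable_Cn (@open_punctured R n y del).
have EE : E = (E `&` P) `|` (E `\` P) by rewrite setUIDK.
have mEP : measurable (E `&` P) by exact: measurableI.
have mEDP : measurable (E `\` P) by exact: measurableD.
rewrite EE ge0_integral_setU //; rewrite -?EE //; last first.
  by rewrite disj_set2E setDE setIACA setICr setI0.
rewrite mulrDr EFinD; apply: leeD.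
  have mS : measurable_fun P (fun z => (K * 2 * enorm (z - y) ^- (2 * n).-1)%:E).
    apply/measurable_EFinP; apply: measurable_funM => //.
    exact: measurable_singular.
  apply: (@le_trans _ _ (\int[leb]_(z in P) (K * 2 * enorm (z - y) ^- (2 * n).-1)%:E)%E).
    apply: (@le_trans _ _ (\int[leb]_(z in E `&` P) (K * 2 * enorm (z - y) ^- (2 * n).-1)%:E)%E).
      apply: ge0_le_integral => //.
      - by move=> z [Ez _]; exact: hd0.
      - by apply: measurable_funS mhd.
      - by apply: measurable_funS mS.
      move=> z [/EU Uz [Z0 Zd]]; rewrite -EFinM lee_fin.
      have e0 : 0 < enorm (z - y) by rewrite enormE sqrtr_gt0.
      apply: le_trans (excess_le Uz _ (sqn_sub_le y1 z)) _; first by rewrite mulr_ge0 // ltW.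
      rewrite -mulrA ler_pM2l // mulrCA ler_pM2l // -(@prednK (2 * n)) ?muln_gt0 //.
      by rewrite exprSr invfM -mulrA mulVf ?mulr1 // gt_eqF.
    apply: ge0_subset_integral => //.
    by move=> z _; rewrite lee_fin mulr_ge0 ?invr_ge0 ?exprn_ge0 ?enorm_ge0 // ltW // mulr_gt0.
  under eq_integral do rewrite EFinM.
  rewrite ge0_integralZl_EFin //; last first.
  - by rewrite ltW // mulr_gt0.
  - by apply/measurable_EFinP; exact: measurable_singular.
  - by move=> z _; rewrite lee_fin invr_ge0 exprn_ge0 // enorm_ge0.
  rewrite mulrA [X in (_ <= X)%E]EFinM; apply: lee_wpmul2l; last exact: integral_singular_le.
  by rewrite lee_fin ltW // mulr_gt0.
set B := [set z | _].
have mB : measurable B := measurable_sqn_lt 1.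
have C0 : 0 <= K * (del ^- (2 * n) * eta).
  by rewrite !mulr_ge0 ?invr_ge0 ?exprn_ge0 // ltW.
rewrite [in X in (_ <= X)%E]mulrA EFinM (fineK V_fin).
have <- : (\int[leb]_(z in B) (K * (del ^- (2 * n) * eta))%:E = (K * (del ^- (2 * n) * eta))%:E * leb B)%E.
  exact: (integral_cst leb mB (K * (del ^- (2 * n) * eta))%:E).
apply: (@le_trans _ _ (\int[leb]_(z in E `\` P) (K * (del ^- (2 * n) * eta))%:E)%E).
  apply: ge0_le_integral => //.
  - by move=> z [Ez _]; exact: hd0.
  - by apply: measurable_funS mhd.
  move=> z [Ez nP]; rewrite -EFinM lee_fin; have Uz := EU z Ez.
  apply: le_trans (excess_le Uz eta0 (Eeta z Ez)) _.
  have Z0 : 0 < sqn (z - y).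
    by case: Uz => _ zy; apply: sqn_gt0 => /eqP; rewrite subr_eq0 => /eqP.
  have e0 : 0 < enorm (z - y) by rewrite enormE sqrtr_gt0.
  have dz : del <= enorm (z - y) by rewrite leNgt; apply/negP => zd; apply: nP.
  rewrite ler_pM2l // ler_wpM2r // lef_pV2 ?posrE ?exprn_gt0 //.
  by rewrite lerXn2r ?nnegrE // ltW.
apply: ge0_subset_integral => //.
by move=> z [/EB]; rewrite unit_ballE.
Qed.

End excess.

(** * Consequences of the mean value property for one exterior point *)

Section exterior_point.
Context {R : realType} {n : nat}.
Hypothesis n0 : (0 < n)%N.
Variable Omega : set (Cn R n).
Hypotheses (hball : Omega `<=` unit_ball R n) (hopen : open Omega) (h0 : Omega 0)
  (hfin : (invariant_measure R n Omega < +oo)%E)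
  (hmean : forall (f : Cn R n -> R[i]^o) (U : set (Cn R n)),
     closure Omega `&` unit_ball R n `<=` U -> M_harmonic U f ->
     complex_integrable Omega f ->
     ((fine (invariant_measure R n Omega))^-1)%:C * complex_integral Omega f = f 0).
Variables (y : Cn R n) (s : R).
Hypotheses (y1 : sqn y < 1) (yO : ~ closure Omega y) (s0 : 0 < s) (sy : s < sqn y)
  (sO : [set z | sqn z < s] `<=` Omega).
Local Notation leb := (lebesgue_Cn R n).
Local Notation lam := (invariant_measure R n).
Local Notation U := (punctured_ball y).
Local Notation c := (yc y).

Lemma closure_sub_punctured : closure Omega `&` unit_ball R n `<=` U.
Proof.
move=> z [cz]; rewrite unit_ballE => z1; split; first exact: z1.
by move=> E; apply: yO; rewrite -E; exact: cz.
Qed.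

Lemma sub_punctured : Omega `<=` U.
Proof.
move=> z Oz; apply: closure_sub_punctured; split; [exact: subset_closure|exact: hball].
Qed.

Lemma exterior_dist : exists2 del, 0 < del & forall z, Omega z -> del <= sqn (z - y).
Proof.
have : nbhs y (~` Omega).
  have /open_nbhs_nbhs : open_nbhs y (~` closure Omega).
    by split => //; apply: closed_openC; exact: closed_closure.
  by apply: filterS => z nz Oz; apply: nz; exact: subset_closure.
move=> /nbhs_CnP[r r0 rO]; exists (r ^+ 2); first by rewrite exprn_gt0.
move=> z Oz; rewrite leNgt; apply/negP => zr; apply: (rO z) => // d.
rewrite -XB -(@ltr_pXn2r _ 2) ?nnegrE ?(ltW r0) // real_normK ?num_real //.
exact: le_lt_trans (X_sqr_le_sqn d _) zr.
Qed.

Let c1 : c < 1.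
Proof. by rewrite /yc ltrBlDr ltrDl (lt_trans s0). Qed.

Let mO : measurable Omega := open_measurable_Cn hopen.
Let f := test_fun y.
Let g z := f z - f 0.

Let cf : cont U f.
Proof. by have [u1 [u2 [ju _]]] := jet_test_fun y1 n0; exact: jet_cont ju. Qed.

Let mf : measurable_fun Omega f.
Proof.
apply: (measurable_funS (open_measurable_Cn (@open_punctured_ball R n y)) sub_punctured).
exact: cont_measurable (@open_punctured_ball R n y) cf.
Qed.

Let intf : lam.-integrable Omega (EFin \o f).
Proof.
apply: measurable_bounded_integrable => //.
have [del d0 dO] := exterior_dist; have [K fK] := test_fun_bounded y1 d0.
exists K; split; first exact: num_real.
by move=> M KM z Oz; apply: le_trans (ltW KM); apply: fK; [exact: sub_punctured|exact: dO].
Qed.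

Lemma measure_Omega_gt0 : (0 < lam Omega)%E.
Proof. by apply: open_measure_gt0 => //; exists 0. Qed.

Lemma integral_test_fun0 : (\int[lam]_(z in Omega) (g z)%:E = 0)%E.
Proof.
have [u1 [u2 [ju Lu]]] := jet_test_fun y1 n0.
have UB : U `<=` unit_ball R n by move=> z []; rewrite unit_ballE.
have MH := M_harmonic_jet (@open_punctured_ball R n y) UB ju Lu.
have ci : complex_integrable Omega (fun z => (f z)%:C : R[i]^o).
  by split; [exact: intf|exact: integrable0].
have := hmean closure_sub_punctured MH ci.
have Lfin : lam Omega \is a fin_num by rewrite ge0_fin_numE ?measure_ge0.
have L0 : 0 < fine (lam Omega) by rewrite fine_gt0 // hfin measure_Omega_gt0.
move=> /(congr1 (@complex.Re R)); rewrite /complex_integral /= !mul0r subr0 => E.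
have {}E : (\int[lam]_(z in Omega) (f z)%:E = (fine (lam Omega) * f 0)%:E)%E.
  rewrite (_ : f 0 = test_fun y 0) // -E mulrA divff ?gt_eqF // mul1r fineK //; exact: integrable_fin_num.
under eq_integral do rewrite /g EFinB.
rewrite integralB //; last first.
  by apply: measurable_bounded_integrable => //; exists `|f 0|; split; [exact: num_real|move=> M KM z _ /=; exact: ltW].
have -> : (\int[lam]_(z in Omega) (f 0)%:E = (f 0)%:E * lam Omega)%E by exact: integral_cst.
by rewrite E -{2}(fineK Lfin) -EFinM mulrC subee.
Qed.

Let E := Omega `\` [set z | sqn z < s].
Let mE : measurable E.
Proof. by apply: measurableD => //; exact: measurable_sqn_lt. Qed.
Let EO : E `<=` Omega. Proof. by move=> z []. Qed.

Let intg : lam.-integrable Omega (EFin \o g).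
Proof.
rewrite (_ : EFin \o g = (fun z => (f z)%:E - (f 0)%:E)%E); last by apply/funext => z; rewrite /= EFinB.
apply: integrableB => //.
by apply: measurable_bounded_integrable => //; exists `|f 0|; split; [exact: num_real|move=> M KM z _ /=; exact: ltW].
Qed.

Lemma integral_outer0 : (\int[lam]_(z in E) (g z)%:E = 0)%E.
Proof.
have [u1 [u2 [ju Lu]]] := jet_test_fun y1 n0.
have mB := @measurable_sqn_lt R n s.
(* The closed ball avoids the pole because s < |y|^2. *)
have sU : [set z | sqn z <= s] `<=` U.
  move=> z /= zs; split; first exact: le_lt_trans zs (lt_trans sy y1).
  by move=> zy; move: zs; rewrite zy leNgt sy.
have MV := invariant_mean_value n0 (@open_punctured_ball R n y) ju Lu s0 (lt_trans sy y1) sU.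
have : (\int[lam]_(z in [set z : Cn R n | (sqn z < s)%R] `|` E) (g z)%:E = 0)%E.
  by rewrite /E setDUK //; exact: integral_test_fun0.
have UE : [set z : Cn R n | (sqn z < s)%R] `|` E = Omega by rewrite /E setDUK.
rewrite integral_setU.
- by rewrite MV add0e.
- exact: mB.
- exact: mE.
- by rewrite UE; apply/measurable_EFinP; apply: measurable_funB => //; exact: mf.
- by rewrite disj_set2E /E setDE setICA setICr setI0.
Qed.

Let h := excess y.

Let mh : measurable_fun E h.
Proof.
apply: (measurable_funS (open_measurable_Cn (@open_punctured_ball R n y))) (measurable_excess y1).
by move=> z /EO; exact: sub_punctured.
Qed.

(** Integrate [test_fun_ge] over E, where g has integral 0; the gain (1 - c) [phi1 n c 1] has 1 - c
    = |y|^2. *)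
Lemma outer_lower_bound :
  ((sqn y * phi1 n c 1)%:E * lam E <= \int[lam]_(z in E) (h z)%:E)%E.
Proof.
have EU : E `<=` U by move=> z /EO; exact: sub_punctured.
have hE0 : (0 <= \int[lam]_(z in E) (h z)%:E)%E.
  by apply: integral_ge0 => z /EU Uz; rewrite lee_fin excess_ge0.
have [->|hfinE] := eqVneq (\int[lam]_(z in E) (h z)%:E)%E +oo%E; first exact: leey.
have inth : lam.-integrable E (EFin \o h).
  apply/integrableP; split; first exact/measurable_EFinP.
  rewrite (eq_integral (fun z => (h z)%:E)); first by rewrite ltey.
  by move=> z; rewrite inE => /EU Uz; rewrite /= ger0_norm // excess_ge0.
have intgE : lam.-integrable E (EFin \o g) := integrableS mO mE EO intg.
have -> : (\int[lam]_(z in E) (h z)%:E = \int[lam]_(z in E) ((g z)%:E + (h z)%:E))%E.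
  by rewrite integralD // integral_outer0 add0e.
have -> : ((sqn y * phi1 n c 1)%:E * lam E = \int[lam]_(z in E) (sqn y * phi1 n c 1)%:E)%E.
  by rewrite (integral_cst lam mE (sqn y * phi1 n c 1)%:E).
have lE : (lam E < +oo)%E.
  by apply: le_lt_trans hfin; apply: le_measure; rewrite ?inE.
apply: le_integral => //.
- apply: measurable_bounded_integrable => //.
  by exists `|sqn y * phi1 n c 1|; split; [exact: num_real|move=> M KM z _ /=; exact: ltW].
- exact: integrableD.
move=> z; rewrite inE => /EU Uz; rewrite -EFinD lee_fin.
have := test_fun_ge n0 y1 c1 Uz; rewrite /g /f /h /excess {1}/yc.
move: (test_fun y z) (phi1 n c (yq y z) * _) (test_fun y 0) (phi1 n c 1) => a b d e.
by nra.
Qed.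

Lemma outer_measure_le (del : R) : 0 < del ->
  ((sqn y * c ^+ n)%:E * lam E <=
   (4 / c ^+ 2 / c ^+ n.+1 * (2 * (2 ^+ (4 * n) * del) +
      del ^- (2 * n) * (sqn y - s) * fine (leb [set z : Cn R n | (sqn z < 1)%R])))%:E)%E.
Proof.
move=> del0; have y0 : 0 < sqn y := lt_trans s0 sy.
apply: (@le_trans _ _ (\int[lam]_(z in E) (h z)%:E)%E); last first.
  apply: integral_excess_le => //; last first.
  - by move=> z [_ /negP]; rewrite -leNgt => sz; rewrite lerD2l lerN2.
  - by rewrite subr_ge0 ltW.
  - by move=> z /EO; exact: sub_punctured.
apply: le_trans outer_lower_bound; apply: lee_wpmul2r; first exact: measure_ge0.
(* [phi1 n c 1] equals (c / |y|^2)^n, at least c^n since |y| < 1. *)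
rewrite lee_fin ler_pM2l // /phi1; have c0 : 0 < c by rewrite subr_gt0.
have -> : 1 - c = sqn y by rewrite /yc; ring.
rewrite lerXn2r ?nnegrE ?divr_ge0 ?(ltW c0) ?(ltW y0) //.
by rewrite ler_pdivlMr // ler_piMr ?ltW.
Qed.

End exterior_point.

(** * The inscribed ball and the choice of constants *)

Section inscribed_ball.
Context {R : realType} {n : nat}.
Hypothesis n0 : (0 < n)%N.
Variable Omega : set (Cn R n).
Hypotheses (hball : Omega `<=` unit_ball R n) (hopen : open Omega) (h0 : Omega 0)
  (hfin : (invariant_measure R n Omega < +oo)%E)
  (hbd : boundary Omega `&` unit_ball R n =
         boundary (closure Omega) `&` unit_ball R n).
Local Notation lam := (invariant_measure R n).

Let T : set R := [set t | t <= 1 /\ [set z : Cn R n | sqn z < t] `<=` Omega].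
Definition inradius2 : R := sup T.
Local Notation r := inradius2.

Let T0 : T 0.
Proof. by split=> // z /=; rewrite ltNge sqn_ge0. Qed.

Let supT : has_sup T.
Proof. by split; [exists 0|exists 1 => t []]. Qed.

Lemma inradius2_sub : [set z : Cn R n | sqn z < r] `<=` Omega.
Proof.
move=> z /= /(sup_gt (ex_intro _ 0 T0)) [t [_ tO] zt]; exact: tO.
Qed.

Lemma le_inradius2 (t : R) : t <= 1 -> [set z : Cn R n | sqn z < t] `<=` Omega -> t <= r.
Proof. by move=> t1 tO; apply: ub_le_sup; [case: supT|split]. Qed.

Lemma inradius2_gt0 : 0 < r.
Proof.
have /nbhs_CnP[rho rho0 rhoO] : nbhs (0 : Cn R n) Omega by exact: open_nbhs_nbhs.
apply: (@lt_le_trans _ _ (Num.min 1 (rho ^+ 2))).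
  by rewrite lt_min ltr01 exprn_gt0.
apply: le_inradius2; first by rewrite ge_min lexx.
move=> z /=; rewrite lt_min => /andP[_ zr]; apply: rhoO => d.
rewrite X0 subr0 -(@ltr_pXn2r _ 2) ?nnegrE ?(ltW rho0) // real_normK ?num_real //.
exact: le_lt_trans (X_sqr_le_sqn d _) zr.
Qed.

Lemma inradius2_lt1 : r < 1.
Proof.
rewrite ltNge; apply/negP => r1.
have BO : unit_ball R n `<=` Omega.
  by rewrite unit_ballE => z /= z1; apply: inradius2_sub; exact: lt_le_trans r1.
have : (lam (unit_ball R n) <= lam Omega)%E.
  by apply: le_measure; rewrite ?inE //; [exact: measurable_unit_ball|exact: open_measurable_Cn].
by rewrite (invariant_measure_unit_ball n0) leye_eq => /eqP E; move: hfin; rewrite E.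
Qed.

(** Otherwise the ball |z|^2 < r + eta lies in the closure of Omega. By maximality of r it has a
    point outside Omega; that point is on the boundary of Omega, hence by (iv) on that of the
    closure, yet it is interior to the closure. *)
Lemma exists_exterior (eta : R) : 0 < eta -> r + eta <= 1 ->
  exists y : Cn R n, [/\ ~ closure Omega y, r <= sqn y & sqn y < r + eta].
Proof.
move=> eta0 eta1; apply: contrapT => noy.
have sub : [set z : Cn R n | sqn z < r + eta] `<=` closure Omega.
  move=> z /= zr; apply: contrapT => nz; apply: noy; exists z; split=> //.
  rewrite leNgt; apply/negP => zr'; apply: nz; apply: subset_closure.
  exact: inradius2_sub.
suff /(le_inradius2 eta1) : [set z : Cn R n | sqn z < r + eta] `<=` Omega.
  by rewrite leNgt ltrDl eta0.
move=> w /= wr; apply: contrapT => nw.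
have : (boundary Omega `&` unit_ball R n) w.
  split; last by rewrite unit_ballE /=; exact: lt_le_trans eta1.
  by split; [exact: sub|move=> /interior_subset].
rewrite hbd => -[[_ nint] _]; apply: nint.
by apply: (filterS sub); apply: open_nbhs_nbhs; split=> //; exact: open_sqn_lt.
Qed.

(** A point on the sphere is pushed outwards along its radius, within the open set Omega. *)
Lemma outer_nonempty (w : Cn R n) : Omega w -> r <= sqn w ->
  exists2 w', Omega w' & r < sqn w'.
Proof.
move=> Ow rw; have /nbhs_CnP[rho rho0 rhoO] : nbhs w Omega by exact: open_nbhs_nbhs.
have w1 : sqn w < 1 by have := hball Ow; rewrite unit_ballE.
have h2 : 0 < rho / 2 by rewrite divr_gt0.
have Xw' d : X d (w + ((rho / 2)%:C : R[i]^o) *: w) = X d w + rho / 2 * X d w.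
  by rewrite XD XZ.
exists (w + ((rho / 2)%:C : R[i]^o) *: w).
  apply: rhoO => d; rewrite Xw' addrAC subrr add0r normrM (gtr0_norm h2).
  have X1 : `|X d w| <= 1.
    rewrite -(@ler_pXn2r _ 2) ?nnegrE // expr1n real_normK ?num_real //.
    exact: le_trans (X_sqr_le_sqn d _) (ltW w1).
  by apply: le_lt_trans (ler_wpM2l (ltW h2) X1) _; rewrite mulr1 ltr_pdivrMr // ltr_pMr // ltr1n.
have -> : sqn (w + ((rho / 2)%:C : R[i]^o) *: w) = (1 + rho / 2) ^+ 2 * sqn w.
  rewrite /sqn mulr_sumr; apply: eq_bigr => d _; rewrite Xw'; ring.
have w0 := lt_le_trans inradius2_gt0 rw; apply: le_lt_trans rw _.
by rewrite ltr_pMl // exprn_egt1 // ltrDl.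
Qed.

Hypothesis hmean : forall (f : Cn R n -> R[i]^o) (U : set (Cn R n)),
  closure Omega `&` unit_ball R n `<=` U -> M_harmonic U f ->
  complex_integrable Omega f ->
  ((fine (invariant_measure R n Omega))^-1)%:C * complex_integral Omega f = f 0.

Lemma sub_inscribed_ball : Omega `<=` [set z : Cn R n | sqn z < r].
Proof.
move=> w Ow /=; rewrite ltNge; apply/negP => rw.
have [w' Ow' rw'] := outer_nonempty Ow rw.
(* A fixed open set of positive measure contained in Omega minus B' for every choice of B'. *)
pose W := Omega `&` [set z : Cn R n | - sqn z < - r].
have oW : open W by exact: open_cont_lt hopen (contN (cont_sqn _)).
have mO := open_measurable_Cn hopen; have mW := open_measurable_Cn oW.
have W0 : (0 < lam W)%E.
  apply: open_measure_gt0 => //; first by exists w'; split=> //=; rewrite ltrN2.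
  by move=> z [/hball].
have WO : (lam W <= lam Omega)%E by apply: le_measure; rewrite ?inE //; move=> z [].
have Wfin : lam W \is a fin_num by rewrite ge0_fin_numE ?measure_ge0 // (le_lt_trans WO).
have m0 : 0 < fine (lam W) by rewrite fine_gt0 // W0 -ge0_fin_numE ?measure_ge0.
have r0 := inradius2_gt0; have r1 := inradius2_lt1.
set V := fine (lebesgue_Cn R n [set z : Cn R n | (sqn z < 1)%R]).
have V0 : 0 <= V by rewrite fine_ge0 // measure_ge0.
(* Lower bound for c = 1 - |y|^2, valid as soon as |y|^2 < r + eta with eta <= cs; it makes [K] and
   [a] independent of y. *)
pose cs := (1 - r) / 2; have cs0 : 0 < cs by rewrite divr_gt0 // subr_gt0.
pose K := 4 / cs ^+ 2 / cs ^+ n.+1.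
have K0 : 0 < K by apply: divr_gt0; [apply: divr_gt0 => //; exact: exprn_gt0|exact: exprn_gt0].
pose a := r * cs ^+ n * fine (lam W).
have a0 : 0 < a by apply: mulr_gt0 => //; apply: mulr_gt0 => //; exact: exprn_gt0.
(* Makes the term near the pole equal to a / 4. *)
pose del := a / (8 * K * 2 ^+ (4 * n)).
have p0 : 0 < (2 : R) ^+ (4 * n) by rewrite exprn_gt0.
have del0 : 0 < del by apply: divr_gt0 => //; apply: mulr_gt0 => //; exact: mulr_gt0.
pose L := del ^- (2 * n) * (V + 1).
have L0 : 0 < L by apply: mulr_gt0; [rewrite invr_gt0 exprn_gt0|exact: ltr_wpDl].
(* The three bounds ensure r - eta > 0, c >= cs, and that the remaining term, with |y|^2 - s < 2 eta
   for s = r - eta, is at most a / 4. *)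
pose eta := Num.min (r / 2) (Num.min cs (a / (8 * K * L))).
have eta0 : 0 < eta.
  rewrite !lt_min cs0 divr_gt0 //=; apply: divr_gt0 => //; apply: mulr_gt0 => //; exact: mulr_gt0.
have eta1 : eta <= r / 2 by rewrite ge_min lexx.
have eta2 : eta <= cs by rewrite !ge_min lexx orbT.
have eta3 : eta <= a / (8 * K * L) by rewrite !ge_min lexx !orbT.
have reta1 : r + eta <= 1 by move: eta2; rewrite /cs; move: r1; lra.
have [y [yO ry yr]] := exists_exterior eta0 reta1.
have y1 : sqn y < 1 by exact: lt_le_trans reta1.
have s0 : 0 < r - eta by move: r0 eta1; lra.
have sy : r - eta < sqn y by move: ry eta0; lra.
have sO : [set z : Cn R n | sqn z < r - eta] `<=` Omega.
  move=> z /= zs; apply: inradius2_sub => /=; move: zs eta0; lra.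
have := outer_measure_le n0 hball hopen h0 hfin hmean y1 yO s0 sy sO del0.
apply/negP; rewrite -ltNge -/V.
have cc : cs <= yc y by move: eta2 yr; rewrite /yc /cs; lra.
have c0 : 0 < yc y := lt_le_trans cs0 cc.
apply: (@lt_le_trans _ _ a%:E); last first.
  rewrite /a EFinM fineK //; apply: lee_pmul => //.
  - by rewrite lee_fin mulr_ge0 ?exprn_ge0 ?(ltW r0) ?(ltW cs0).
  - rewrite lee_fin ler_pM ?exprn_ge0 ?(ltW r0) ?(ltW cs0) //.
    by rewrite lerXn2r ?nnegrE ?(ltW c0) ?(ltW cs0).
  apply: le_measure; rewrite ?inE //.
    by apply: measurableD => //; exact: measurable_sqn_lt.
  move=> z [Oz /=]; rewrite ltrN2 => rz; split=> //=; apply/negP; rewrite -leNgt.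
  by move: rz eta0; lra.
rewrite lte_fin.
have KK : 4 / yc y ^+ 2 / yc y ^+ n.+1 <= K.
  apply: ler_pM; rewrite ?divr_ge0 ?invr_ge0 ?exprn_ge0 ?(ltW c0) //.
    by rewrite ler_pM2l // lef_pV2 ?posrE ?exprn_gt0 // lerXn2r ?nnegrE ?(ltW c0) ?(ltW cs0).
  by rewrite lef_pV2 ?posrE ?exprn_gt0 // lerXn2r ?nnegrE ?(ltW c0) ?(ltW cs0).
have e1 : K * (2 * (2 ^+ (4 * n) * del)) = a / 4.
  by rewrite /del; field; rewrite !gt_eqF.
have d0 : 0 < del ^- (2 * n) by rewrite invr_gt0 exprn_gt0.
have e2 : del ^- (2 * n) * (sqn y - (r - eta)) * V <= 2 * eta * L.
  rewrite /L mulrAC [leRHS]mulrC; apply: ler_pM.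
  - by rewrite mulr_ge0 // ltW.
  - by rewrite subr_ge0 ltW.
  - by rewrite ler_wpM2l ?(ltW d0) // lerDl.
  - by move: yr; lra.
have e3 : K * (2 * eta * L) <= a / 4.
  have -> : a / 4 = K * (2 * (a / (8 * K * L)) * L) by field; rewrite !gt_eqF.
  by rewrite ler_pM2l // ler_pM2r // ler_pM2l.
have S0 : 0 <= 2 * (2 ^+ (4 * n) * del) + del ^- (2 * n) * (sqn y - (r - eta)) * V.
  apply: addr_ge0; first by apply: mulr_ge0 => //; apply: mulr_ge0; exact: ltW.
  apply: mulr_ge0 => //; apply: mulr_ge0; first exact: ltW.
  by rewrite subr_ge0 ltW.
apply: le_lt_trans (ler_wpM2r S0 KK) _; rewrite mulrDr e1.
have := ler_wpM2l (ltW K0) e2; move: e3 a0; lra.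
Qed.

End inscribed_ball.

Theorem theorem4p1 (R : realType) (n : nat) (hn : (1 <= n)%N)
  (Omega : set (Cn R n))
  (hball : Omega `<=` unit_ball R n)
  (hopen : open Omega) (hconn : connected Omega) (h0 : Omega 0)
  (hfin : (invariant_measure R n Omega < +oo)%E)
  (hcpt : forall K : set (Cn R n), compact K -> K `<=` unit_ball R n ->
     (sup_potential Omega K < +oo)%E)
  (hlim : (fun r : R => ((1 - r ^+ 2) ^ (n%:Z - 2))%:E *
       sup_potential Omega (Omega `&` [set z | enorm z = r]))%E @ 1^'- --> 0%E)
  (hbd : boundary Omega `&` unit_ball R n =
         boundary (closure Omega) `&` unit_ball R n)
  (hmean : forall (f : Cn R n -> R[i]^o) (U : set (Cn R n)),
     closure Omega `&` unit_ball R n `<=` U -> M_harmonic U f ->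
     complex_integrable Omega f ->
     ((fine (invariant_measure R n Omega))^-1)%:C * complex_integral Omega f
       = f 0) :
  exists r : R, [/\ 0 < r, r < 1 & Omega = unit_ball R n `&` [set z | enorm z < r]].
Proof.
have r0 := inradius2_gt0 hopen h0; have r1 := inradius2_lt1 hn hopen hfin.
exists (Num.sqrt (inradius2 Omega)); split; first by rewrite sqrtr_gt0.
  by rewrite -sqrtr1 ltr_sqrt.
have lt_sqrt (z : Cn R n) : (enorm z < Num.sqrt (inradius2 Omega)) = (sqn z < inradius2 Omega).
  by rewrite enorm_ltE ?sqrtr_gt0 // sqr_sqrtr // ltW.
apply/seteqP; split=> z.
  move=> Oz; split; [exact: hball|rewrite /= lt_sqrt].
  exact: (sub_inscribed_ball hn hball hopen h0 hfin hbd hmean Oz).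
by move=> [_ /=]; rewrite lt_sqrt => zr; exact: inradius2_sub.
Qed.
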